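(* Let $k\ge1$ be odd, let $\mathcal T_0$ be a triangulation of $\Omega$ and let $f\in L^2(\Omega)$. There exist constants $0<\rho_2<1$ and $\Lambda_2>0$ such that for all $\mathcal T\in\mathbb T(\mathcal T_0)$, all admissible refinements $\widehat{\mathcal T}\in\mathbb T(\mathcal T)$, all $v\in\mathrm{CR}_{k,0}(\mathcal T)$ and all $\widehat v\in\mathrm{CR}_{k,0}(\widehat{\mathcal T})$, $$\eta(\widehat v;\widehat{\mathcal T}\setminus\mathcal T,f)^2\le\rho_2\,\eta(v;\mathcal T\setminus\widehat{\mathcal T},f)^2+\Lambda_2\,\|\nabla_{\mathcal T}v-\nabla_{\widehat{\mathcal T}}\widehat v\|_{L^2(\Omega)}^2,$$ where $\eta(v;\cdot,f)$ is computed with respect to the mesh $\mathcal T$ and $\eta(\widehat v;\cdot,f)$ with respect to the mesh $\widehat{\mathcal T}$.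
   Context: $\Omega\subseteq\mathbb R^2$ is a bounded open polygonal Lipschitz domain. A triangulation $\mathcal T$ of $\Omega$ is a finite set of closed triangles covering $\overline\Omega$ that is conforming: two distinct triangles intersect in a common edge, a common vertex, or not at all. $|K|$ is the area of $K$. $\mathcal E(K)$ is the set of edges of $K$, $\mathcal E(\mathcal T)$ the set of all edges, $\mathcal E_{\partial\Omega}(\mathcal T)$ the edges contained in $\partial\Omega$, $\mathcal E_\Omega(\mathcal T)$ the remaining (interior) edges, and $\mathcal E_\Omega(K)=\mathcal E(K)\cap\mathcal E_\Omega(\mathcal T)$. Each triangle has a designated newest vertex. Newest vertex bisection (NVB) of a triangle joins its newest vertex to the midpoint of the opposite edge; that midpoint becomes the newest vertex of both children. $\mathbb T(\mathcal T)$ is the set of (conforming) triangulations obtained from $\mathcal T$ by finitely many newest vertex bisections. Each edge $E$ has a fixed ordering $\mathbf z_0,\mathbf z_1$ of its endpoints; $\mathbf t_E=(\mathbf z_1-\mathbf z_0)/|E|$ and $\mathbf n_E=(-t_{E,2},t_{E,1})^T$; for boundary edges the ordering is such that $\mathbf n_E$ is exterior to $\Omega$. For an interior edge, $K_L,K_R$ are the two adjacent triangles with $\mathbf n_E$ pointing into $K_R$; for a boundary edge, $K_L$ is the adjacent triangle. The jump is $[v]_E=v|_{K_L}|_E-v|_{K_R}|_E$ for interior $E$ and $[v]_E=v|_{K_L}|_E$ for boundary $E$ (componentwise for vector fields). $\nabla_{\mathcal T}$ is the piecewise gradient. $\mathbb P_k$ denotes polynomials of total degree at most $k$, and $\mathbb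 P_k(\mathcal T)$ the functions that are in $\mathbb P_k(K)$ on every $K\in\mathcal T$. $\mathrm{CR}_{k,0}(\mathcal T)$ is the space of $v\in\mathbb P_k(\mathcal T)$ such that $[v]_E$ is $L^2(E)$-orthogonal to $\mathbb P_{k-1}(E)$ for all $E\in\mathcal E(\mathcal T)$ (interior and boundary). For $v\in\mathbb P_k(\mathcal T)$, $f\in L^2(\Omega)$, $K\in\mathcal T$ and $\mathcal S\subseteq\mathcal T$: $$\mu(v;K,f)^2=|K|\,\|f+\Delta v\|_{L^2(K)}^2+|K|^{1/2}\sum_{E\in\mathcal E_\Omega(K)}\|[\nabla_{\mathcal T}v]_E\cdot\mathbf n_E\|_{L^2(E)}^2,$$ $$\nu(v;K)^2=|K|^{1/2}\sum_{E\in\mathcal E(K)}\|[\nabla_{\mathcal T}v]_E\cdot\mathbf t_E\|_{L^2(E)}^2,$$ $\eta(v;K,f)^2=\mu(v;K,f)^2+\nu(v;K)^2$ and $\eta(v;\mathcal S,f)^2=\sum_{K\in\mathcal S}\eta(v;K,f)^2$. The same notation is used on $\widehat{\mathcal T}$. *)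

(* Defs.v *)
From HB Require Import structures.
From mathcomp Require Import all_boot all_order all_algebra finmap.
From mathcomp Require Import all_classical all_reals all_analysis.
(* The notations of mpoly clash with those of MathComp-Analysis. *)
From mathcomp Require Import -(notations) mpoly.

Set Implicit Arguments.
Unset Strict Implicit.
Unset Printing Implicit Defensive.

Import Order.TTheory GRing.Theory Num.Theory.
Import numFieldNormedType.Exports.

Local Open Scope classical_set_scope.
Local Open Scope ring_scope.

Section Geometry.
Context {R : realType}.

Definition plane : Type := (R * R)%type.

Definition dot (a b : plane) : R := a.1 * b.1 + a.2 * b.2.
Definition enorm (a : plane) : R := Num.sqrt (dot a a).
Definition det2 (a b : plane) : R := a.1 * b.2 - a.2 * b.1.
(* counterclockwise rotation by a right angle *)
Definition rot (a : plane) : plane := (- a.2, a.1).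

Definition hull (A : {fset plane}) : set plane :=
  [set x | exists w : plane -> R,
    [/\ forall a, a \in A -> 0 <= w a,
        \sum_(a <- A) w a = 1 &
        x = \sum_(a <- A) w a *: a]].

Definition boundary (A : set plane) : set plane := closure A `\` interior A.

Definition polygonal (Om : set plane) : Prop :=
  exists s : seq (plane * plane),
    boundary Om = [set x | exists2 ab, ab \in s & hull [fset ab.1; ab.2]%fset x].

(* After a rotation, Om is locally the strict epigraph of a Lipschitz
   function; e and rot e are the axes of the rotated frame. *)
Definition lipschitz_boundary (Om : set plane) : Prop :=
  forall x, boundary Om x ->
  exists (e : plane) (r h : R) (g : R -> R),
    [/\ dot e e = 1, 0 < r, 0 < h, [lipschitz g s | s in setT] &
     forall s t, `|s| < r -> `|t| < h ->
       (Om (x + s *: e + t *: rot e) <-> g s < t)].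

Record polygonal_lipschitz_domain (Om : set plane) : Prop := {
  pld_open : open Om;
  pld_nonempty : Om !=set0;
  pld_connected : connected Om;
  pld_bounded : bounded_set Om;
  pld_polygonal : polygonal Om;
  pld_lipschitz : lipschitz_boundary Om }.

(* A triangle with its newest vertex: the newest vertex together with the two
   endpoints of the opposite edge. *)
Definition triangle : Type := (plane * {fset plane})%type.

Definition vertices (K : triangle) : {fset plane} := (K.1 |` K.2)%fset.

Definition tri (K : triangle) : set plane := hull (vertices K).

Definition nondegenerate (K : triangle) : Prop :=
  exists a b, K.2 = [fset a; b]%fset /\ det2 (a - K.1) (b - K.1) != 0.

(* An edge is identified with the set of its two endpoints. *)
Definition edge : Type := {fset plane}.

Definition edges (K : triangle) : {fset edge} :=
  [fset E in fpowerset (vertices K) | #|` E| == 2%N]%fset.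

Definition triangulation (Om : set plane) (T : {fset triangle}) : Prop :=
  [/\ forall K, K \in T -> nondegenerate K,
      closure Om = [set x | exists2 K, K \in T & tri K x] &
      forall K K', K \in T -> K' \in T -> K != K' ->
        [\/ exists E, [/\ E \in edges K, E \in edges K' &
                          tri K `&` tri K' = hull E],
            exists z, [/\ z \in vertices K, z \in vertices K' &
                          tri K `&` tri K' = [set z]] |
            tri K `&` tri K' = set0]].

Definition midpoint (E : edge) : plane := 2^-1 *: \sum_(z <- E) z.

Definition children (K : triangle) : {fset triangle} :=
  [fset (midpoint K.2, [fset K.1; z]%fset) | z in K.2]%fset.

Inductive bisections (T : {fset triangle}) : {fset triangle} -> Prop :=
| bisections0 : bisections T T
| bisectionsS T' K : bisections T T' -> K \in T' ->
    bisections T ((T' `\ K) `|` children K)%fset.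

(* The intermediate meshes need not be conforming; the final one is. *)
Definition nvb_refinement (Om : set plane) (T T' : {fset triangle}) : Prop :=
  bisections T T' /\ triangulation Om T'.

Definition boundary_edge (Om : set plane) (E : edge) : Prop :=
  hull E `<=` boundary Om.

Definition interior_edges (Om : set plane) (K : triangle) : {fset edge} :=
  [fset E in edges K | ~~ `[< boundary_edge Om E >]]%fset.

Definition ordering : Type := edge -> plane * plane.

Definition edge_length (o : ordering) (E : edge) : R :=
  enorm ((o E).2 - (o E).1).

Definition tangent (o : ordering) (E : edge) : plane :=
  (edge_length o E)^-1 *: ((o E).2 - (o E).1).

Definition normal (o : ordering) (E : edge) : plane := rot (tangent o E).

(* the point at parameter t of the edge E, run through from z0 to z1 *)
Definition edge_point (o : ordering) (E : edge) (t : R) : plane :=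
  (o E).1 + t *: ((o E).2 - (o E).1).

Definition exterior_normal (Om : set plane) (o : ordering) (E : edge) : Prop :=
  forall t, 0 < t < 1 -> exists2 eps, 0 < eps &
    forall s, 0 < s < eps -> ~ Om (edge_point o E t + s *: normal o E).

Definition edge_ordering (Om : set plane) (o : ordering) : Prop :=
  forall E : edge, #|` E| = 2%N ->
    E = [fset (o E).1; (o E).2]%fset /\
    (boundary_edge Om E -> exterior_normal Om o E).

(* For an edge E of K, K lies on the side of E opposite to the normal
   (K = K_L), resp. on the side that the normal points into (K = K_R). *)
Definition on_left (o : ordering) (E : edge) (K : triangle) : bool :=
  all (fun z => dot (z - (o E).1) (normal o E) <= 0) (vertices K).
Definition on_right (o : ordering) (E : edge) (K : triangle) : bool :=
  all (fun z => 0 <= dot (z - (o E).1) (normal o E)) (vertices K).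

(* A piecewise function is a family indexed by the triangles, so that its
   traces on the edges are those from inside each triangle.  In a triangulation
   each of the two sums has at most one term, K_L resp. K_R; on a boundary edge
   the second one is empty, because the normal is exterior. *)
Definition jump (V : zmodType) (o : ordering) (T : {fset triangle})
    (g : triangle -> plane -> V) (E : edge) (x : plane) : V :=
  \sum_(K <- T | (E \in edges K) && on_left o E K) g K x -
  \sum_(K <- T | (E \in edges K) && on_right o E K) g K x.

End Geometry.
Arguments plane : clear implicits.
Arguments triangle : clear implicits.
Arguments edge : clear implicits.
Arguments ordering : clear implicits.

(* Lebesgue measure on the plane *)
Notation leb2 := (lebesgue_measure \x lebesgue_measure)%E.

Section Integrals.
Context {R : realType}.
Local Open Scope ereal_scope.

Definition int2 (D : set (plane R)) (g : plane R -> R) : \bar R :=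
  \int[leb2]_(x in D) (g x)%:E.

(* the integral over E with respect to arc length *)
Definition int_edge (o : ordering R) (E : edge R) (g : plane R -> R) : \bar R :=
  (edge_length o E)%:E *
  \int[lebesgue_measure]_(t in `[0%R, 1%R]) (g (edge_point o E t))%:E.

(* Square-integrable functions on Om, represented by Borel functions on the
   whole plane. *)
Definition L2 (Om : set (plane R)) (f : plane R -> R) : Prop :=
  measurable_fun setT f /\ int2 Om (fun x => f x ^+ 2)%R < +oo.

End Integrals.

Section PiecewisePolynomials.
Context {R : realType}.

(* {mpoly R[2]} *)
Definition poly2 : Type := mpoly 2 R.

Definition peval (p : poly2) (x : plane R) : R :=
  meval (fun i : 'I_2 => if i == ord0 then x.1 else x.2) p.

Definition grad (p : poly2) (x : plane R) : plane R :=
  (peval (mderiv ord0 p) x, peval (mderiv ord_max p) x).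

Definition laplacian (p : poly2) (x : plane R) : R :=
  peval (mderiv ord0 (mderiv ord0 p)) x +
  peval (mderiv ord_max (mderiv ord_max p)) x.

(* total degree at most k; msize is the degree plus one (and msize 0 = 0) *)
Definition deg_le (k : nat) (p : poly2) : Prop := (msize p <= k.+1)%N.

(* Only the values v K for K in the mesh are relevant. *)
Definition pwpoly : Type := triangle R -> poly2.

Definition pw_deg_le (k : nat) (T : {fset triangle R}) (v : pwpoly) : Prop :=
  forall K, K \in T -> deg_le k (v K).

Definition pw_val (v : pwpoly) (K : triangle R) : plane R -> R := peval (v K).
Definition pw_grad (v : pwpoly) (K : triangle R) : plane R -> plane R :=
  grad (v K).

(* The edge polynomials of degree at most k - 1 are the restrictions to E of
   the bivariate ones. *)
Definition CR0 (k : nat) (o : ordering R) (T : {fset triangle R})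
    (v : pwpoly) : Prop :=
  pw_deg_le k T v /\
  forall E, (exists2 K, K \in T & E \in edges K) ->
  forall q, deg_le k.-1 q ->
    int_edge o E (fun x => jump o T (pw_val v) E x * peval q x) = 0%E.

(* The piecewise gradient as a function on the plane; it is set to 0 on the
   edges and outside the mesh. *)
Definition broken_grad (T : {fset triangle R}) (v : pwpoly) (x : plane R) :
    plane R :=
  \sum_(K <- T | `[< interior (tri K) x >]) grad (v K) x.

Definition area (K : triangle R) : R := fine (leb2 (tri K)).

Section Estimator.
Variables (Om : set (plane R)) (o : ordering R) (T : {fset triangle R}).
Variables (v : pwpoly) (f : plane R -> R).
Local Open Scope ereal_scope.

Definition mu2 (K : triangle R) : \bar R :=
  (area K)%:E * int2 (tri K) (fun x => (f x + laplacian (v K) x) ^+ 2)%R +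
  (Num.sqrt (area K))%:E *
    \sum_(E <- interior_edges Om K)
      int_edge o E (fun x => dot (jump o T (pw_grad v) E x) (normal o E) ^+ 2)%R.

Definition nu2 (K : triangle R) : \bar R :=
  (Num.sqrt (area K))%:E *
    \sum_(E <- edges K)
      int_edge o E (fun x => dot (jump o T (pw_grad v) E x) (tangent o E) ^+ 2)%R.

Definition eta2 (S : {fset triangle R}) : \bar R :=
  \sum_(K <- S) (mu2 K + nu2 K).

End Estimator.

(* the squared L2(Om)-distance of the piecewise gradients *)
Definition grad_dist2 (Om : set (plane R)) (T : {fset triangle R}) (v : pwpoly)
    (T' : {fset triangle R}) (v' : pwpoly) : \bar R :=
  int2 Om (fun x => enorm (broken_grad T v x - broken_grad T' v' x) ^+ 2).

End PiecewisePolynomials.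
Arguments pwpoly : clear implicits.
Arguments poly2 : clear implicits.

(* Main.v *)
Require Import Defs.
From HB Require Import structures.
From mathcomp Require Import all_boot all_order all_algebra finmap.
From mathcomp Require Import all_classical all_reals all_analysis.
From mathcomp Require Import -(notations) mpoly.
From mathcomp Require Import measurable_realfun ring lra.
(* Imported again: MathComp has another [nondegenerate]. *)
Require Import Defs.

(* A triangle K' of the refined mesh that is not in the coarse one lies in a
   coarse triangle K with |K'| <= |K|/2.  Replace v' on K' by the polynomial of
   v on K.  By Young's inequality this costs a factor 5/4 and a multiple of a
   term in w = v - v', and since NVB preserves the ratio of the sum of the
   squared lengths of the two edges at the newest vertex to the area,
   inverse and trace inequalities with uniform constants bound that term by
   the norm of grad w on the triangles sharing an edge with K'.  What is left
   is the estimator of v on the refined mesh: a jump of grad v across a fine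
   edge vanishes if the edge runs through the interior of K, and is up to sign
   the jump across the coarse edge containing it otherwise.  So the fine terms
   sum up to the coarse ones, with a weight reduced by at least the factor
   5/4 * sqrt (1/2) < 9/10. *)

Set Implicit Arguments.
Unset Strict Implicit.
Unset Printing Implicit Defensive.

Import Order.TTheory GRing.Theory Num.Theory.
Import numFieldNormedType.Exports.

Local Open Scope classical_set_scope.
Local Open Scope ring_scope.

(** * Triangles and their edges *)

Section Triangles.
Context {R : realType}.
Implicit Types (K : triangle R) (E : edge R) (x y z w m d : plane R).

(** Three obstacles shape the comparison of jumps on the two meshes: a fine edge need not carry the
    ordering of the coarse edge containing it, left and right depend on this ordering, and the
    meshes between [T] and [T'] need not conform. Traces are therefore taken from the side of a
    point [m] that a direction [d] points into, which refers to no edge. Jumps on both meshes are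
    differences of such traces at the same [m]. Conformity is used for [T] and [T'] only; between
    them, single triangles are followed through their bisections.

    Young's inequality is used as (a - d)^2 <= 5/4 a^2 + 5 d^2. The edge terms set the rate: their
    weight is the square root of the area, so that halving the area gains only sqrt (1/2); the
    volume terms would allow 5/8. Inverse estimates apply on [K'] because the coarse function is a
    single polynomial there. The jump of the difference also involves the triangle across the edge,
    so the trace estimate has to compare two triangles that share an edge. *)

Lemma scale_plane1 (c : R) x : (c *: x).1 = c * x.1. Proof. by []. Qed.
Lemma scale_plane2 (c : R) x : (c *: x).2 = c * x.2. Proof. by []. Qed.
Lemma add_plane1 x y : (x + y).1 = x.1 + y.1. Proof. by []. Qed.
Lemma add_plane2 x y : (x + y).2 = x.2 + y.2. Proof. by []. Qed.
Lemma opp_plane1 x : (- x).1 = - x.1. Proof. by []. Qed.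
Lemma opp_plane2 x : (- x).2 = - x.2. Proof. by []. Qed.
Lemma zero_plane1 : (0 : plane R).1 = 0. Proof. by []. Qed.
Lemma zero_plane2 : (0 : plane R).2 = 0. Proof. by []. Qed.
Definition planeE := (scale_plane1, scale_plane2, add_plane1, add_plane2,
  opp_plane1, opp_plane2, zero_plane1, zero_plane2).

Lemma plane_eqP x y : x.1 = y.1 -> x.2 = y.2 -> x = y.
Proof. by case: x y => [? ?] [? ?] /= -> ->. Qed.

Lemma mem_fset2 x y : x \in [fset x; y]%fset /\ y \in [fset x; y]%fset.
Proof. by rewrite !in_fsetU !in_fset1 (eqxx x) (eqxx y) orbT. Qed.

Lemma mem_fset3 x y z : [/\ x \in [fset x; y; z]%fset,
  y \in [fset x; y; z]%fset & z \in [fset x; y; z]%fset].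
Proof.
by rewrite !in_fsetU !in_fset1 (eqxx x) (eqxx y) (eqxx z) !orbT.
Qed.

Lemma hull3P x y z w : x != y -> x != z -> y != z ->
  hull [fset x; y; z]%fset w <-> exists s t u : R,
    [/\ 0 <= s, 0 <= t, 0 <= u, s + t + u = 1 &
        w = s *: x + t *: y + u *: z].
Proof.
move=> xy xz yz.
have sumE (V : zmodType) (g : plane R -> V) :
    \sum_(a <- [fset x; y; z]%fset) g a = g x + g y + g z.
  rewrite -fsetUA big_fsetU1/= ?inE ?negb_or ?xy// big_fsetU1/= ?inE//.
  by rewrite big_seq_fset1 addrA.
split=> [[g [g0 g1 ->]]|[s [t [u [s0 t0 u0 stu ->]]]]].
  exists (g x), (g y), (g z); rewrite -g1 !sumE.
  have [? ? ?] := mem_fset3 x y z; split=> //; exact: g0.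
exists (fun a => if a == x then s else if a == y then t else u).
split; rewrite ?sumE ?(eqxx x) ?(eqxx y) ?(eqxx z).
- by move=> a _; case: ifP => // _; case: ifP.
- by rewrite (eq_sym y) (negbTE xy) !(eq_sym z) (negbTE xz) (negbTE yz).
- by rewrite (eq_sym y) (negbTE xy) !(eq_sym z) (negbTE xz) (negbTE yz).
Qed.

Lemma hull2P x y w : x != y ->
  hull [fset x; y]%fset w <->
  exists2 t : R, 0 <= t <= 1 & w = x + t *: (y - x).
Proof.
move=> xy.
have sumE (V : zmodType) (g : plane R -> V) :
    \sum_(a <- [fset x; y]%fset) g a = g x + g y.
  by rewrite big_fsetU1/= ?inE ?negb_or ?xy// big_seq_fset1.
split=> [[g [g0 g1 ->]]|[t /andP[t0 t1] ->]].
  have [/g0 gx /g0 gy] := mem_fset2 x y.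
  rewrite sumE in g1; exists (g y); first by apply/andP; split=> //; lra.
  by rewrite sumE (_ : g x = 1 - g y); [apply: plane_eqP; rewrite !planeE; ring|lra].
exists (fun a => if a == x then 1 - t else t).
split; rewrite ?sumE ?(eqxx x) ?(eqxx y) ?(eq_sym y) ?(negbTE xy).
- by move=> a _; case: ifP => // _; lra.
- by ring.
- by apply: plane_eqP; rewrite !planeE; ring.
Qed.

Lemma det2_neq x y : det2 x y != 0 -> [/\ x != 0, y != 0 & x != y].
Proof.
by move=> h; split; apply: contra_neq h => ->; rewrite /det2 ?planeE; ring.
Qed.

(* An enumeration of the vertices of a nondegenerate triangle, in any order. *)
Definition frame K x y z : Prop :=
  vertices K = [fset x; y; z]%fset /\ det2 (y - x) (z - x) != 0.

Lemma frame_rot K x y z : frame K x y z -> frame K y z x.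
Proof.
move=> [Kv D]; split; first by rewrite Kv -fsetUA fsetUC.
by apply: contra_neq D => D; rewrite -[RHS]D /det2 !planeE; ring.
Qed.

Lemma frame_swap K x y z : frame K x y z -> frame K y x z.
Proof.
move=> [Kv D]; split; first by rewrite Kv (fsetUC [fset x]%fset).
by apply: contra_neq D => D; rewrite -[RHS]oppr0 -D /det2 !planeE; ring.
Qed.

Lemma frame_neq K x y z : frame K x y z -> [/\ x != y, x != z & y != z].
Proof.
move=> [_ /det2_neq[]]; rewrite !subr_eq0 => yx zx yz.
by split; rewrite 1?eq_sym//; apply: contra_neq yz => ->.
Qed.

Lemma nondegenerate_frame K : nondegenerate K -> exists x y z, frame K x y z.
Proof.
move=> [a [b [K2 D]]]; exists K.1, a, b; split=> //.
by rewrite /vertices K2 fsetUA.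
Qed.

(* barycentric coordinate of [w] at the first vertex [x] *)
Definition bary x y z w : R := det2 (y - w) (z - w) / det2 (y - x) (z - x).

Lemma bary_sum K x y z w : frame K x y z ->
  bary x y z w + bary y z x w + bary z x y w = 1.
Proof.
move=> f; have [_ D] := f; have [_ D2] := frame_rot f.
have [_ D3] := frame_rot (frame_rot f).
have E2 : det2 (z - y) (x - y) = det2 (y - x) (z - x).
  by rewrite /det2 !planeE; ring.
have E3 : det2 (x - z) (y - z) = det2 (y - x) (z - x).
  by rewrite /det2 !planeE; ring.
rewrite /bary E2 E3 -!mulrDl; apply: (canLR (mulfK D)).
by rewrite mul1r /det2 !planeE; ring.
Qed.

Lemma bary_comb K x y z w : frame K x y z ->
  w = bary x y z w *: x + bary y z x w *: y + bary z x y w *: z.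
Proof.
move=> f; have [_ D] := f.
have E2 : det2 (z - y) (x - y) = det2 (y - x) (z - x).
  by rewrite /det2 !planeE; ring.
have E3 : det2 (x - z) (y - z) = det2 (y - x) (z - x).
  by rewrite /det2 !planeE; ring.
apply: plane_eqP; rewrite !planeE /bary E2 E3; move: D;
  by rewrite /det2 !planeE => D; field.
Qed.

Lemma bary_affine K x y z w d (e : R) : frame K x y z ->
  bary x y z (w + e *: d) =
  bary x y z w + e * (det2 (z - y) d / det2 (y - x) (z - x)).
Proof.
by move=> [_]; rewrite /bary /det2 !planeE => D; field.
Qed.

Lemma triP K x y z w : frame K x y z -> tri K w <->
  [/\ 0 <= bary x y z w, 0 <= bary y z x w & 0 <= bary z x y w].
Proof.
move=> f; have [Kv D] := f; have [xy xz yz] := frame_neq f.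
rewrite /tri Kv; split=> [/(hull3P _ xy xz yz)|[b1 b2 b3]]; last first.
  apply/(hull3P _ xy xz yz).
  exists (bary x y z w), (bary y z x w), (bary z x y w); split=> //.
    exact: (bary_sum _ f).
  exact: (bary_comb _ f).
move=> [s [t [u [s0 t0 u0 stu ->]]]].
have -> : s = 1 - t - u by lra.
have E2 : det2 (z - y) (x - y) = det2 (y - x) (z - x).
  by rewrite /det2 !planeE; ring.
have E3 : det2 (x - z) (y - z) = det2 (y - x) (z - x).
  by rewrite /det2 !planeE; ring.
rewrite /bary E2 E3; split.
- rewrite (_ : det2 _ _ = s * det2 (y - x) (z - x)) ?mulfK//.
  by rewrite (_ : s = 1 - t - u); [rewrite /det2 !planeE; ring|lra].
- rewrite (_ : det2 _ _ = t * det2 (y - x) (z - x)) ?mulfK//.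
  by rewrite /det2 !planeE; ring.
- rewrite (_ : det2 _ _ = u * det2 (y - x) (z - x)) ?mulfK//.
  by rewrite /det2 !planeE; ring.
Qed.

Lemma continuous_bary x y z : continuous (bary x y z).
Proof.
have cf1 (c : R) : continuous (fun w : plane R => c - w.1).
  by move=> w; apply: cvgB; [exact: cvg_cst|exact: cvg_fst].
have cf2 (c : R) : continuous (fun w : plane R => c - w.2).
  by move=> w; apply: cvgB; [exact: cvg_cst|exact: cvg_snd].
move=> w; rewrite /bary /det2.
by apply: cvgM; [apply: cvgB; apply: cvgM; [apply: cf1|apply: cf2|apply: cf2|apply: cf1]|exact: cvg_cst].
Qed.

Lemma near0_affine_gt0 (c b : R) : 0 < c ->
  \forall e \near 0^'+, 0 < c + e * b.
Proof.
move=> c0; have b1 : 0 < `|b| + 1 by rewrite ltr_wpDl.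
near=> e; have e0 : 0 < e by near: e; exact: nbhs_right_gt.
have : e < c / (`|b| + 1).
  by near: e; apply: nbhs_right_lt; rewrite divr_gt0.
rewrite ltr_pdivlMr// => ec.
have := ler_norm (- b); rewrite normrN => bb.
have : e * (- b) <= e * `|b| by rewrite ler_wpM2l// ltW.
by nra.
Unshelve. all: by end_near. Qed.

Lemma near0_affine_lt0 (c b : R) : c < 0 ->
  \forall e \near 0^'+, c + e * b < 0.
Proof.
move=> c0; have := @near0_affine_gt0 (- c) (- b); rewrite oppr_gt0 => /(_ c0).
by apply: filterS => e; rewrite mulrN -opprD oppr_gt0.
Qed.

Lemma near_add (A : set (plane R)) w d : nbhs w A ->
  \forall e \near (0:R)^'+, A (w + e *: d).
Proof.
move=> wA; suff h : (w + e *: d) @[e --> (0:R)^'+] --> w by exact: h.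
apply: cvg_at_right_filter; rewrite -[X in _ --> X]addr0.
apply: cvgD; first exact: cvg_cst.
by rewrite -[X in _ --> X](scale0r d); apply: cvgZr_tmp; exact: cvg_id.
Qed.

End Triangles.

(** * Interiors of triangles and relative interiors of edges *)

Section Edges.
Context {R : realType}.
Implicit Types (K : triangle R) (E : edge R) (x y z w m d : plane R).

Lemma near0_ex (P : R -> Prop) : (\forall e \near (0:R)^'+, P e) ->
  exists e, 0 < e /\ P e.
Proof. by move=> h; exact: (filter_ex (filterI (nbhs_right_gt 0) h)). Qed.

Lemma interior_triP K x y z w : frame K x y z -> interior (tri K) w <->
  [/\ 0 < bary x y z w, 0 < bary y z x w & 0 < bary z x y w].
Proof.
move=> f.
have pos a b c : frame K a b c -> interior (tri K) w -> 0 < bary a b c w.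
  move=> g wi; have /(triP _ g)[b0 _ _] := interior_subset wi.
  rewrite lt_neqAle b0 andbT; apply/negP => /eqP bE.
  (* If the coordinate at [a] vanishes at [w], moving from [w] away from [a] by the step [e] turns
     it into [- e], so every such step leaves the triangle. *)
  have [e [e0]] := near0_ex (near_add (w - a) wi).
  move=> /(triP _ g)[+ _ _]; rewrite (bary_affine _ _ _ g) -bE add0r.
  suff -> : det2 (c - b) (w - a) / det2 (b - a) (c - a) = bary a b c w - 1.
    by rewrite -bE; lra.
  by case: g => _; rewrite /bary /det2 !planeE => D; field.
split=> [wi|[b1 b2 b3]].
  by split; [exact: (pos _ _ _ f wi)|exact: (pos _ _ _ (frame_rot f) wi)
    |exact: (pos _ _ _ (frame_rot (frame_rot f)) wi)].
have cp a b c : 0 < bary a b c w -> \forall w' \near w, 0 < bary a b c w'.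
  by move=> b0; exact: (cvgr_gt _ (@continuous_bary _ a b c w) _ b0).
rewrite /interior /=; near=> w'; apply/(triP _ f); split;
  apply/ltW; near: w'; exact: cp.
Unshelve. all: by end_near. Qed.

Lemma card2_fset (E : edge R) : #|` E| = 2%N ->
  exists a b, a != b /\ E = [fset a; b]%fset.
Proof.
move=> E2; have [E0|[a aE]] := fset_0Vmem E; first by rewrite E0 cardfs0 in E2.
have := cardfsD1 a E; rewrite aE E2 => -[/esym/eqP/cardfs1P[b bE]].
exists a, b; split; last by rewrite -(fsetD1K aE) bE.
have : b \in (E `\ a)%fset by rewrite bE fset11.
by rewrite in_fsetD1 eq_sym => /andP[].
Qed.

Lemma edgesE K E : (E \in edges K) = (E `<=` vertices K)%fset && (#|` E| == 2)%N.
Proof. by rewrite /edges !inE /= fpowersetE. Qed.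

Lemma frame_edge K x y z : frame K x y z -> [fset x; y]%fset \in edges K.
Proof.
move=> f; have [xy _ _] := frame_neq f.
by rewrite edgesE f.1 fsubsetUl cardfs2 xy.
Qed.

Lemma edge_frame K a b : Defs.nondegenerate K -> [fset a; b]%fset \in edges K ->
  exists z, frame K a b z.
Proof.
move=> /nondegenerate_frame[x [y [z f]]].
have f2 := frame_rot f; have f3 := frame_rot f2.
have s1 := frame_swap f; have s2 := frame_swap f2; have s3 := frame_swap f3.
rewrite edgesE cardfs2 => /andP[/fsubsetP sub].
have [ma mb] := mem_fset2 a b.
move: (sub _ ma) (sub _ mb); rewrite f.1 !in_fsetU !in_fset1.
case/orP=> [/orP[]|] /eqP ->; case/orP=> [/orP[]|] /eqP -> => ab;
  rewrite ?(eqxx x) ?(eqxx y) ?(eqxx z)// in ab;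
  by [exists z|exists x|exists y].
Qed.

Lemma edge_frame_ex K E : Defs.nondegenerate K -> E \in edges K ->
  exists x y z, E = [fset x; y]%fset /\ frame K x y z.
Proof.
move=> nK EK; move: (EK); rewrite edgesE => /andP[_ /eqP/card2_fset[a [b [_ EE]]]].
rewrite EE in EK *; have [z f] := edge_frame nK EK.
by exists a, b, z.
Qed.

Lemma fset2_inj (a b c d : plane R) : a != b -> [fset a; b]%fset = [fset c; d]%fset ->
  (a = c /\ b = d) \/ (a = d /\ b = c).
Proof.
move=> ab e.
have [ma mb] := mem_fset2 a b; move: ma mb; rewrite e !in_fsetU !in_fset1.
case/orP=> /eqP ac; case/orP=> /eqP bc; rewrite ?ac ?bc; auto;
  by rewrite ac bc eqxx in ab.
Qed.

(* the relative interior of an edge *)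
Definition openseg E m : Prop := exists x y (t : R),
  [/\ E = [fset x; y]%fset, x != y, 0 < t < 1 & m = x + t *: (y - x)].

Lemma openseg_hull E m : openseg E m -> hull E m.
Proof.
move=> [x [y [t [-> xy /andP[t0 t1] ->]]]]; apply/(hull2P _ xy).
by exists t => //; apply/andP; split; exact: ltW.
Qed.

Lemma openseg_fset2 (a b m : plane R) : openseg [fset a; b]%fset m ->
  a != b /\ exists2 t : R, 0 < t < 1 & m = a + t *: (b - a).
Proof.
move=> [x [y [t [e xy t01 ->]]]]; have [[xa yb]|[xb ya]] := fset2_inj xy (esym e).
  by subst; split=> //; exists t.
subst; split; first by rewrite eq_sym.
exists (1 - t); first by move: t01 => /andP[? ?]; apply/andP; split; lra.
by apply: plane_eqP; rewrite !planeE; ring.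
Qed.

Lemma edge_bary K x y z w : frame K x y z ->
  hull [fset x; y]%fset w -> bary z x y w = 0.
Proof.
move=> f; have [xy _ _] := frame_neq f => /(hull2P _ xy)[t _ ->].
by rewrite /bary (_ : det2 _ _ = 0) ?mul0r// /det2 !planeE; ring.
Qed.

Lemma openseg_bary K x y z m : frame K x y z -> openseg [fset x; y]%fset m ->
  0 < bary x y z m /\ 0 < bary y z x m.
Proof.
move=> f /openseg_fset2[xy [t /andP[t0 t1] ->]]; move: f => [_].
rewrite /bary => D.
have -> : det2 (y - (x + t *: (y - x))) (z - (x + t *: (y - x))) / det2 (y - x) (z - x) = 1 - t.
  by move: D; rewrite /det2 !planeE => D; field.
have -> : det2 (z - (x + t *: (y - x))) (x - (x + t *: (y - x))) / det2 (z - y) (x - y) = t.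
  have : det2 (z - y) (x - y) != 0.
    by apply: contra_neq D => D; rewrite -[RHS]D /det2 !planeE; ring.
  by rewrite /det2 !planeE => D'; field.
by split; lra.
Qed.

Lemma hull_edge_tri K E m : E \in edges K -> Defs.nondegenerate K ->
  hull E m -> tri K m.
Proof.
move=> EK nK; have [x [y [z [-> f]]]] := edge_frame_ex nK EK.
have [xy _ _] := frame_neq f => /[dup] /(edge_bary f) bz /(hull2P _ xy)[t /andP[t0 t1] mE].
apply/(triP _ f); rewrite bz; split=> //.
  suff -> : bary x y z m = 1 - t by rewrite subr_ge0.
  by rewrite mE; move: f => [_]; rewrite /bary /det2 !planeE => D; field.
suff -> : bary y z x m = t by [].
have [_ ] := frame_rot f.
by rewrite mE /bary /det2 !planeE => D'; field.
Qed.

Lemma hull_edge_not_interior K E m : E \in edges K -> Defs.nondegenerate K ->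
  hull E m -> ~ interior (tri K) m.
Proof.
move=> EK nK; have [x [y [z [-> f]]]] := edge_frame_ex nK EK.
by move=> /(edge_bary f) bz /(interior_triP _ f)[_ _]; rewrite bz ltxx.
Qed.

Lemma vertex_not_interior K z : Defs.nondegenerate K -> z \in vertices K ->
  ~ interior (tri K) z.
Proof.
move=> nK zK; have [a [b [c f]]] := nondegenerate_frame nK.
suff : exists b c, frame K z b c.
  move=> [b' [c' g]] /(interior_triP _ g)[_ + _].
  by rewrite (_ : bary _ _ _ _ = 0) ?ltxx// /bary (_ : det2 _ _ = 0) ?mul0r// /det2 !planeE; ring.
move: zK; rewrite f.1 !in_fsetU !in_fset1 => /orP[/orP[]|] /eqP ->.
- by exists b, c.
- by exists c, a; exact: frame_rot.
- by exists a, b; do 2 apply: frame_rot.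
Qed.

Lemma bary_swap x y z w : bary x z y w = bary x y z w.
Proof.
rewrite /bary (_ : det2 (z - w) _ = - det2 (y - w) (z - w)); last first.
  by rewrite /det2; ring.
rewrite (_ : det2 (z - x) _ = - det2 (y - x) (z - x)); last first.
  by rewrite /det2; ring.
by rewrite invrN mulrNN.
Qed.

(** A point in the relative interior of [E] has positive coordinates at both endpoints of [E], while
    each of the other two edges lies in the zero set of one of these coordinates. *)
Lemma openseg_edge_uniq K E E' m : Defs.nondegenerate K ->
  E \in edges K -> E' \in edges K -> openseg E m -> hull E' m -> E' = E.
Proof.
move=> nK EK E'K; have [x [y [z [EE f]]]] := edge_frame_ex nK EK.
rewrite EE => om; have [bx by_] := openseg_bary f om.
have h1 : ~ hull [fset x; z]%fset m.
  move/(edge_bary (frame_swap (frame_rot (frame_rot f)))); rewrite bary_swap.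
  by move=> b0; rewrite b0 ltxx in by_.
have h2 : ~ hull [fset y; z]%fset m.
  by move/(edge_bary (frame_rot f)) => b0; rewrite b0 ltxx in bx.
move: E'K; rewrite edgesE f.1 => /andP[+ /eqP/card2_fset[a [b [ab E'E]]]].
have [ma mb] := mem_fset2 a b.
subst E' => /fsubsetP sub; move: (sub _ ma) (sub _ mb) ab.
rewrite !in_fsetU !in_fset1.
case/orP=> [/orP[]|] /eqP ->; case/orP=> [/orP[]|] /eqP -> => ab;
  first [by rewrite ?(eqxx x) ?(eqxx y) ?(eqxx z) in ab | by [] |
    by rewrite fsetUC | by move/h1 | by move/h2 | by rewrite fsetUC => /h1 |
    by rewrite fsetUC => /h2].
Qed.

End Edges.

(** * Newest vertex bisection *)

Section Bisection.
Context {R : realType}.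
Implicit Types (K : triangle R) (E : edge R) (x y z w m d : plane R).
Implicit Types (T : {fset triangle R}).

(** A rotation and a transposition generate all permutations of the three vertices, so a property
    that respects these two passes from one enumeration to any other. *)
Lemma frame_ind K (P : plane R -> plane R -> plane R -> Prop) x y z x' y' z' :
  (forall a b c, P a b c -> P b c a) -> (forall a b c, P a b c -> P b a c) ->
  frame K x y z -> frame K x' y' z' -> P x y z -> P x' y' z'.
Proof.
move=> Prot Pswap f g Pxyz.
have [xy xz yz] := frame_neq f.
have [xy' xz' yz'] := frame_neq g.
have P2 := Prot _ _ _ Pxyz; have P3 := Prot _ _ _ P2.
have Q1 := Pswap _ _ _ Pxyz; have Q2 := Pswap _ _ _ P2; have Q3 := Pswap _ _ _ P3.
have [] := mem_fset3 x' y' z'; rewrite -g.1 f.1 !in_fsetU !in_fset1.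
case/orP=> [/orP[]|] /eqP ex; case/orP=> [/orP[]|] /eqP ey;
  case/orP=> [/orP[]|] /eqP ez; subst => //;
  by rewrite ?(eqxx x) ?(eqxx y) ?(eqxx z) in xy' xz' yz'.
Qed.

Lemma frame_det K x y z x' y' z' : frame K x y z -> frame K x' y' z' ->
  `|det2 (y - x) (z - x)| = `|det2 (y' - x') (z' - x')|.
Proof.
move=> f g; apply: (frame_ind (P := fun a b c =>
  `|det2 (y - x) (z - x)| = `|det2 (b - a) (c - a)|) _ _ f g) => // a b c ->.
  by congr (`|_|); rewrite /det2 !planeE; ring.
by rewrite -normrN; congr (`|_|); rewrite /det2 !planeE; ring.
Qed.

Lemma tri_comb K x y z w : frame K x y z -> tri K w <-> exists s t u : R,
  [/\ 0 <= s, 0 <= t, 0 <= u, s + t + u = 1 & w = s *: x + t *: y + u *: z].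
Proof.
by move=> f; have [xy xz yz] := frame_neq f; rewrite /tri f.1; exact: hull3P.
Qed.

Lemma frame_pair (p a b : plane R) : det2 (a - p) (b - p) != 0 ->
  frame (p, [fset a; b]%fset) p a b.
Proof. by move=> D; split=> //; rewrite /vertices fsetUA. Qed.

(** The endpoint that the child keeps is named [a]; exchanging [a] and [b] gives the other child, so
    whatever is proved from this form covers both. *)
Lemma child_frame K K' : Defs.nondegenerate K -> K' \in children K ->
  exists p a b, [/\ K = (p, [fset a; b]%fset), det2 (a - p) (b - p) != 0 &
    K' = (2^-1 *: (a + b), [fset p; a]%fset)].
Proof.
move=> [a [b [K2 D]]] /imfsetP[z /= + K'E].
have [_ _] := det2_neq D; rewrite (inj_eq (addIr _)) => ab.
have mE : midpoint K.2 = 2^-1 *: (a + b).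
  by rewrite /midpoint K2 big_fsetU1/= ?inE// big_seq_fset1.
rewrite K2 in_fsetU !in_fset1 => /orP[] /eqP zE.
- exists K.1, a, b; split=> //; first by rewrite -K2; case: (K).
  by rewrite K'E mE zE.
- exists K.1, b, a; split=> //; first by rewrite fsetUC -K2; case: (K).
    by apply: contra_neq D => D; rewrite -[RHS]oppr0 -D /det2; ring.
  by rewrite K'E mE zE addrC.
Qed.

Lemma child_det (p a b : plane R) :
  det2 (p - 2^-1 *: (a + b)) (a - 2^-1 *: (a + b)) =
  det2 (a - p) (b - p) / 2.
Proof. by rewrite /det2 !planeE; field. Qed.

Lemma child_det_neq0 (p a b : plane R) : det2 (a - p) (b - p) != 0 ->
  det2 (p - 2^-1 *: (a + b)) (a - 2^-1 *: (a + b)) != 0.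
Proof. by rewrite child_det mulf_eq0 invr_eq0 pnatr_eq0 orbF. Qed.

Lemma child_nondegenerate K K' : Defs.nondegenerate K -> K' \in children K ->
  Defs.nondegenerate K'.
Proof.
move=> nK /(child_frame nK)[p [a [b [_ D ->]]]]; exists p, a; split=> //.
exact: child_det_neq0.
Qed.

Lemma child_tri K K' : Defs.nondegenerate K -> K' \in children K ->
  tri K' `<=` tri K.
Proof.
move=> nK /(child_frame nK)[p [a [b [-> D ->]]]] w.
move/(tri_comb _ (frame_pair (child_det_neq0 D))) => [s [t [u [s0 t0 u0 stu ->]]]].
apply/(tri_comb _ (frame_pair D)); exists t, (u + s / 2), (s / 2).
by split; [|lra|lra|lra|apply: plane_eqP; rewrite !planeE; field].
Qed.

Lemma children_cover K w : Defs.nondegenerate K -> tri K w ->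
  exists2 K', K' \in children K & tri K' w.
Proof.
move=> nK; have [a [b [K2 D]]] := nK.
have [_ _] := det2_neq D; rewrite (inj_eq (addIr _)) => ab.
have mE : midpoint K.2 = 2^-1 *: (a + b).
  by rewrite /midpoint K2 big_fsetU1/= ?inE// big_seq_fset1.
have D' : det2 (b - K.1) (a - K.1) != 0.
  by apply: contra_neq D => D; rewrite -[RHS]oppr0 -D /det2; ring.
have f : frame K K.1 a b by split=> //; rewrite /vertices K2 fsetUA.
move/(tri_comb _ f) => [s [t [u [s0 t0 u0 stu ->]]]].
have [ma mb] := mem_fset2 a b.
(* The bisector consists of the points with equal coordinates at [a] and [b]; their order tells in
   which child [w] lies. *)
have [tu|/ltW tu] := leP u t.
- exists (2^-1 *: (a + b), [fset K.1; a]%fset).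
    by apply/imfsetP; exists a; rewrite /= ?mE ?K2.
  apply/(tri_comb _ (frame_pair (child_det_neq0 D))).
  exists (2 * u), s, (t - u).
  by split; [lra|lra|lra|lra|apply: plane_eqP; rewrite !planeE; field].
- exists (2^-1 *: (b + a), [fset K.1; b]%fset).
    by apply/imfsetP; exists b; rewrite /= ?mE 1?addrC ?K2.
  apply/(tri_comb _ (frame_pair (child_det_neq0 D'))).
  exists (2 * t), s, (u - t).
  by split; [lra|lra|lra|lra|apply: plane_eqP; rewrite !planeE; field].
Qed.

(** The bisection history of a single triangle. It involves no mesh, hence no conformity, and can be
    followed through the intermediate meshes. *)
Inductive descendant K : triangle R -> Prop :=
| descendant0 : descendant K K
| descendantS K1 K2 : descendant K K1 -> K2 \in children K1 -> descendant K K2.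

Lemma descendant_nondegenerate K K' : Defs.nondegenerate K -> descendant K K' ->
  Defs.nondegenerate K'.
Proof. by move=> nK; elim=> // K1 K2 _ n1 ch; exact: child_nondegenerate n1 ch. Qed.

Lemma descendant_tri K K' : Defs.nondegenerate K -> descendant K K' ->
  tri K' `<=` tri K.
Proof.
move=> nK; elim=> // K1 K2 d12 sub ch; apply: subset_trans sub.
by apply: child_tri => //; exact: descendant_nondegenerate d12.
Qed.

Lemma descendant_det K K' x y z x' y' z' : Defs.nondegenerate K ->
  descendant K K' -> frame K x y z -> frame K' x' y' z' ->
  K' = K \/ `|det2 (y' - x') (z' - x')| <= `|det2 (y - x) (z - x)| / 2.
Proof.
move=> nK dKK' f; elim: dKK' x' y' z' => [|K1 K2 d12 IH ch] x' y' z' g; first by left.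
right; have n1 := descendant_nondegenerate nK d12.
have [p [a [b [K1E D K2E]]]] := child_frame n1 ch.
have := frame_pair (child_det_neq0 D); rewrite -K2E => g2.
have := frame_pair D; rewrite -K1E => g1.
rewrite -(frame_det g2 g) child_det normrM normfV normr_nat.
have D0 := normr_ge0 (det2 (y - x) (z - x)).
have [K1K|le1] := IH _ _ _ g1; last by lra.
by rewrite K1K in g1; rewrite -(frame_det f g1).
Qed.

Lemma bisections_ancestor T T' : bisections T T' ->
  forall K', K' \in T' -> exists2 K, K \in T & descendant K K'.
Proof.
elim=> [K' K'T|T1 K1 _ IH K1T K']; first by exists K' => //; exact: descendant0.
rewrite in_fsetU in_fsetD1 => /orP[/andP[_ /IH//]|ch].
by have [K KT dK] := IH _ K1T; exists K => //; exact: descendantS ch.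
Qed.

Lemma bisections_nondegenerate T T' : (forall K, K \in T -> Defs.nondegenerate K) ->
  bisections T T' -> forall K', K' \in T' -> Defs.nondegenerate K'.
Proof.
move=> nT bis K' /(bisections_ancestor bis)[K /nT nK].
exact: descendant_nondegenerate.
Qed.

Lemma bisections_cover T T' : (forall K, K \in T -> Defs.nondegenerate K) ->
  bisections T T' -> forall K w, K \in T -> tri K w ->
  exists K', [/\ K' \in T', descendant K K' & tri K' w].
Proof.
move=> nT; elim=> [K w KT Kw|T1 K1 bis IH K1T K w KT Kw].
  by exists K; split=> //; exact: descendant0.
have [K2 [K2T d2 K2w]] := IH _ _ KT Kw.
have [K21|K21] := eqVneq K2 K1; last first.
  by exists K2; split=> //; rewrite in_fsetU in_fsetD1 K21 K2T.
have n1 := bisections_nondegenerate nT bis K1T.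
rewrite K21 in d2 K2w; have [K' ch K'w] := children_cover n1 K2w.
by exists K'; split=> //; [rewrite in_fsetU ch orbT|exact: descendantS ch].
Qed.

(* The ratio of [|a - p|^2 + |b - p|^2] to the area does not change under
   newest vertex bisection, so this bound is inherited by all descendants. *)
Definition shape_regular (C : R) K : Prop := exists p a b,
  [/\ K = (p, [fset a; b]%fset), det2 (a - p) (b - p) != 0 &
   dot (a - p) (a - p) + dot (b - p) (b - p) <= C * `|det2 (a - p) (b - p)|].

Lemma shape_regular_nondegenerate C K : shape_regular C K -> Defs.nondegenerate K.
Proof. by move=> [p [a [b [-> D _]]]]; exists a, b. Qed.

(** Parallelogram law: with e = a - p and f = b - p, the edges at the new vertex are, up to sign, (e
    + f)/2 and (e - f)/2. Their squared lengths add up to half of |e|^2 + |f|^2, and the determinant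
    is halved as well. *)
Lemma shape_regular_descendant C K K' : shape_regular C K -> descendant K K' ->
  shape_regular C K'.
Proof.
move=> sK; elim=> // K1 K2 d12 s1 ch.
have [p [a [b [K1E D K2E]]]] := child_frame (shape_regular_nondegenerate s1) ch.
have [p' [a' [b' [K1E' D' le]]]] := s1.
exists (2^-1 *: (a + b)), p, a; split=> //; first exact: child_det_neq0.
have [pp /fset2_inj aabb] : p' = p /\ [fset a'; b']%fset = [fset a; b]%fset.
  by move: K1E; rewrite K1E' => -[].
rewrite child_det normrM normfV normr_nat.
have a'b' : a' != b' by have [_ _] := det2_neq D'; rewrite (inj_eq (addIr _)).
have E1 : `|det2 (a - p) (b - p)| = `|det2 (a' - p') (b' - p')|.
  rewrite pp; case: (aabb a'b') => -[-> ->] //.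
  by rewrite -normrN; congr (`|_|); rewrite /det2; ring.
have E2 : dot (a - p) (a - p) + dot (b - p) (b - p) =
    dot (a' - p') (a' - p') + dot (b' - p') (b' - p').
  by rewrite pp; case: (aabb a'b') => -[-> ->] //; rewrite addrC.
rewrite E1; apply: (@le_trans _ _ (2^-1 * (dot (a' - p') (a' - p') + dot (b' - p') (b' - p')))).
  by rewrite -E2 /dot !planeE; lra.
by rewrite mulrA [leRHS]mulrC ler_wpM2l.
Qed.

Lemma shape_regular_le C C' K : C <= C' -> shape_regular C K -> shape_regular C' K.
Proof.
move=> CC' [p [a [b [KE D le]]]]; exists p, a, b; split=> //.
by apply: le_trans le _; rewrite ler_wpM2r.
Qed.

(** The factor 2 is for the edge opposite to the newest vertex: |a - b|^2 <= 2 (|a - p|^2 + |b -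
    p|^2). *)
Lemma shape_regular_edge C K x y z : shape_regular C K -> frame K x y z ->
  dot (y - x) (y - x) <= 2 * C * `|det2 (y - x) (z - x)|.
Proof.
move=> [p [a [b [KE D le]]]] f; have := frame_pair D; rewrite -KE => g.
rewrite (frame_det f g) -mulrA; set M := C * _ in le *.
pose Q u v w := [/\ dot (v - u) (v - u) <= 2 * M, dot (w - v) (w - v) <= 2 * M
  & dot (u - w) (u - w) <= 2 * M].
have sq (u : R) : 0 <= u ^+ 2 by exact: sqr_ge0.
suff [] : Q x y z by [].
apply: (frame_ind (P := Q) _ _ g f) => [u v w []|u v w []|].
- by split.
- have E u' v' : dot (u' - v') (u' - v') = dot (v' - u') (v' - u').
    by rewrite /dot !planeE; ring.
  by split; rewrite E.
- have h1 : 0 <= dot (a - p) (a - p) by rewrite /dot addr_ge0// -expr2.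
  have h2 : 0 <= dot (b - p) (b - p) by rewrite /dot addr_ge0// -expr2.
  split; first by lra.
  + have := sq ((b - p).1 + (a - p).1); have := sq ((b - p).2 + (a - p).2).
    by move: le h1 h2; rewrite /dot !planeE; nra.
  + by move: le h1 h2; rewrite /dot !planeE; nra.
Qed.

Lemma fset_shape_regular T : (forall K, K \in T -> Defs.nondegenerate K) ->
  exists2 C : R, 0 < C & forall K, K \in T -> shape_regular C K.
Proof.
move=> nT; have : forall s : seq (triangle R), {subset s <= T} ->
    exists2 C : R, 0 < C & forall K, K \in s -> shape_regular C K.
  elim=> [_|K s IH sub]; first by exists 1.
  have [|C C0 h] := IH; first by move=> K' K's; apply: sub; rewrite inE K's orbT.
  have [a [b [K2 D]]] : Defs.nondegenerate K by apply/nT/sub; rewrite inE eqxx.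
  have D0 : 0 < `|det2 (a - K.1) (b - K.1)| by rewrite normr_gt0.
  pose c := (dot (a - K.1) (a - K.1) + dot (b - K.1) (b - K.1)) /
    `|det2 (a - K.1) (b - K.1)|.
  exists (Num.max C c); first by rewrite lt_max C0.
  move=> K'; rewrite inE => /orP[/eqP ->|/h]; last first.
    by apply: shape_regular_le; rewrite le_max lexx.
  exists K.1, a, b; split=> //; first by rewrite -K2; case: (K).
  by rewrite -ler_pdivrMr// -/c le_max lexx orbT.
by move=> /(_ (enum_fset T)); apply.
Qed.

End Bisection.

(** * Conformity and jumps *)

Section Conformity.
Context {R : realType}.
Implicit Types (K : triangle R) (E : edge R) (x y z w m d : plane R).
Implicit Types (T : {fset triangle R}) (o : ordering R).
Variable Om : set (plane R).

Lemma triangulation_nondegenerate T : triangulation Om T ->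
  forall K, K \in T -> Defs.nondegenerate K.
Proof. by case. Qed.

Lemma triangulation_interior T K K' m : triangulation Om T ->
  K \in T -> K' \in T -> interior (tri K) m -> tri K' m -> K = K'.
Proof.
move=> [nT _ conf] KT K'T Km K'm; apply/eqP/negPn/negP => KK'.
have KK'm : (tri K `&` tri K') m by split=> //; exact: interior_subset.
have [[E [EK _ I]]|[z [zK _ I]]|I] := conf _ _ KT K'T KK'; rewrite I in KK'm => //.
  exact: hull_edge_not_interior EK (nT _ KT) KK'm Km.
rewrite /set1 /= in KK'm; subst z.
exact: vertex_not_interior (nT _ KT) zK Km.
Qed.

Lemma openseg_not_vertex K E z : Defs.nondegenerate K -> E \in edges K ->
  z \in vertices K -> ~ openseg E z.
Proof.
move=> nK EK zK; have [a [b [c [-> f]]]] := edge_frame_ex nK EK.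
move=> /(openseg_bary f)[]; move: zK.
rewrite f.1 !in_fsetU !in_fset1 => /orP[/orP[]|] /eqP ->.
- move=> _; rewrite (_ : bary _ _ _ _ = 0) ?ltxx//.
  by rewrite /bary (_ : det2 _ _ = 0) ?mul0r// /det2 !planeE; ring.
- rewrite (_ : bary _ _ _ _ = 0) ?ltxx//.
  by rewrite /bary (_ : det2 _ _ = 0) ?mul0r// /det2 !planeE; ring.
- rewrite (_ : bary _ _ _ _ = 0) ?ltxx//.
  by rewrite /bary (_ : det2 _ _ = 0) ?mul0r// /det2 !planeE; ring.
Qed.

(** Conformity excludes hanging nodes: a common edge through [m] must be [E] itself, and no vertex
    of [K] lies in the relative interior of [E]. *)
Lemma triangulation_edge T K K' E m : triangulation Om T ->
  K \in T -> K' \in T -> E \in edges K -> openseg E m -> tri K' m ->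
  E \in edges K'.
Proof.
move=> [nT _ conf] KT K'T EK om K'm; have [<-//|KK'] := eqVneq K K'.
have KK'm : (tri K `&` tri K') m.
  by split=> //; exact: hull_edge_tri EK (nT _ KT) (openseg_hull om).
have [[E2 [E2K E2K' I]]|[z [zK _ I]]|I] := conf _ _ KT K'T KK'; rewrite I in KK'm => //.
  by rewrite -(openseg_edge_uniq (nT _ KT) EK E2K om KK'm).
rewrite /set1 /= in KK'm; subst z.
by have := openseg_not_vertex (nT _ KT) EK zK om.
Qed.

(* [K] lies on the side of [m] that the direction [d] points into *)
Definition sided K m d : Prop :=
  \forall e \near (0:R)^'+, interior (tri K) (m + e *: d).

Lemma bary_step K x y z m d (e : R) : frame K x y z ->
  openseg [fset x; y]%fset m ->
  bary z x y (m + e *: d) = e * (det2 (y - x) d / det2 (y - x) (z - x)).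
Proof.
move=> f om; rewrite (bary_affine _ _ _ (frame_rot (frame_rot f))).
rewrite (edge_bary f (openseg_hull om)) add0r.
by rewrite (_ : det2 (x - z) _ = det2 (y - x) (z - x))// /det2 !planeE; ring.
Qed.

Lemma sidedP K x y z m d : frame K x y z -> openseg [fset x; y]%fset m ->
  sided K m d <-> 0 < det2 (y - x) d / det2 (y - x) (z - x).
Proof.
move=> f om; split=> [/near0_ex[e [e0]]|c0].
  by move=> /(interior_triP _ f)[_ _]; rewrite (bary_step _ _ f om) pmulr_rgt0.
have [b1 b2] := openseg_bary f om.
near=> e; have e0 : 0 < e by near: e; exact: nbhs_right_gt.
apply/(interior_triP _ f); split.
- rewrite (bary_affine _ _ _ f); near: e; exact: near0_affine_gt0.
- rewrite (bary_affine _ _ _ (frame_rot f)); near: e; exact: near0_affine_gt0.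
- by rewrite (bary_step _ _ f om) mulr_gt0.
Unshelve. all: by end_near. Qed.

Lemma not_tri_near K m d : Defs.nondegenerate K -> ~ tri K m ->
  \forall e \near (0:R)^'+, ~ tri K (m + e *: d).
Proof.
move=> /nondegenerate_frame[x [y [z f]]].
have f2 := frame_rot f; have f3 := frame_rot f2 => nK.
have [b1|b1] := ltP (bary x y z m) 0.
  near=> e; move=> /(triP _ f)[+ _ _]; apply/negP; rewrite -ltNge.
  rewrite (bary_affine _ _ _ f); near: e; exact: near0_affine_lt0.
have [b2|b2] := ltP (bary y z x m) 0.
  near=> e; move=> /(triP _ f)[_ + _]; apply/negP; rewrite -ltNge.
  rewrite (bary_affine _ _ _ f2); near: e; exact: near0_affine_lt0.
have [b3|b3] := ltP (bary z x y m) 0.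
  near=> e; move=> /(triP _ f)[_ _]; apply/negP; rewrite -ltNge.
  rewrite (bary_affine _ _ _ f3); near: e; exact: near0_affine_lt0.
by exfalso; apply/nK/(triP _ f).
Unshelve. all: by end_near. Qed.

Lemma sided_tri K m d : Defs.nondegenerate K -> sided K m d -> tri K m.
Proof.
move=> nK s; apply: contrapT => /(not_tri_near d nK) ns.
have [e [_ [/interior_subset ?]]] := near0_ex (filterI s ns).
by [].
Qed.

Lemma sided_uniq T K K' m d : triangulation Om T -> K \in T -> K' \in T ->
  sided K m d -> sided K' m d -> K = K'.
Proof.
move=> tT KT K'T s s'; have [e [_ [Ke /interior_subset K'e]]] := near0_ex (filterI s s').
exact: triangulation_interior tT KT K'T Ke K'e.
Qed.

Lemma sided_edge T K0 K E m d : triangulation Om T -> K0 \in T -> K \in T ->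
  E \in edges K0 -> openseg E m -> sided K m d -> E \in edges K.
Proof.
move=> tT K0T KT EK om s; apply: (triangulation_edge tT K0T KT EK om).
exact: sided_tri (triangulation_nondegenerate tT KT) s.
Qed.

Lemma sided_interior K m d : interior (tri K) m -> sided K m d.
Proof. by move=> mi; apply: near_add; exact: nbhs_interior. Qed.

Lemma sided_sub K K' m d : tri K' `<=` tri K -> sided K' m d -> sided K m d.
Proof. by move=> sub; apply: filterS => e; exact: interiorS. Qed.

Lemma ordering_edge o E : edge_ordering Om o -> #|` E| = 2%N ->
  E = [fset (o E).1; (o E).2]%fset /\ (o E).1 != (o E).2.
Proof.
move=> ho E2; have [EE _] := ho _ E2; split=> //.
by move: E2; rewrite {1}EE cardfs2; case: eqP.
Qed.

Lemma edge_length_gt0 o E : edge_ordering Om o -> #|` E| = 2%N ->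
  0 < edge_length o E.
Proof.
move=> ho E2; have [_ ab] := ordering_edge ho E2.
rewrite sqrtr_gt0 /dot lt_neqAle addr_ge0 ?andbT -?expr2 ?sqr_ge0//.
apply: contra_neq ab => /esym/eqP; rewrite paddr_eq0 ?sqr_ge0// !sqrf_eq0 !planeE.
by rewrite !subr_eq0 => /andP[/eqP ? /eqP ?]; exact: plane_eqP.
Qed.

Lemma dot_rot (a w : plane R) : dot w (rot a) = det2 a w.
Proof. by rewrite /dot /rot /det2 /=; ring. Qed.

Lemma dot_normal o E w : dot w (normal o E) =
  (edge_length o E)^-1 * det2 ((o E).2 - (o E).1) w.
Proof. by rewrite /normal dot_rot /tangent /det2 !planeE; ring. Qed.

Lemma on_rightE o E K z : edge_ordering Om o -> #|` E| = 2%N ->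
  frame K (o E).1 (o E).2 z ->
  on_right o E K = (0 < det2 ((o E).2 - (o E).1) (z - (o E).1)).
Proof.
move=> ho E2 f; have l0 := edge_length_gt0 ho E2; have [Kv D] := f.
rewrite lt_neqAle eq_sym D /=.
have [ma mb mz] := mem_fset3 (o E).1 (o E).2 z; rewrite -Kv in ma mb mz.
apply/allP/idP => [/(_ _ mz)|D0 w].
  by rewrite dot_normal pmulr_rge0// invr_gt0.
rewrite Kv !in_fsetU !in_fset1 dot_normal pmulr_rge0 ?invr_gt0//.
by case/orP=> [/orP[]|] /eqP ->//; rewrite (_ : det2 _ _ = 0)// /det2 !planeE; ring.
Qed.

Lemma on_leftE o E K z : edge_ordering Om o -> #|` E| = 2%N ->
  frame K (o E).1 (o E).2 z ->
  on_left o E K = (det2 ((o E).2 - (o E).1) (z - (o E).1) < 0).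
Proof.
move=> ho E2 f; have l0 := edge_length_gt0 ho E2; have [Kv D] := f.
rewrite lt_neqAle D /=.
have [ma mb mz] := mem_fset3 (o E).1 (o E).2 z; rewrite -Kv in ma mb mz.
apply/allP/idP => [/(_ _ mz)|D0 w].
  by rewrite dot_normal pmulr_rle0// invr_gt0.
rewrite Kv !in_fsetU !in_fset1 dot_normal pmulr_rle0 ?invr_gt0//.
by case/orP=> [/orP[]|] /eqP ->//; rewrite (_ : det2 _ _ = 0)// /det2 !planeE; ring.
Qed.

(** The trace at [m] from the side of [d]. In a triangulation there is at most one term, and none
    where the mesh ends. Neither an edge nor its ordering occurs, so the traces on two meshes can be
    compared. *)
Definition sided_sum (V : zmodType) T m d (g : triangle R -> V) : V :=
  \sum_(K <- T | `[< sided K m d >]) g K.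

Lemma edge_card2 K E : E \in edges K -> #|` E| = 2%N.
Proof. by rewrite edgesE => /andP[_ /eqP]. Qed.

(** A triangle on a side of [m] contains [m], so by conformity it has the edge [E]; hence the sums
    over the two sides of the edge and over the two sides of [m] have the same terms. The direction
    [d] only has to point to the side of the normal. *)
Lemma jump_sided (V : zmodType) o T (g : triangle R -> plane R -> V) K0 E m d x :
  edge_ordering Om o -> triangulation Om T -> K0 \in T -> E \in edges K0 ->
  openseg E m -> 0 < det2 ((o E).2 - (o E).1) d ->
  jump o T g E x =
  sided_sum T m (- d) (fun K => g K x) - sided_sum T m d (fun K => g K x).
Proof.
move=> ho tT K0T EK0 om d0; have E2 := edge_card2 EK0.
have [EE ab] := ordering_edge ho E2.
have nT := triangulation_nondegenerate tT.
have om' := om; rewrite EE in om'.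
have frm K : K \in T -> E \in edges K -> exists z, frame K (o E).1 (o E).2 z.
  by move=> KT; rewrite {1}EE; exact: edge_frame (nT _ KT).
rewrite /jump /sided_sum; congr (_ - _);
  rewrite big_seq_cond [RHS]big_seq_cond; apply: eq_bigl => K;
  have [KT|//] := boolP (K \in T); rewrite !andTb.
- apply/andP/asboolP => [[EK]|s].
    have [z f] := frm _ KT EK; rewrite (on_leftE ho E2 f) => l.
    apply/(sidedP _ f om'); rewrite (_ : det2 _ (- d) = - det2 ((o E).2 - (o E).1) d).
      by rewrite mulNr -mulrN -invrN divr_gt0// oppr_gt0.
    by rewrite /det2 !planeE; ring.
  have EK := sided_edge tT K0T KT EK0 om s; split=> //.
  have [z f] := frm _ KT EK; rewrite (on_leftE ho E2 f).
  move/(sidedP _ f om'): s; rewrite (_ : det2 _ (- d) = - det2 ((o E).2 - (o E).1) d).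
    by rewrite mulNr -mulrN -invrN pmulr_rgt0// invr_gt0 oppr_gt0.
  by rewrite /det2 !planeE; ring.
- apply/andP/asboolP => [[EK]|s].
    have [z f] := frm _ KT EK; rewrite (on_rightE ho E2 f) => l.
    by apply/(sidedP _ f om'); rewrite divr_gt0.
  have EK := sided_edge tT K0T KT EK0 om s; split=> //.
  have [z f] := frm _ KT EK; rewrite (on_rightE ho E2 f).
  by move/(sidedP _ f om'): s; rewrite pmulr_rgt0// invr_gt0.
Qed.

Lemma jump_sidedN (V : zmodType) o T (g : triangle R -> plane R -> V) K0 E m d x :
  edge_ordering Om o -> triangulation Om T -> K0 \in T -> E \in edges K0 ->
  openseg E m -> det2 ((o E).2 - (o E).1) d < 0 ->
  jump o T g E x =
  sided_sum T m d (fun K => g K x) - sided_sum T m (- d) (fun K => g K x).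
Proof.
move=> ho tT K0T EK0 om d0; rewrite -{1}(opprK d).
apply: (jump_sided _ _ ho tT K0T EK0 om).
by rewrite (_ : det2 _ _ = - det2 ((o E).2 - (o E).1) d) ?oppr_gt0// /det2 !planeE; ring.
Qed.

Lemma sided_sum1 (V : zmodType) T m d (g : triangle R -> V) K :
  triangulation Om T -> K \in T -> sided K m d -> sided_sum T m d g = g K.
Proof.
move=> tT KT s; rewrite /sided_sum big_mkcond (bigD1_seq K)//=; last exact: fset_uniq.
rewrite asboolT// big_seq_cond big1 ?addr0// => K' /andP[K'T K'K].
case: asboolP => // s'.
by rewrite (sided_uniq tT K'T KT s' s) eqxx in K'K.
Qed.

Lemma sided_sum0 (V : zmodType) T m d (g : triangle R -> V) :
  (forall K, K \in T -> ~ sided K m d) -> sided_sum T m d g = 0.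
Proof.
move=> h; rewrite /sided_sum big_seq_cond big1// => K /andP[KT /asboolP].
by move/(h _ KT).
Qed.

(** The finitely many descendants of [K] in [T'] cover [K], so one of them, [K'], contains
    [m + e *: d] for arbitrarily small [e]. Being closed it contains [m], and by conformity of [T']
    it has the edge [E]. As [d] is not parallel to [E], it points strictly into [K'] or strictly out
    of it, and the latter contradicts the choice of [K']. *)
Lemma sided_refine T T' K0 E m d K : triangulation Om T -> triangulation Om T' ->
  bisections T T' -> K0 \in T' -> E \in edges K0 -> openseg E m ->
  (forall a b, E = [fset a; b]%fset -> det2 (b - a) d != 0) ->
  K \in T -> sided K m d ->
  exists K', [/\ K' \in T', descendant K K' & sided K' m d].
Proof.
move=> tT tT' bis K0T' EK0 om trd KT s.
have nT := triangulation_nondegenerate tT.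
have nT' := triangulation_nondegenerate tT'.
have [K' [K'T' dK' fr]] : exists K', [/\ K' \in T', descendant K K' &
    ~ \forall e \near (0:R)^'+, ~ tri K' (m + e *: d)].
  apply: contrapT => /forallNP h.
  have : \forall e \near (0:R)^'+, forall K', K' \in T' ->
      ~ (descendant K K' /\ tri K' (m + e *: d)).
    have : forall r : seq (triangle R), {subset r <= T'} ->
        \forall e \near (0:R)^'+, forall K', K' \in r ->
          ~ (descendant K K' /\ tri K' (m + e *: d)).
      elim=> [_|K1 r IH sub]; first by near=> e.
      have {}IH := IH (fun K' K'r => sub K' (mem_behead (s := K1 :: r) K'r)).
      have [d1|nd1] := pselect (descendant K K1); last first.
        move: IH; apply: filterS => e he K'; rewrite inE => /orP[/eqP -> []//|/he].
        by [].
      have h1 : \forall e \near (0:R)^'+, ~ tri K1 (m + e *: d).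
        apply: contrapT => h1; apply: (h K1); split=> //.
        by apply: sub; rewrite inE eqxx.
      near=> e => K'; rewrite inE => /orP[/eqP -> [_]|].
        by near: e.
      by move: K'; near: e.
    by move=> /(_ (enum_fset T')); apply.
  move=> ns; have [e [_ [he /interior_subset Ke]]] := near0_ex (filterI ns s).
  have [K' [K'T' dK' K'e]] := bisections_cover nT bis KT Ke.
  exact: (he K').
have nK' := nT' _ K'T'.
have K'm : tri K' m by apply: contrapT => /(not_tri_near d nK').
have EK' := triangulation_edge tT' K0T' K'T' EK0 om K'm.
have [x [y [z [EE f]]]] := edge_frame_ex nK' EK'.
rewrite EE in om; exists K'; split=> //; apply/(sidedP _ f om).
rewrite ltNge; apply/negP => le0; apply: fr.
have le1 : det2 (y - x) d / det2 (y - x) (z - x) < 0.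
  have [_ D] := f; rewrite lt_neqAle le0 andbT mulf_eq0 invr_eq0 negb_or D andbT.
  exact: trd.
near=> e; move/(triP _ f) => [_ _]; rewrite (bary_step _ _ f om).
have e0 : 0 < e by near: e; exact: nbhs_right_gt.
by rewrite pmulr_rge0// leNgt le1.
Unshelve. all: by end_near. Qed.

End Conformity.

(** * Edges, traces and jumps under refinement *)

Section Refinement.
Context {R : realType}.
Implicit Types (K : triangle R) (E : edge R) (x y z w m d : plane R).
Implicit Types (T : {fset triangle R}) (o : ordering R).
Variable Om : set (plane R).

(** For a slit domain the interior of the closure is larger than the domain; the Lipschitz condition
    excludes this. If [x] were a boundary point, a short step from [x] along [- rot e] would end at
    a point [y] of [K] strictly below the graph of [g]. A neighbourhood of [y] would then miss [Om],
    although [y] lies in the closure of [Om]. *)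
Lemma triangulation_interior_sub T K : open Om -> lipschitz_boundary Om ->
  triangulation Om T -> K \in T -> interior (tri K) `<=` Om.
Proof.
move=> oOm lip [_ cover _] KT x xi; apply: contrapT => nOm.
have subcl : tri K `<=` closure Om by rewrite cover => y Ky; exists K.
have bx : boundary Om x.
  by split=> [|/interior_subset//]; exact: (subcl _ (interior_subset xi)).
have [e [r [h [g [ee r0 h0 lg loc]]]]] := lip x bx.
have g0 : 0 <= g 0.
  rewrite leNgt; apply/negP => g0; apply: nOm.
  have := loc 0 0; rewrite normr0 !scale0r !addr0 => /(_ r0 h0)[_]; exact.
have gcont : continuous g.
  have [M [Mr HM]] := lg; set k := Num.max M 0 + 1.
  have k0 : 0 < k by rewrite ltr_wpDl// le_max lexx orbT.
  have Mk : M < k by rewrite (@le_lt_trans _ _ (Num.max M 0)) ?le_max ?lexx// ltrDl.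
  have gk a b : `|g a - g b| <= k * `|a - b| by exact: (HM k Mk (a, b)).
  move=> a; apply/cvgrPdist_lt => eps eps0; near=> b.
  apply: le_lt_trans (gk a b) _; rewrite -ltr_pdivlMl//.
  near: b; apply/nbhs_normP; exists (k^-1 * eps) => //=.
  by rewrite mulr_gt0// invr_gt0.
have [c [c0 [yi ch]]] := near0_ex (filterI (near_add (- rot e) xi) (nbhs_right_lt h0)).
pose s (w : plane R) := (w.1 - x.1) * e.1 + (w.2 - x.2) * e.2.
pose t (w : plane R) := (w.1 - x.1) * (- e.2) + (w.2 - x.2) * e.1.
have cs (a b : R) : continuous (fun w : plane R => (w.1 - x.1) * a + (w.2 - x.2) * b).
  move=> w; apply: cvgD; apply: cvgM; try exact: cvg_cst; apply: cvgB; try exact: cvg_cst.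
    exact: cvg_fst.
  exact: cvg_snd.
set y := x + c *: (- rot e) in yi.
have sy : s y = 0 by rewrite /s /y /rot /dot !planeE/=; ring.
have ty : t y = - c.
  have -> : t y = - c * dot e e by rewrite /t /y /rot /dot !planeE/=; ring.
  by rewrite ee mulr1.
have wE w : w = x + s w *: e + t w *: rot e.
  apply: plane_eqP; rewrite /rot !planeE /=.
    have -> : x.1 + s w * e.1 + t w * - e.2 = x.1 + (w.1 - x.1) * dot e e.
      by rewrite /s /t /dot; ring.
    by rewrite ee; ring.
  have -> : x.2 + s w * e.2 + t w * e.1 = x.2 + (w.2 - x.2) * dot e e.
    by rewrite /s /t /dot; ring.
  by rewrite ee; ring.
have n1 : \forall w \near y, s w < r by apply: (cvgr_lt _ (cs _ _ _)); rewrite -/(s y) sy.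
have n2 : \forall w \near y, - r < s w by apply: (cvgr_gt _ (cs _ _ _)); rewrite -/(s y) sy oppr_lt0.
have n3 : \forall w \near y, t w < 0 by apply: (cvgr_lt _ (cs _ _ _)); rewrite -/(t y) ty oppr_lt0.
have n4 : \forall w \near y, - h < t w by apply: (cvgr_gt _ (cs _ _ _)); rewrite -/(t y) ty ltrN2.
have n5 : \forall w \near y, 0 < g (s w) - t w.
  have cgt : (g (s w) - t w) @[w --> y] --> g (s y) - t y.
    apply: cvgB; last exact: cs.
    by apply: (@continuous_comp _ _ _ s g); [exact: cs|exact: gcont].
  by apply: (cvgr_gt _ cgt); move: (c0) g0; rewrite sy ty; lra.
have clOm : closure Om y by exact: (subcl _ yi).
have [w [Omw [[[[w1 w2] w3] w4] w5]]] :=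
  clOm _ (filterI (filterI (filterI (filterI n1 n2) n3) n4) n5).
move: Omw; rewrite (wE w) => /loc; rewrite !ltr_norml w1 w2 w4 (lt_trans w3 h0).
by move=> /(_ isT isT); lra.
Unshelve. all: by end_near. Qed.

Lemma hull_fset2_end (a b : plane R) : a != b ->
  hull [fset a; b]%fset a /\ hull [fset a; b]%fset b.
Proof.
move=> ab; split; apply/(hull2P _ ab).
  by exists 0; [rewrite lexx ler01|rewrite scale0r addr0].
by exists 1; [rewrite lexx ler01|rewrite scale1r addrC subrK].
Qed.

Lemma subsegment (x y a b : plane R) : x != y -> a != b ->
  hull [fset x; y]%fset a -> hull [fset x; y]%fset b ->
  exists s0 s1 : R, [/\ 0 <= s0 <= 1, 0 <= s1 <= 1, s0 != s1,
    a = x + s0 *: (y - x) & b = x + s1 *: (y - x)].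
Proof.
move=> xy ab /(hull2P _ xy)[s0 s01 aE] /(hull2P _ xy)[s1 s11 bE].
exists s0, s1; split=> //; apply: contra_neq ab => s01E.
by rewrite aE bE s01E.
Qed.

Lemma openseg_sub E E' m : #|` E| = 2%N -> hull E' `<=` hull E ->
  openseg E' m -> openseg E m.
Proof.
move=> /card2_fset[x [y [xy ->]]] + [a [b [t [E'E ab t01 mE]]]].
have [ha hb] := hull_fset2_end ab; rewrite E'E => sub.
have [s0 [s1 [s0b s1b s01 aE bE]]] := subsegment xy ab (sub _ ha) (sub _ hb).
exists x, y, (s0 + t * (s1 - s0)); split=> //; last first.
  by rewrite mE aE bE; apply: plane_eqP; rewrite !planeE; ring.
move: t01 s0b s1b => /andP[t0 t1] /andP[? ?] /andP[? ?].
have [s|s|s] := ltgtP s0 s1; last by rewrite s eqxx in s01.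
- by apply/andP; split; nra.
- by apply/andP; split; nra.
Qed.

Lemma openseg_mid (a b : plane R) : a != b ->
  openseg [fset a; b]%fset (a + 2^-1 *: (b - a)).
Proof.
move=> ab; exists a, b, 2^-1; split=> //.
by apply/andP; split; [rewrite invr_gt0|rewrite invf_lt1// ltr1n].
Qed.

Lemma bary0_hull K x y z a : frame K x y z -> tri K a -> bary z x y a = 0 ->
  hull [fset x; y]%fset a.
Proof.
move=> f /(triP _ f)[b1 b2 _] b3; have [xy _ _] := frame_neq f.
have := bary_sum a f; rewrite b3 => s; apply/(hull2P _ xy).
exists (bary y z x a); first by apply/andP; split=> //; lra.
rewrite {1}(bary_comb a f) b3; have -> : bary x y z a = 1 - bary y z x a by lra.
by apply: plane_eqP; rewrite !planeE; ring.
Qed.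

(** The coordinate at [z] is affine and nonnegative at [a] and [b]; vanishing strictly between them,
    it vanishes at both. *)
Lemma bary0_sub K x y z a b m : frame K x y z -> a != b -> tri K a -> tri K b ->
  openseg [fset a; b]%fset m -> bary z x y m = 0 ->
  hull [fset a; b]%fset `<=` hull [fset x; y]%fset.
Proof.
move=> f ab Ka Kb /openseg_fset2[_ [t /andP[t0 t1] ->]] b0.
have [xy _ _] := frame_neq f; have f3 := frame_rot (frame_rot f).
have [_ _ ba] := (triP _ f).1 Ka; have [_ _ bb] := (triP _ f).1 Kb.
have := bary_affine a (b - a) 1 f3; rewrite scale1r mul1r (addrC a) subrK => bE.
move: b0; rewrite (bary_affine _ _ _ f3).
set c := det2 _ _ / _ in bE * => b0.
have za : bary z x y a = 0 by nra.
have zb : bary z x y b = 0 by nra.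
have /(hull2P _ xy)[s0 /andP[s00 s01] aE] := bary0_hull f Ka za.
have /(hull2P _ xy)[s1 /andP[s10 s11] bE'] := bary0_hull f Kb zb.
move=> w /(hull2P _ ab)[u /andP[u0 u1] ->]; apply/(hull2P _ xy).
exists (s0 + u * (s1 - s0)); first by apply/andP; split; nra.
by rewrite aE bE'; apply: plane_eqP; rewrite !planeE; ring.
Qed.

(** A coarse coordinate that vanishes at [m] names the coarse edge containing [E']; if none
    vanishes, [m] is an interior point. *)
Lemma descendant_edge K K' E' m : Defs.nondegenerate K -> descendant K K' ->
  E' \in edges K' -> openseg E' m ->
  interior (tri K) m \/ exists2 E, E \in edges K & hull E' `<=` hull E.
Proof.
move=> nK dK EK' om; have nK' := descendant_nondegenerate nK dK.
have [a [b [c [E'E g]]]] := edge_frame_ex nK' EK'.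
have [ab _ _] := frame_neq g; have [ha hb] := hull_fset2_end ab.
have sub := descendant_tri nK dK; rewrite E'E in EK' om *.
have Ka : tri K a by apply: sub; exact: hull_edge_tri EK' nK' ha.
have Kb : tri K b by apply: sub; exact: hull_edge_tri EK' nK' hb.
have Km : tri K m.
  by apply: sub; exact: hull_edge_tri EK' nK' (openseg_hull om).
have [x [y [z f]]] := nondegenerate_frame nK.
have f2 := frame_rot f; have f3 := frame_rot f2.
have [b1 b2 b3] := (triP _ f).1 Km.
have [z1|z1] := eqVneq (bary z x y m) 0.
  by right; exists [fset x; y]%fset; [exact: frame_edge f|exact: bary0_sub f ab Ka Kb om z1].
have [z2|z2] := eqVneq (bary x y z m) 0.
  by right; exists [fset y; z]%fset; [exact: frame_edge f2|exact: bary0_sub f2 ab Ka Kb om z2].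
have [z3|z3] := eqVneq (bary y z x m) 0.
  by right; exists [fset z; x]%fset; [exact: frame_edge f3|exact: bary0_sub f3 ab Ka Kb om z3].
by left; apply/(interior_triP _ f); split; rewrite lt_neqAle eq_sym ?z1 ?z2 ?z3.
Qed.

(** If a coarse triangle lies on this side of [m], then so does one of its descendants in [T'], and
    uniqueness in [T] identifies the parent of the latter. Conversely, a fine triangle on this side
    puts its parent there. *)
Lemma sided_sum_refine (V : zmodType) T T' (par : triangle R -> triangle R)
    (h : triangle R -> V) K0 E m d :
  triangulation Om T -> triangulation Om T' -> bisections T T' ->
  (forall K', K' \in T' -> par K' \in T /\ descendant (par K') K') ->
  K0 \in T' -> E \in edges K0 -> openseg E m ->
  (forall a b, E = [fset a; b]%fset -> det2 (b - a) d != 0) ->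
  sided_sum T' m d (h \o par) = sided_sum T m d h.
Proof.
move=> tT tT' bis hpar K0T EK0 om trd.
have nT := triangulation_nondegenerate tT.
have [[K [KT s]]|ns] := pselect (exists K, K \in T /\ sided K m d).
  have [K' [K'T' dK' s']] := sided_refine tT tT' bis K0T EK0 om trd KT s.
  have [pT dp] := hpar _ K'T'.
  have sp := sided_sub (descendant_tri (nT _ pT) dp) s'.
  by rewrite (sided_sum1 _ tT' K'T' s') (sided_sum1 _ tT KT s)/= (sided_uniq tT KT pT s sp).
rewrite [RHS]sided_sum0; last by move=> K KT s; apply: ns; exists K.
apply: sided_sum0 => K' K'T' s'; have [pT dp] := hpar _ K'T'.
by apply: ns; exists (par K'); split=> //; exact: sided_sub (descendant_tri (nT _ pT) dp) s'.
Qed.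

Lemma det2_rot (a : plane R) : a != 0 -> 0 < det2 a (rot a).
Proof.
move=> a0; rewrite /det2 /rot /= mulrN opprK -!expr2 lt_neqAle addr_ge0 ?sqr_ge0// andbT.
apply: contra_neq a0 => /esym/eqP; rewrite paddr_eq0 ?sqr_ge0// !sqrf_eq0.
by move=> /andP[/eqP ? /eqP ?]; exact: plane_eqP.
Qed.

(* The ordering of a subedge need not agree with that of the edge: [s1 < s0]
   is possible. *)
Lemma subedge_ordering o E E' : edge_ordering Om o -> #|` E| = 2%N -> #|` E'| = 2%N ->
  hull E' `<=` hull E -> exists s0 s1 : R,
  [/\ 0 <= s0 <= 1, 0 <= s1 <= 1, s0 != s1,
    (o E').1 = (o E).1 + s0 *: ((o E).2 - (o E).1) &
    (o E').2 = (o E).1 + s1 *: ((o E).2 - (o E).1)].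
Proof.
move=> ho E2 E2'; have [EE ab] := ordering_edge ho E2.
have [EE' ab'] := ordering_edge ho E2' => sub.
have {}sub : hull [fset (o E').1; (o E').2]%fset `<=`
    hull [fset (o E).1; (o E).2]%fset by rewrite -EE -EE'.
have [ha hb] := hull_fset2_end ab'.
exact: (subsegment ab ab' (sub _ ha) (sub _ hb)).
Qed.

(** Both jumps are differences of traces at the midpoint of [E'] along a direction normal to [E'].
    If the midpoint is interior to the parent, both traces come from the parent and cancel.
    Otherwise the sign depends on whether the orderings of [E'] and [E] agree, that is, on the sign
    of [s1 - s0]. *)
Lemma jump_refine (V : zmodType) o T T' (par : triangle R -> triangle R)
    (h : triangle R -> plane R -> V) K' E' :
  edge_ordering Om o ->
  triangulation Om T -> triangulation Om T' -> bisections T T' ->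
  (forall K', K' \in T' -> par K' \in T /\ descendant (par K') K') ->
  K' \in T' -> E' \in edges K' ->
  (forall x, jump o T' (h \o par) E' x = 0) \/
  exists E, [/\ E \in edges (par K'), hull E' `<=` hull E &
    forall x, jump o T' (h \o par) E' x = jump o T h E x \/
      jump o T' (h \o par) E' x = - jump o T h E x].
Proof.
move=> ho tT tT' bis hpar K'T' EK'; have E2' := edge_card2 EK'.
have [EE' ab'] := ordering_edge ho E2'; have [pT dp] := hpar _ K'T'.
have nK := triangulation_nondegenerate tT pT.
set u := (o E').2 - (o E').1; set m := (o E').1 + 2^-1 *: u.
have om : openseg E' m by rewrite EE'; exact: openseg_mid.
have u0 : u != 0 by rewrite subr_eq0 eq_sym.
have uu := det2_rot u0; set d := rot u in uu.
have trd a b : E' = [fset a; b]%fset -> det2 (b - a) d != 0.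
  rewrite EE' => /(fset2_inj ab')[[<- <-]|[<- <-]]; first by rewrite gt_eqF.
  rewrite (_ : det2 _ _ = - det2 u d) ?oppr_eq0 ?gt_eqF//.
  by rewrite /u /det2 !planeE; ring.
have trdN a b : E' = [fset a; b]%fset -> det2 (b - a) (- d) != 0.
  move=> /trd; apply: contra_neq => h0; rewrite -[RHS]oppr0 -h0.
  by rewrite /det2 !planeE; ring.
have JE x : jump o T' (h \o par) E' x =
    sided_sum T m (- d) (fun K => h K x) - sided_sum T m d (fun K => h K x).
  rewrite (jump_sided _ _ ho tT' K'T' EK' om uu).
  rewrite -(sided_sum_refine (fun K => h K x) tT tT' bis hpar K'T' EK' om trd).
  by rewrite -(sided_sum_refine (fun K => h K x) tT tT' bis hpar K'T' EK' om trdN).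
have [mi|[E EK sub]] := descendant_edge nK dp EK' om.
  left=> x; rewrite JE.
  by rewrite !(sided_sum1 _ tT pT) ?subrr//; exact: sided_interior.
have E2 := edge_card2 EK.
have om' := openseg_sub E2 sub om.
have [s0 [s1 [_ _ s01 e1 e2]]] := subedge_ordering ho E2 E2' sub.
right; exists E; split=> // x; rewrite JE.
have uE : det2 u d = (s1 - s0) * det2 ((o E).2 - (o E).1) d.
  by rewrite {1}/u e1 e2 /det2 !planeE; ring.
have [s|s|s] := ltgtP s0 s1; last by rewrite s eqxx in s01.
- left; rewrite (jump_sided _ _ ho tT pT EK om' (d := d))//.
  by move: uu; rewrite uE pmulr_rgt0// subr_gt0.
- right; rewrite (jump_sidedN _ _ ho tT pT EK om' (d := d)) ?opprB//.
  by move: uu; rewrite uE nmulr_rgt0// subr_lt0.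
Qed.

(** Conformity makes [E1] an edge of both fine triangles. It lies in an edge of [K], and both
    triangles lie in [K], hence on the same side of it. This makes the contributions of fine
    triangles inside [K] to one coarse edge disjoint. *)
Lemma subedge_disjoint T' K K1 K2 E E1 E2 m : triangulation Om T' ->
  Defs.nondegenerate K -> E \in edges K ->
  K1 \in T' -> K2 \in T' -> descendant K K1 -> descendant K K2 ->
  E1 \in edges K1 -> E2 \in edges K2 -> hull E1 `<=` hull E ->
  openseg E1 m -> openseg E2 m -> K1 = K2 /\ E1 = E2.
Proof.
move=> tT' nK EK K1T K2T d1 d2 E1K E2K sub om1 om2.
have nT' := triangulation_nondegenerate tT'.
have K2m := hull_edge_tri E2K (nT' _ K2T) (openseg_hull om2).
have E1K2 := triangulation_edge tT' K1T K2T E1K om1 K2m.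
have E12 := openseg_edge_uniq (nT' _ K2T) E2K E1K2 om2 (openseg_hull om1).
split=> //; have om := openseg_sub (edge_card2 EK) sub om1.
have [x [y [z [EE f]]]] := edge_frame_ex nK EK; rewrite EE in om sub.
have [a [b [c1 [E1E f1]]]] := edge_frame_ex (nT' _ K1T) E1K.
have [c2 f2] : exists c, frame K2 a b c by rewrite E1E in E1K2; exact: edge_frame (nT' _ K2T) E1K2.
have [ab _ _] := frame_neq f1; have [ha hb] := hull_fset2_end ab.
have [xy _ _] := frame_neq f; rewrite E1E in sub om1.
have [s0 [s1 [_ _ s01 aE bE]]] := subsegment xy ab (sub _ ha) (sub _ hb).
have D := f.2; set d := z - x in D.
have baE : det2 (b - a) d = (s1 - s0) * det2 (y - x) d.
  by rewrite aE bE /det2 !planeE; ring.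
have trd : det2 (b - a) d != 0 by rewrite baE mulf_neq0// subr_eq0 eq_sym.
have sid Ki c : descendant K Ki -> frame Ki a b c -> sided Ki m d.
  move=> dKi g; apply/(sidedP _ g om1); rewrite lt_neqAle eq_sym mulf_neq0 ?invr_eq0 ?g.2//=.
  rewrite leNgt; apply/negP => neg.
  have : sided Ki m (- d).
    apply/(sidedP _ g om1); rewrite (_ : det2 _ (- d) = - det2 (b - a) d).
      by rewrite mulNr oppr_gt0.
    by rewrite /det2 !planeE; ring.
  move/(sided_sub (descendant_tri nK dKi))/(sidedP _ f om).
  rewrite (_ : det2 _ (- d) = - det2 (y - x) d); last by rewrite /det2 !planeE; ring.
  by rewrite mulNr divff// oppr_gt0 ltr10.
exact: sided_uniq tT' K1T K2T (sid _ _ d1 f1) (sid _ _ d2 f2).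
Qed.

End Refinement.

(** * Area of triangles *)

Section AffineMeasure.
Context {R : realType}.
Local Open Scope ereal_scope.
Local Notation leb := (@lebesgue_measure R).

Definition aff (a e : R) : measurableTypeR R -> measurableTypeR R :=
  fun y => (a * y + e)%R.

Lemma measurable_aff a e : measurable_fun setT (aff a e).
Proof.
apply: measurable_funD; last exact: measurable_cst.
by apply: measurable_funM; [exact: measurable_cst|exact: measurable_id].
Qed.

(** Lebesgue measure is determined by its values on half-open intervals, where the claim is a
    computation of lengths. *)
Lemma lebesgue_measure_aff (a e : R) (A : set R) : a != 0%R -> measurable A ->
  leb A = `|a|%:E * leb (aff a e @^-1` A).
Proof.
move=> a0 mA.
pose f := isMeasurableFun.Build _ _ _ _ _ (measurable_aff a e).
pose F : {mfun measurableTypeR R >-> measurableTypeR R} := HB.pack (aff a e) f.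
have na : (0 <= `|a|)%R by [].
rewrite (_ : _ * _ = mscale (NngNum na) (pushforward leb F) A)//.
apply: lebesgue_measure_unique mA => _ [[l r] _ <-] /=.
transitivity (`|a|%:E * leb (aff a e @^-1` `]l, r]%classic)); last by [].
have [a1|a1|a1] := ltgtP a 0%R; last by rewrite a1 eqxx in a0.
- rewrite (_ : _ @^-1` _ = `[((r - e) / a)%R, ((l - e) / a)%R[%classic).
    rewrite !lebesgue_measure_itv/= !lte_fin ltr_ndivlMr// divfK// ltrD2r.
    case: ifP => // _; last by rewrite mule0.
    by rewrite -!EFinD -EFinM ltr0_norm//; congr (_%:E); field.
  apply/seteqP; split=> y /=; rewrite !in_itv/= /aff ler_ndivrMr// ltr_ndivlMr//;
    by rewrite !(mulrC y) lerBrDr ltrBlDr andbC.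
- rewrite (_ : _ @^-1` _ = `]((l - e) / a)%R, ((r - e) / a)%R]%classic).
    rewrite !lebesgue_measure_itv/= !lte_fin ltr_pdivrMr// divfK// ltrD2r.
    case: ifP => // _; last by rewrite mule0.
    by rewrite -!EFinD -EFinM gtr0_norm//; congr (_%:E); field.
  apply/seteqP; split=> y /=; rewrite !in_itv/= /aff ltr_pdivrMr// ler_pdivlMr//;
    by rewrite !(mulrC y) lerBrDr ltrBlDr.
Qed.

Definition aff_pushforward (a e : R) :
  {measure set (measurableTypeR R) -> \bar R}.
Proof.
unshelve refine (pushforward leb (aff a e)); exact: measurable_aff.
Defined.

Lemma ge0_integral_aff (a e : R) (g : R -> \bar R) : a != 0%R ->
  measurable_fun setT g -> (forall y, 0 <= g y) ->
  \int[leb]_y g y = `|a|%:E * \int[leb]_y g (a * y + e)%R.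
Proof.
move=> a0 mg g0; have na : (0 <= `|a|)%R by [].
transitivity (\int[mscale (NngNum na) (aff_pushforward a e)]_y g y).
  by apply: eq_measure_integral => A mA _; exact: lebesgue_measure_aff.
rewrite ge0_integral_mscale//; congr (_ * _).
exact: (@ge0_integral_pushforward _ _ _ _ _ _ (measurable_aff a e) leb setT g).
Qed.

(** The change of variables is stated with preimages, so that measurability is immediate and
    composition multiplies the factors. For an invertible affine map, [c] is the absolute value of
    the determinant. *)
Definition scales_area (F : plane R -> plane R) (c : R) : Prop :=
  measurable_fun setT F /\
  forall A : set (plane R), measurable A -> leb2 A = c%:E * leb2 (F @^-1` A).

Lemma scales_area_comp F G c d : scales_area F c -> scales_area G d ->
  scales_area (F \o G) (c * d)%R.
Proof.
move=> [mF hF] [mG hG]; split; first exact: measurableT_comp.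
move=> A mA; have mA' : measurable (F @^-1` A).
  by rewrite -[X in measurable X]setTI; exact: mF.
by rewrite (hF A mA) (hG _ mA') EFinM muleA.
Qed.

(** The product measure integrates the measures of the sections along one axis; Tonelli's theorem
    for the indicator of [A] gives the same value along the other. *)
Lemma scales_area_swap : scales_area (fun x => (x.2, x.1)) 1.
Proof.
have ms : measurable_fun setT (fun x : plane R => (x.2, x.1)).
  by apply/measurable_fun_pairP; split; [exact: measurable_snd|exact: measurable_fst].
split=> // A mA; rewrite mul1e.
have mA' : measurable ((fun x : plane R => (x.2, x.1)) @^-1` A).
  by rewrite -[X in measurable X]setTI; exact: ms.
have eA : \int[leb]_x (leb \o xsection A) x = \int[leb]_y (leb \o ysection A) y.
  rewrite -(indic_fubini_tonelli_FE leb mA) -(indic_fubini_tonelli_GE leb mA).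
  exact: indic_fubini_tonelli.
rewrite /product_measure1 eA; apply: eq_integral => y _ /=.
congr (leb _); apply/seteqP; split=> x; rewrite /ysection /xsection /= ?inE.

Qed.
End AffineMeasure.

Section Area.
Context {R : realType}.
Local Notation leb := (@lebesgue_measure R).
Implicit Types (K : triangle R) (x y z w : plane R).

Lemma measurable_fst_plane : measurable_fun setT (fun x : plane R => x.1).
Proof. exact: measurable_fst. Qed.

Lemma measurable_snd_plane : measurable_fun setT (fun x : plane R => x.2).
Proof. exact: measurable_snd. Qed.

Lemma scales_area_shear (a b e : R) : a != 0%R ->
  scales_area (fun x => (x.1, (a * x.2 + b * x.1 + e)%R)) `|a|%R.
Proof.
move=> a0; set F := fun x : plane R => _.
have mF : measurable_fun setT F.
  apply/measurable_fun_pairP; split; first exact: measurable_fst_plane.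
  apply: measurable_funD; last exact: measurable_cst.
  apply: measurable_funD; apply: measurable_funM; try exact: measurable_cst.
    exact: measurable_snd_plane.
  exact: measurable_fst_plane.
split=> // A mA; have mA' : measurable (F @^-1` A).
  by rewrite -[X in measurable X]setTI; exact: mF.
rewrite /product_measure1 -ge0_integralZl_EFin//; last first.
  exact: measurable_fun_xsection.
apply: eq_integral => u _ /=.
rewrite (@lebesgue_measure_aff _ a (b * u + e)%R)//; last exact: measurable_xsection.
congr (_ * leb _)%E; apply/seteqP; split=> v;
  by rewrite /xsection /aff /F /= !inE addrA.
Qed.

Definition frame_map x y z : plane R -> plane R :=
  fun s => (x + s.1 *: (y - x) + s.2 *: (z - x))%R.

(** Gaussian elimination: the map is a horizontal shear with factor [a.1], which is a vertical one
    between two swaps, followed by a vertical shear with factor [det2 a b / a.1]. *)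
Lemma scales_area_frame_map x y z : det2 (y - x) (z - x) != 0%R ->
  scales_area (frame_map x y z) `|det2 (y - x) (z - x)|%R.
Proof.
(* The pivot. If it vanishes, [y] and [z] are exchanged, at the price of one more swap. *)
wlog a0 : y z / (y - x).1 != 0%R => [hwlog D|].
  have [a0|a0] := eqVneq (y - x).1 0%R; last exact: hwlog.
  have b0 : (z - x).1 != 0%R.
    by apply: contra_neq D => b0; rewrite /det2 a0 b0 !(mul0r, mulr0) subr0.
  have DE : det2 (z - x) (y - x) = (- det2 (y - x) (z - x))%R by rewrite /det2; ring.
  have D' : det2 (z - x) (y - x) != 0%R by rewrite DE oppr_eq0.
  have := scales_area_comp (hwlog z y b0 D') scales_area_swap.
  rewrite mulr1 DE normrN; congr (scales_area _ _); apply/funext => s.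
  by rewrite /frame_map /= addrAC.
set a := (y - x)%R in a0 *; set b := (z - x)%R => D.
have D2 : (det2 a b / a.1 != 0)%R by rewrite mulf_neq0// invr_eq0.
have G1 := scales_area_comp (scales_area_comp scales_area_swap
  (scales_area_shear b.1 x.1 a0)) scales_area_swap.
have := scales_area_comp (scales_area_shear (a.2 / a.1)%R (x.2 - a.2 / a.1 * x.1)%R D2) G1.
rewrite mul1r mulr1 -normrM divfK//; congr (scales_area _ _); apply/funext => s.
apply: plane_eqP; rewrite /frame_map -/a -/b !planeE /=; first by ring.
by move: a0; rewrite /det2 /a /b !planeE => a0; field.
Qed.

Lemma measurable_bary x y z : measurable_fun setT (bary x y z).
Proof.
rewrite (_ : bary x y z = fun w : plane R =>
  ((y.1 - w.1) * (z.2 - w.2) - (y.2 - w.2) * (z.1 - w.1)) /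
  det2 (y - x) (z - x))//.
apply: measurable_funM; last exact: measurable_cst.
by apply: measurable_funB; apply: measurable_funM; apply: measurable_funB;
  first [exact: measurable_cst | exact: measurable_fst_plane |
    exact: measurable_snd_plane].
Qed.

Lemma measurable_preimage_itv (f : plane R -> R) (i : interval R) :
  measurable_fun setT f -> measurable (f @^-1` [set` i]).
Proof. by move=> mf; rewrite -[X in measurable X]setTI; exact: mf. Qed.

Lemma triE K x y z : frame K x y z -> tri K =
  (bary x y z @^-1` `[0%R, +oo[) `&` (bary y z x @^-1` `[0%R, +oo[) `&`
  (bary z x y @^-1` `[0%R, +oo[).
Proof.
move=> f; apply/seteqP; split=> w; rewrite /= !in_itv /= !andbT.
  by move/(triP _ f) => [].
by move=> [[? ?] ?]; apply/(triP _ f).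
Qed.

Lemma interior_triE K x y z : frame K x y z -> interior (tri K) =
  (bary x y z @^-1` `]0%R, +oo[) `&` (bary y z x @^-1` `]0%R, +oo[) `&`
  (bary z x y @^-1` `]0%R, +oo[).
Proof.
move=> f; apply/seteqP; split=> w; rewrite /= !in_itv /= !andbT.
  by move/(interior_triP _ f) => [].
by move=> [[? ?] ?]; apply/(interior_triP _ f).
Qed.

Lemma measurable_bary_itv x y z (i : interval R) :
  measurable (bary x y z @^-1` [set` i]).
Proof. by apply: measurable_preimage_itv; exact: measurable_bary. Qed.

Lemma measurable_tri K : Defs.nondegenerate K -> measurable (tri K).
Proof.
move=> /nondegenerate_frame[x [y [z f]]]; rewrite (triE f).
apply: measurableI; last exact: measurable_bary_itv.
by apply: measurableI; exact: measurable_bary_itv.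
Qed.

Lemma measurable_interior_tri K : Defs.nondegenerate K ->
  measurable (interior (tri K)).
Proof.
move=> /nondegenerate_frame[x [y [z f]]]; rewrite (interior_triE f).
apply: measurableI; last exact: measurable_bary_itv.
by apply: measurableI; exact: measurable_bary_itv.
Qed.

Lemma bary_frame_map K x y z (s : plane R) : frame K x y z ->
  [/\ bary x y z (frame_map x y z s) = (1 - s.1 - s.2)%R,
      bary y z x (frame_map x y z s) = s.1 &
      bary z x y (frame_map x y z s) = s.2].
Proof.
move=> f; have [_] := f; have [_] := frame_rot f.
have [_] := frame_rot (frame_rot f).
by rewrite /bary /frame_map /det2 !planeE => D3 D2 D1; split; field.
Qed.

Definition unit_triangle : set (plane R) :=
  [set s | [/\ (0 <= s.1)%R, (0 <= s.2)%R & (s.1 + s.2 <= 1)%R]].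

Lemma leb2_tri K x y z : Defs.nondegenerate K -> frame K x y z ->
  leb2 (tri K) = (`|det2 (y - x) (z - x)|%:E * leb2 unit_triangle)%E.
Proof.
move=> nK f; rewrite ((scales_area_frame_map f.2).2 _ (measurable_tri nK)).
congr (_ * leb2 _)%E; apply/seteqP; split=> s.
  move/(triP _ f); have [-> -> ->] := bary_frame_map s f => -[s0 s1 s2].
  by split=> //; lra.
move=> [s1 s2 s3]; apply/(triP _ f); have [-> -> ->] := bary_frame_map s f.
by split=> //; lra.
Qed.

Lemma measurable_unit_triangle : measurable unit_triangle.
Proof.
rewrite (_ : unit_triangle = (fst @^-1` `[0%R, +oo[) `&` (snd @^-1` `[0%R, +oo[) `&`
   ((fun s : plane R => s.1 + s.2)%R @^-1` `]-oo, 1%R])); last first.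
  apply/seteqP; split=> s; rewrite /= !in_itv/= ?andbT.
    by move=> [].
  by move=> [[? ?] ?].
apply: measurableI; last first.
  apply: measurable_preimage_itv.
  by apply: measurable_funD; [exact: measurable_fst_plane|exact: measurable_snd_plane].
apply: measurableI; apply: measurable_preimage_itv.
  exact: measurable_fst_plane.
exact: measurable_snd_plane.
Qed.

Lemma le_leb2 (A B : set (plane R)) : measurable A -> measurable B ->
  A `<=` B -> (leb2 A <= leb2 B)%E.
Proof.
pose m : {measure set (measurableTypeR R * measurableTypeR R) -> \bar R} := leb2.
move=> mA mB AB; suff : (m A <= m B)%E by [].
by apply: le_measure; rewrite ?inE.
Qed.

Lemma leb2_rectangle (a b c d : R) : (a <= b)%R -> (c <= d)%R ->
  leb2 (`[a, b] `*` `[c, d]) = ((b - a) * (d - c))%:E.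
Proof.
have leb_itv (u v : R) : u <= v -> leb `[u, v]%classic = (v - u)%:E.
  move=> uv; rewrite lebesgue_measure_itv/= lte_fin.
  case: ltP => [_|vu]; first by rewrite EFinB.
  by have -> : u = v by [lra]; rewrite subrr.
move=> ab cd; rewrite EFinM -(leb_itv _ _ ab) -(leb_itv _ _ cd).
exact: product_measure1E.
Qed.

(** The triangle is squeezed between squares of sides 1/2 and 1. Its area [A] stays abstract and
    enters the later constants as the ratio of area to determinant. *)
Lemma leb2_unit_triangle : exists2 A : R, (0 < A)%R & leb2 unit_triangle = A%:E.
Proof.
have h1 : (leb2 unit_triangle <= 1%:E)%E.
  rewrite (_ : 1%:E = leb2 (`[0%R, 1%R] `*` `[0%R, 1%R])); last first.
    by rewrite leb2_rectangle ?ler01// subr0 mulr1.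
  apply: le_leb2; [exact: measurable_unit_triangle|exact: measurableX|].
  by move=> s [? ? ?] /=; rewrite !in_itv/=; split; apply/andP; split; lra.
have h2 : ((4^-1)%:E <= leb2 unit_triangle)%E.
  rewrite (_ : (4^-1)%:E = leb2 (`[0%R, 2^-1%R] `*` `[0%R, 2^-1%R])); last first.
    by rewrite leb2_rectangle ?invr_ge0// subr0; congr (_%:E); field.
  apply: le_leb2; [exact: measurableX|exact: measurable_unit_triangle|].
  move=> s /=; rewrite !in_itv/= => -[/andP[? ?] /andP[? ?]].
  by split=> //; lra.
move: h1 h2; case: (leb2 unit_triangle) => // A _; rewrite lee_fin => A4.
by exists A => //; lra.
Qed.

Lemma leb2_bary0 K x y z : frame K x y z ->
  leb2 (bary z x y @^-1` [set 0%R]) = 0%E.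
Proof.
move=> f; rewrite ((scales_area_frame_map f.2).2).
  rewrite (_ : _ @^-1` _ = setT `*` [set 0%R]); last first.
    apply/seteqP; split=> s /=; have [_ _ ->] := bary_frame_map s f => //.
    by case.
  have -> : leb2 (setT `*` [set 0%R]) = (leb setT * leb [set 0%R])%E.
    by apply: product_measure1E.
  by rewrite lebesgue_measure_set1 !mule0.
rewrite (_ : [set 0%R] = [set` `[0%R, 0%R] ]); last by rewrite set_itv1.
exact: measurable_bary_itv.
Qed.

Lemma leb2_boundary_tri K : Defs.nondegenerate K ->
  leb2 (tri K `\` interior (tri K)) = 0%E.
Proof.
move=> nK; have [x [y [z f]]] := nondegenerate_frame nK.
have f2 := frame_rot f; have f3 := frame_rot f2.
have m0 a b c : measurable (bary a b c @^-1` [set 0%R] : set (plane R)).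
  rewrite (_ : [set 0%R] = [set` `[0%R, 0%R] ]); last by rewrite set_itv1.
  exact: measurable_bary_itv.
apply/eqP; rewrite eq_le measure_ge0 andbT.
have N : leb2 (bary x y z @^-1` [set 0%R] `|` bary y z x @^-1` [set 0%R] `|`
   bary z x y @^-1` [set 0%R]) = 0%E.
  apply: null_set_setU; [by apply: measurableU; exact: m0|exact: m0|
    |exact: (leb2_bary0 f)].
  by apply: null_set_setU; [exact: m0|exact: m0|exact: (leb2_bary0 f2)|
    exact: (leb2_bary0 f3)].
rewrite -N; apply: le_leb2.
- by apply: measurableD; [exact: measurable_tri|exact: measurable_interior_tri].
- by apply: measurableU; [apply: measurableU|]; exact: m0.
move=> w [/(triP _ f)[b1 b2 b3] /(interior_triP _ f) ni] /=.
have [e1|n1] := eqVneq (bary x y z w) 0%R; first by left; left.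
have [e2|n2] := eqVneq (bary y z x w) 0%R; first by left; right.
have [e3|n3] := eqVneq (bary z x y w) 0%R; first by right.
by exfalso; apply: ni; split; rewrite lt_neqAle eq_sym ?n1 ?n2 ?n3.
Qed.

(** The interiors of the triangles of a mesh are disjoint, and on them [broken_grad] is the gradient
    of one polynomial. *)
Lemma ge0_integral_interior K (g : plane R -> \bar R) : Defs.nondegenerate K ->
  measurable_fun setT g -> (forall x, (0 <= g x)%E) ->
  (\int[leb2]_(x in tri K) g x = \int[leb2]_(x in interior (tri K)) g x)%E.
Proof.
move=> nK mg g0.
pose m : {measure set (measurableTypeR R * measurableTypeR R) -> \bar R} := leb2.
suff : (\int[m]_(x in tri K) g x = \int[m]_(x in interior (tri K)) g x)%E by [].
have mt := measurable_tri nK; have mi := measurable_interior_tri nK.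
have -> : interior (tri K) = tri K `\` (tri K `\` interior (tri K)).
  by rewrite setDD (setIidr (@interior_subset _ _)).
apply: ge0_negligible_integral => //.
- exact: measurableD.
- exact: measurable_funTS.
- exact: leb2_boundary_tri.
Qed.

End Area.

(** * Inverse estimates for polynomials *)

Section UnivariateInverse.
Context {R : realType}.
Local Notation leb := (@lebesgue_measure R).
Implicit Types (p q : {poly R}).

Lemma measurable_horner p : measurable_fun setT (horner p).
Proof. by apply: continuous_measurable_fun; exact: continuous_horner. Qed.

Lemma integrable_horner p : leb.-integrable `[0, 1]%classic (EFin \o horner p).
Proof.
apply: continuous_compact_integrable; first exact: segment_compact.
by apply: continuous_subspaceT => x; exact: continuous_horner.
Qed.

Definition Ipoly p : R := \int[leb]_(x in `[0, 1]) p.[x].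

Lemma IpolyD p q : Ipoly (p + q) = Ipoly p + Ipoly q.
Proof.
rewrite /Ipoly -RintegralD//; [|exact: integrable_horner|exact: integrable_horner].
by apply: eq_Rintegral => x _; rewrite hornerD.
Qed.

Lemma IpolyZ a p : Ipoly (a *: p) = a * Ipoly p.
Proof.
rewrite /Ipoly -RintegralZl//; last exact: integrable_horner.
by apply: eq_Rintegral => x _; rewrite hornerZ.
Qed.

Lemma Ipoly0 : Ipoly 0 = 0.
Proof. by rewrite -(scale0r 0) IpolyZ mul0r. Qed.

Lemma Ipoly_sum n (F : 'I_n -> {poly R}) :
  Ipoly (\sum_(i < n) F i) = \sum_(i < n) Ipoly (F i).
Proof. by elim/big_ind2: _ => [|? ? ? ? <- <-|//]; [exact: Ipoly0|exact: IpolyD]. Qed.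

Lemma IpolyE p : (forall x, 0 <= p.[x]) ->
  (Ipoly p)%:E = (\int[leb]_(x in `[0%R, 1%R]) (p.[x])%:E)%E.
Proof.
move=> p0; rewrite /Ipoly /Rintegral fineK//.
by apply: integrable_fin_num => //; exact: integrable_horner.
Qed.

Lemma sqr_poly_ge0 p x : 0 <= (p ^+ 2).[x].
Proof. by rewrite horner_exp sqr_ge0. Qed.

Lemma Ipoly_sqr_ge0 p : 0 <= Ipoly (p ^+ 2).
Proof. by apply: Rintegral_ge0 => x _; exact: sqr_poly_ge0. Qed.

(** The square vanishes almost everywhere; if [p] were nonzero, its finitely many roots and a null
    set would cover an interval of length 1. *)
Lemma Ipoly_sqr_eq0 p : Ipoly (p ^+ 2) = 0 -> p = 0.
Proof.
move=> I0; apply: contrapT => /eqP p0.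
have : (\int[leb]_(x in `[0%R, 1%R]) `|((p ^+ 2).[x])%:E|)%E = 0%E.
  transitivity (Ipoly (p ^+ 2))%:E; last by rewrite I0.
  rewrite IpolyE; last exact: sqr_poly_ge0.
  by apply: eq_integral => x _; rewrite gee0_abs// lee_fin sqr_poly_ge0.
have mf : measurable_fun (`[0, 1]%classic : set R) (fun x => ((p ^+ 2).[x])%:E).
  by apply: measurable_funTS; apply/measurable_EFinP; exact: measurable_horner.
move/(ae_eq_integral_abs leb (measurable_itv _) mf).1 => [N [mN N0 sub]].
have fr : finite_set [set x | root p x].
  apply: contrapT => /infinite_set_fsetP /(_ (size p))[B Bsub pB].
  have := max_poly_roots p0 _ (fset_uniq B); rewrite ltnNge pB => /(_ _)/negP.
  by apply=> //; apply/allP => x xB; exact: Bsub.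
have cr : countable [set x | root p x] by exact: finite_set_countable.
have sub2 : `[0, 1]%classic `<=` N `|` [set x | root p x].
  move=> x x01; have [rx|nrx] := boolP (root p x); first by right.
  left; apply: sub => /= h; move: nrx; rewrite /root.
  have := h x01; rewrite /cst => -[]; rewrite horner_exp => /eqP.
  by rewrite sqrf_eq0 => ->.
have : (leb `[0%R, 1%R]%classic <= leb (N `|` [set x | root p x]))%E.
  apply: le_measure; rewrite ?inE//; apply: measurableU => //.
  exact: countable_measurable.
rewrite null_set_setU//; last 2 first.
- exact: countable_measurable.
- exact: countable_lebesgue_measure0.
by rewrite lebesgue_measure_itv/= lte_fin ltr01 oppr0 adde0 lee_fin ler10.
Qed.

(* The shift by [1] only serves to avoid dividing by zero. *)
Lemma Ipoly_cauchy_schwarz p q :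
  Ipoly (p * q) ^+ 2 <= (Ipoly (q ^+ 2) + 1) * Ipoly (p ^+ 2).
Proof.
have q0 := Ipoly_sqr_ge0 q; set r := Ipoly (q ^+ 2) in q0 *.
set b := Ipoly (p * q); have r1 : 0 < r + 1 by lra.
pose t := b / (r + 1).
have := Ipoly_sqr_ge0 (p + (- t) *: q).
have -> : (p + (- t) *: q) ^+ 2 =
    p ^+ 2 + (- t) *: (p * q) + (- t) *: (p * q) + (t ^+ 2) *: (q ^+ 2).
  by rewrite -!mul_polyC polyC_exp polyCN; ring.
rewrite !IpolyD !IpolyZ -/r -/b => h.
have tb : b = t * (r + 1) by rewrite /t divfK// gt_eqF.
rewrite tb in h *; nra.
Qed.

Lemma rVpolyE n (v : 'rV[R]_n) : rVpoly v = \sum_(i < n) v ord0 i *: 'X^i.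
Proof. by rewrite /rVpoly poly_def; apply: eq_bigr => i _; rewrite valK. Qed.

(** The inverse of the Gram matrix of the monomials recovers the coefficients from the moments
    [Ipoly (p * 'X^j)], which the Cauchy-Schwarz inequality bounds. The Gram matrix is invertible
    because a vector in its kernel gives a polynomial whose square has integral zero. *)
Lemma coef_bound n : exists2 C : R, 0 < C & forall p, (size p <= n)%N ->
  forall i, `|p`_i| <= C * Num.sqrt (Ipoly (p ^+ 2)).
Proof.
pose G : 'M[R]_n := \matrix_(i, j) Ipoly ('X^i * 'X^j).
have Gmul (v : 'rV[R]_n) j : (v *m G) ord0 j = Ipoly (rVpoly v * 'X^j).
  rewrite mxE rVpolyE mulr_suml Ipoly_sum; apply: eq_bigr => i _.
  by rewrite mxE -scalerAl IpolyZ.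
have Gu : G \in unitmx.
  rewrite -row_free_unit; apply: inj_row_free => v vG.
  have : Ipoly (rVpoly v ^+ 2) = 0.
    rewrite expr2 {2}rVpolyE mulr_sumr Ipoly_sum big1// => i _.
    by rewrite -scalerAr IpolyZ -Gmul vG mxE mulr0.
  by move/Ipoly_sqr_eq0 => v0; rewrite -(rVpolyK v) v0 linear0.
pose H := invmx G.
pose c (i : 'I_n) := \sum_(j < n) Num.sqrt (Ipoly ('X^j ^+ 2) + 1) * `|H j i|.
have c0 i : 0 <= c i by apply: sumr_ge0 => j _; rewrite mulr_ge0 ?sqrtr_ge0.
(* The summand 1 keeps the constant positive for [n = 0]. *)
exists (1 + \sum_(i < n) c i); first by rewrite ltr_wpDr// sumr_ge0.
move=> p pn i; set b := Num.sqrt _; have b0 : 0 <= b by exact: sqrtr_ge0.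
have sc0 : 0 <= \sum_(i < n) c i by exact: sumr_ge0.
have [ni|ni] := leqP n i.
  by rewrite nth_default ?(leq_trans pn)// normr0 mulr_ge0// addr_ge0.
pose v : 'rV[R]_n := poly_rV p.
have -> : p`_i = \sum_(j < n) Ipoly (p * 'X^j) * H j (Ordinal ni).
  transitivity (v ord0 (Ordinal ni)); first by rewrite mxE.
  rewrite -[v in LHS](mulmxK Gu) mxE; apply: eq_bigr => j _.
  by rewrite Gmul poly_rV_K.
apply: le_trans (ler_norm_sum _ _ _) _.
apply: (@le_trans _ _ (c (Ordinal ni) * b)); last first.
  rewrite ler_wpM2r// (bigD1 (Ordinal ni))//= addrCA ler_wpDr// addr_ge0//.
  exact: sumr_ge0.
rewrite /c mulr_suml; apply: ler_sum => j _; rewrite normrM mulrAC ler_wpM2r//.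
rewrite -sqrtr_sqr -sqrtrM; last by rewrite addr_ge0// Ipoly_sqr_ge0.
by rewrite ler_sqrt ?mulr_ge0 ?addr_ge0 ?Ipoly_sqr_ge0// Ipoly_cauchy_schwarz.
Qed.

(** The weight [i.+1] in [S] lets one estimate serve both [p] and its derivative, whose coefficient
    of index [i] is [i.+1] times that of [p] of index [i.+1]. *)
Lemma horner_bound n (M : R) : 0 <= M -> exists2 C : R, 0 < C &
  forall p, (size p <= n)%N -> forall x, `|x| <= M ->
  p.[x] ^+ 2 <= C * Ipoly (p ^+ 2) /\ p^`().[x] ^+ 2 <= C * Ipoly (p ^+ 2).
Proof.
move=> M0; have [C C0 Cp] := coef_bound n.
pose S := \sum_(i < n) i.+1%:R * M ^+ i.
have S0 : 0 <= S by apply: sumr_ge0 => i _; rewrite mulr_ge0// exprn_ge0.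
exists ((C * S) ^+ 2 + 1); first by rewrite ltr_wpDl// sqr_ge0.
move=> p pn x xM; have I0 := Ipoly_sqr_ge0 p.
set b := Num.sqrt (Ipoly (p ^+ 2)).
have b0 : 0 <= b by exact: sqrtr_ge0.
have bE : b ^+ 2 = Ipoly (p ^+ 2) by rewrite sqr_sqrtr.
suff main q : (size q <= n)%N -> (forall i, `|q`_i| <= i.+1%:R * (C * b)) ->
    q.[x] ^+ 2 <= ((C * S) ^+ 2 + 1) * Ipoly (p ^+ 2).
  have Cb0 : 0 <= C * b by rewrite mulr_ge0// ltW.
  split; apply: main.
  - exact: pn.
  - move=> i; apply: le_trans (Cp p pn i) _.
    by rewrite ler_peMl// ler1n.
  - by apply: leq_trans pn; rewrite (leq_trans (size_poly _ _))// leq_pred.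
  - move=> i; rewrite coef_deriv normrMn -[leLHS]mulr_natl.
    by rewrite ler_wpM2l// Cp.
move=> qn qi; rewrite -bE; apply: (@le_trans _ _ ((C * S * b) ^+ 2)); last first.
  by rewrite exprMn ler_wpM2r ?sqr_ge0// ler_wpDr.
have : `|q.[x]| <= C * S * b.
  rewrite (horner_coef_wide _ qn); apply: le_trans (ler_norm_sum _ _ _) _.
  rewrite /S mulr_sumr mulr_suml; apply: ler_sum => i _.
  rewrite normrM normrX.
  have -> : C * (i.+1%:R * M ^+ i) * b = i.+1%:R * (C * b) * M ^+ i by ring.
  by apply: ler_pM => //; rewrite lerXn2r// nnegrE.
rewrite -(real_normK (num_real q.[x])) => h.
by rewrite lerXn2r// nnegrE// (le_trans _ h).
Qed.

(* [h] is the length of the interval and [M * h] the distance up to which the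
   polynomial is controlled. *)
Lemma horner_bound_itv n (M : R) : 0 <= M -> exists2 C : R, 0 < C &
  forall p, (size p <= n)%N -> forall x0 h x, 0 < h -> `|x - x0| <= M * h ->
  ((h * p.[x] ^+ 2)%:E <=
     C%:E * \int[leb]_(t in `[x0, (x0 + h)%R]) (p.[t] ^+ 2)%:E)%E /\
  ((h ^+ 3 * p^`().[x] ^+ 2)%:E <=
     C%:E * \int[leb]_(t in `[x0, (x0 + h)%R]) (p.[t] ^+ 2)%:E)%E.
Proof.
move=> M0; have [C C0 hC] := horner_bound n M0; exists C => // p pn x0 h x h0 xM.
(* Composition with [a] transports the interval to [0, 1]. The derivative of the composition carries
   a factor [h], whence [h ^+ 3] in the second bound. *)
pose a : {poly R} := h *: 'X + x0%:P.
have ha : h != 0 by rewrite gt_eqF.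
have sa : size a = 2.
  by rewrite /a size_polyDl size_scale ?size_polyX// size_polyC; case: (x0 != 0).
have aE s : a.[s] = x0 + h * s by rewrite /a !hornerE addrC.
pose q := p \Po a.
have qE s : q.[s] = p.[x0 + h * s] by rewrite horner_comp aE.
have qn : (size q <= n)%N by rewrite size_comp_poly2.
have hI : (h%:E * (Ipoly (q ^+ 2))%:E =
    \int[leb]_(t in `[x0, (x0 + h)%R]) (p.[t] ^+ 2)%:E)%E.
  have s0 t : 0 <= (q ^+ 2).[t] by exact: sqr_poly_ge0.
  rewrite (IpolyE s0) [RHS]integral_mkcond (@ge0_integral_aff _ h x0)//; last 2 first.
  - apply/(measurable_restrictT _ _).1 => //.
    apply: measurable_funTS; apply/measurable_EFinP.
    by apply: measurable_funX; exact: measurable_horner.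
  - by move=> t; rewrite patchE; case: ifP => // _; rewrite lee_fin sqr_ge0.
  rewrite (gtr0_norm h0); congr (_ * _)%E.
  rewrite integral_mkcond; apply: eq_integral => t _.
  rewrite !patchE horner_exp qE (addrC (h * t)).
  have -> : (x0 + h * t \in `[x0, (x0 + h)]%classic) = (t \in `[0, 1]%classic).
    apply/idP/idP; rewrite !inE /= !in_itv/= => /andP[t0 t1]; apply/andP; split; nra.
  by [].
pose s := (x - x0) / h.
have xE : x0 + h * s = x by rewrite /s mulrC divfK// addrC subrK.
have sM : `|s| <= M.
  by rewrite /s normrM normfV (gtr0_norm h0) ler_pdivrMr.
have [h1 h2] := hC q qn s sM.
have dq : q^`().[s] = h * p^`().[x].
  rewrite deriv_comp hornerM horner_comp aE xE mulrC; congr (_ * _).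
  by rewrite /a derivD derivZ derivX derivC addr0 hornerZ hornerC mulr1.
rewrite -hI -!EFinM !lee_fin; split.
  by rewrite -xE -qE (mulrCA C) ler_wpM2l// ltW.
by rewrite (mulrCA C) exprS -mulrA (ler_wpM2l (ltW h0))// -exprMn -dq.
Qed.

End UnivariateInverse.

(** * Polynomials in two variables on a square *)

Section BivariateInverse.
Context {R : realType}.
Local Notation leb := (@lebesgue_measure R).
Local Notation i0 := (ord0 : 'I_2).
Local Notation i1 := (ord_max : 'I_2).
Implicit Types (p q : poly2 R) (x w : plane R).

Lemma pevalB p q x : peval (p - q) x = peval p x - peval q x.
Proof. exact: mevalB. Qed.

Lemma peval_sum s (c : multinom 2 -> R) x :
  peval (\sum_(m <- s) c m *: mpolyX R m) x =
  \sum_(m <- s) c m * (x.1 ^+ m i0 * x.2 ^+ m i1).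
Proof.
rewrite /peval raddf_sum/=; apply: eq_bigr => m _.
rewrite mevalZ mevalX !big_ord_recl big_ord0 mulr1 /=.
by have -> : lift ord0 ord0 = i1 by exact: val_inj.
Qed.

Lemma pevalE p x :
  peval p x = \sum_(m <- msupp p) mcoeff m p * (x.1 ^+ m i0 * x.2 ^+ m i1).
Proof. by rewrite {1}(mpolyE p) peval_sum. Qed.

Lemma peval_mderivE i p x : peval (mderiv i p) x =
  \sum_(m <- msupp p) ((m i)%:R * mcoeff m p) *
    (x.1 ^+ (m i0 - (i == i0)) * x.2 ^+ (m i1 - (i == i1))).
Proof.
rewrite /peval /mderiv raddf_sum/=; apply: eq_bigr => m _.
rewrite mevalZ mevalX !big_ord_recl big_ord0 mulr1 /=.
have -> : lift ord0 ord0 = i1 by exact: val_inj.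
by rewrite !mnmBE !mnm1E.
Qed.

Lemma measurable_peval q : measurable_fun setT (peval q).
Proof.
rewrite (_ : peval q = fun x => \sum_(m <- msupp q) mcoeff m q * (x.1 ^+ m i0 * x.2 ^+ m i1)).
  apply: measurable_sum => m; apply: measurable_funM; first exact: measurable_cst.
  by apply: measurable_funM; apply: measurable_funX;
    [exact: measurable_fst_plane|exact: measurable_snd_plane].
by apply/funext => x; exact: pevalE.
Qed.

Lemma deg_le_mderiv k i q : deg_le k q -> deg_le k (mderiv i q).
Proof.
rewrite /deg_le /mderiv => qk; apply: leq_trans (msize_sum _ _ _) _.
apply/bigmax_leqP_seq => m ms _; apply: leq_trans (msizeZ_le _ _) _.
by rewrite msizeX (leq_trans _ qk)// (leq_ltn_trans (mdegB _ _))// msize_mdeg_lt.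
Qed.

Lemma deg_leB k p q : deg_le k p -> deg_le k q -> deg_le k (p - q).
Proof.
rewrite /deg_le => pk qk; apply: leq_trans (msizeD_le _ _) _.
by rewrite geq_max pk msizeN.
Qed.

Lemma deg_le_exp k q (m : multinom 2) (i : 'I_2) : deg_le k q -> m \in msupp q ->
  (m i <= k)%N.
Proof.
move=> qk /msize_mdeg_lt; rewrite mdegE => h.
have : (m i <= \sum_j m j)%N by rewrite (bigD1 i)//= leq_addr.
by move=> h2; rewrite -ltnS; apply: leq_ltn_trans h2 (leq_trans h qk).
Qed.

Lemma slice_x k q (y : R) : deg_le k q -> exists P : {poly R},
  [/\ (size P <= k.+1)%N, forall x : R, P.[x] = peval q (x, y) &
      forall x : R, P^`().[x] = peval (mderiv i0 q) (x, y)].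
Proof.
move=> qk; exists (\sum_(m <- msupp q) (mcoeff m q * y ^+ m i1) *: 'X^(m i0)); split.
- apply/leq_sizeP => j kj; rewrite coef_sum big_seq big1// => m ms.
  rewrite coefZ coefXn (_ : j == _ = false) ?mulr0//.
  by rewrite gtn_eqF// (leq_ltn_trans (deg_le_exp i0 qk ms)).
- move=> x; rewrite pevalE horner_sum; apply: eq_bigr => m _ /=.
  by rewrite hornerZ hornerXn; ring.
- move=> x; rewrite peval_mderivE raddf_sum horner_sum; apply: eq_bigr => m _ /=.
  rewrite derivZ derivXn hornerZ hornerMn hornerXn /= ?eqxx subn1 subn0 -mulr_natl.
  by ring.
Qed.

Lemma slice_y k q (x : R) : deg_le k q -> exists P : {poly R},
  [/\ (size P <= k.+1)%N, forall y : R, P.[y] = peval q (x, y) &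
      forall y : R, P^`().[y] = peval (mderiv i1 q) (x, y)].
Proof.
move=> qk; exists (\sum_(m <- msupp q) (mcoeff m q * x ^+ m i0) *: 'X^(m i1)); split.
- apply/leq_sizeP => j kj; rewrite coef_sum big_seq big1// => m ms.
  rewrite coefZ coefXn (_ : j == _ = false) ?mulr0//.
  by rewrite gtn_eqF// (leq_ltn_trans (deg_le_exp i1 qk ms)).
- move=> y; rewrite pevalE horner_sum; apply: eq_bigr => m _ /=.
  by rewrite hornerZ hornerXn; ring.
- move=> y; rewrite peval_mderivE raddf_sum horner_sum; apply: eq_bigr => m _ /=.
  rewrite derivZ derivXn hornerZ hornerMn hornerXn /= ?eqxx subn1 subn0 -mulr_natl.
  by ring.
Qed.

Local Open Scope ereal_scope.

Lemma iterated_integral (g : plane R -> \bar R) (I J : interval R) :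
  measurable_fun setT g -> (forall x, 0 <= g x) ->
  \int[leb2]_(x in [set` I] `*` [set` J]) g x =
  \int[leb]_(s in [set` I]) \int[leb]_(t in [set` J]) g (s, t).
Proof.
move=> mg g0; have mIJ : measurable ([set` I] `*` [set` J] : set (plane R)).
  by apply: measurableX.
have mr : measurable_fun setT (g \_ ([set` I] `*` [set` J])).
  by apply/(measurable_restrictT _ mIJ); exact: measurable_funTS.
rewrite integral_mkcond.
rewrite (@fubini_tonelli1 _ _ _ _ _ leb leb)//; last by move=> x; rewrite patchE; case: ifP.
rewrite [RHS]integral_mkcond; apply: eq_integral => s _.
rewrite /fubini_F patchE; have [sI|sI] := boolP (s \in [set` I]).
  rewrite [RHS]integral_mkcond; apply: eq_integral => t _.
  rewrite !patchE; congr (if _ then _ else _).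
  by apply/idP/idP; rewrite !inE /=; [case|move=> ?; split=> //; rewrite inE in sI].
apply: integral0_eq => t _; rewrite patchE ifF//; apply/negP; rewrite inE => -[/= sI' _].
by move: sI; rewrite notin_setE.
Qed.

(** The univariate bound is applied on the horizontal line through [w] and then on every vertical
    line. A derivative has the weight [h ^+ 3] instead of [h] in its own direction, which turns
    [h ^+ 2] into [h ^+ 4]. *)
Lemma peval_bound_square k (M : R) : (0 <= M)%R -> exists2 C : R, (0 < C)%R &
  forall q, deg_le k q -> forall (x0 y0 h : R) w, (0 < h)%R ->
  (`|w.1 - x0| <= M * h)%R -> (`|w.2 - y0| <= M * h)%R ->
  let I := C%:E * \int[leb2]_(x in `[x0, (x0 + h)%R] `*` `[y0, (y0 + h)%R])
    (peval q x ^+ 2)%:E in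
  [/\ (h ^+ 2 * peval q w ^+ 2)%:E <= I,
      (h ^+ 4 * peval (mderiv i0 q) w ^+ 2)%:E <= I &
      (h ^+ 4 * peval (mderiv i1 q) w ^+ 2)%:E <= I].
Proof.
move=> M0; have [C C0 hC] := horner_bound_itv k.+1 M0.
exists (C ^+ 2)%R; first by rewrite exprn_gt0.
move=> q qk x0 y0 h [u v] h0 /= wx wy; have C0' := ltW C0; have h0' := ltW h0.
have mq p : measurable_fun setT (fun x => (peval p x ^+ 2)%:E).
  by apply/measurable_EFinP; apply: measurable_funX; exact: measurable_peval.
have q20 p (x : plane R) : 0 <= (peval p x ^+ 2)%:E by rewrite lee_fin sqr_ge0.
rewrite iterated_integral//.
have m1 p (t : R) : measurable_fun setT (fun s : R => (peval p (s, t) ^+ 2)%:E).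
  exact: (measurable_fun_pair1 t (mq p)).
have mF : measurable_fun setT (fun s : R =>
    \int[leb]_(t in `[y0, (y0 + h)%R]) (peval q (s, t) ^+ 2)%:E).
  have mJ : measurable (setT `*` `[y0, (y0 + h)%R] : set (plane R)).
    by apply: measurableX.
  have mf : measurable_fun setT
      ((fun x => (peval q x ^+ 2)%:E) \_ (setT `*` `[y0, (y0 + h)%R])).
    by apply/(measurable_restrictT _ mJ); exact: measurable_funTS.
  have := @measurable_fun_fubini_tonelli_F _ _ _ _ _ leb _ mf.
  rewrite (_ : fubini_F _ _ = fun s : R =>
    \int[leb]_(t in `[y0, (y0 + h)%R]) (peval q (s, t) ^+ 2)%:E).
    by apply => x; rewrite patchE; case: ifP.
  apply/funext => s; rewrite /fubini_F [RHS]integral_mkcond.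
  apply: eq_integral => t _; rewrite !patchE; congr (if _ then _ else _).
  by apply/idP/idP; rewrite !inE /=; [case|].
(* Here [p] is the polynomial bounded along the horizontal line: [q] itself, or its derivative in
   the second variable when that derivative is to be bounded. *)
have step p (c b : R) : (0 <= b)%R ->
    c%:E <= C%:E * \int[leb]_(s in `[x0, (x0 + h)%R]) (peval p (s, v) ^+ 2)%:E ->
    (forall s, (b * peval p (s, v) ^+ 2)%:E <=
       C%:E * \int[leb]_(t in `[y0, (y0 + h)%R]) (peval q (s, t) ^+ 2)%:E) ->
    (b * c)%:E <= (C ^+ 2)%:E *
      \int[leb]_(s in `[x0, (x0 + h)%R])
        \int[leb]_(t in `[y0, (y0 + h)%R]) (peval q (s, t) ^+ 2)%:E.
  move=> b0 h1 h2; rewrite EFinM expr2 EFinM -muleA.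
  apply: (@le_trans _ _ (b%:E * (C%:E *
      \int[leb]_(s in `[x0, (x0 + h)%R]) (peval p (s, v) ^+ 2)%:E))).
    by rewrite lee_wpmul2l// lee_fin.
  rewrite muleCA lee_wpmul2l ?lee_fin//.
  rewrite -ge0_integralZl_EFin//; last exact: (measurable_funTS (m1 p v)).
  rewrite -ge0_integralZl_EFin//; last 2 first.
  - by move=> s _; apply: integral_ge0 => t _.
  - exact: (measurable_funTS mF).
  apply: ge0_le_integral => //.
  - by move=> s _; rewrite mule_ge0// lee_fin.
  - by apply: measurable_funeM; exact: (measurable_funTS (m1 p v)).
  - by apply: measurable_funeM; exact: (measurable_funTS mF).
  - by move=> s _; rewrite -EFinM; exact: h2.
have bx p : deg_le k p ->
    (h * peval p (u, v) ^+ 2)%:E <= C%:E *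
      \int[leb]_(s in `[x0, (x0 + h)%R]) (peval p (s, v) ^+ 2)%:E /\
    (h ^+ 3 * peval (mderiv i0 p) (u, v) ^+ 2)%:E <= C%:E *
      \int[leb]_(s in `[x0, (x0 + h)%R]) (peval p (s, v) ^+ 2)%:E.
  move=> pk; have [P [Ps PE PE']] := slice_x v pk.
  have := hC P Ps x0 h u h0 wx; rewrite PE PE'.
  by under eq_integral do rewrite PE.
have by_ s p : deg_le k p ->
    (h * peval p (s, v) ^+ 2)%:E <= C%:E *
      \int[leb]_(t in `[y0, (y0 + h)%R]) (peval p (s, t) ^+ 2)%:E /\
    (h ^+ 3 * peval (mderiv i1 p) (s, v) ^+ 2)%:E <= C%:E *
      \int[leb]_(t in `[y0, (y0 + h)%R]) (peval p (s, t) ^+ 2)%:E.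
  move=> pk; have [P [Ps PE PE']] := slice_y s pk.
  have := hC P Ps y0 h v h0 wy; rewrite PE PE'.
  by under eq_integral do rewrite PE.
have h3 : (0 <= h ^+ 3)%R by rewrite exprn_ge0.
split.
- rewrite (_ : h ^+ 2 * _ = h * (h * peval q (u, v) ^+ 2))%R; last by ring.
  by apply: step (bx q qk).1 _ => // s; exact: (by_ s q qk).1.
- rewrite (_ : h ^+ 4 * _ = h * (h ^+ 3 * peval (mderiv i0 q) (u, v) ^+ 2))%R; last by ring.
  by apply: step (bx q qk).2 _ => // s; exact: (by_ s q qk).1.
- rewrite (_ : h ^+ 4 * _ = h ^+ 3 * (h * peval (mderiv i1 q) (u, v) ^+ 2))%R; last by ring.
  by apply: step (bx _ (deg_le_mderiv i1 qk)).1 _ => // s; exact: (by_ s q qk).2.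
Qed.

End BivariateInverse.

(** * Polynomials on shape-regular triangles *)

Section TriangleInverse.
Context {R : realType}.
Local Notation i0 := (ord0 : 'I_2).
Local Notation i1 := (ord_max : 'I_2).
Implicit Types (K : triangle R) (q : poly2 R) (x y z w : plane R).

Lemma frame_area : exists2 A : R, 0 < A & forall K x y z,
  Defs.nondegenerate K -> frame K x y z ->
  area K = A * `|det2 (y - x) (z - x)| /\ leb2 (tri K) = (area K)%:E.
Proof.
have [A A0 AE] := @leb2_unit_triangle R; exists A => // K x y z nK f.
by rewrite /area (leb2_tri nK f) AE -EFinM /= mulrC.
Qed.

Lemma coord_le (e : plane R) (L : R) : 0 <= L -> dot e e <= L ^+ 2 ->
  `|e.1| <= L /\ `|e.2| <= L.
Proof.
move=> L0; rewrite /dot -!expr2 => h.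
have h1 := sqr_ge0 e.1; have h2 := sqr_ge0 e.2.
split; rewrite -[leRHS](ger0_norm L0) -ler_sqr ?nnegrE// !real_normK ?num_real//; lra.
Qed.

(** The distance of a coordinate from that of the centroid: the difference is a third of a convex
    combination of terms, each the difference of two edge components, so it is at most 2/3 of
    [L]. *)
Lemma convex_dist (s t u X Y Z L : R) : 0 <= s -> 0 <= t -> 0 <= u ->
  s + t + u = 1 -> `|Y - X| <= L -> `|Z - Y| <= L -> `|X - Z| <= L ->
  `|s * X + t * Y + u * Z - 3^-1 * (X + Y + Z)| <= L.
Proof.
move=> s0 t0 u0 stu; rewrite !ler_norml => /andP[a1 a2] /andP[b1 b2] /andP[c1 c2].
have -> : s * X + t * Y + u * Z - 3^-1 * (X + Y + Z) =
  3^-1 * (s * ((X - Z) - (Y - X)) + t * ((Y - X) - (Z - Y)) + u * ((Z - Y) - (X - Z))).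
  have -> : s = 1 - t - u by lra.
  by field.
have bnd (r v L' : R) : 0 <= r -> - L' <= v -> v <= L' -> - (r * L') <= r * v <= r * L'.
  by move=> r0 h1 h2; rewrite -mulrN !ler_wpM2l.
have /andP[p1 p2] := bnd s ((X - Z) - (Y - X)) (2 * L) s0 ltac:(lra) ltac:(lra).
have /andP[q1 q2] := bnd t ((Y - X) - (Z - Y)) (2 * L) t0 ltac:(lra) ltac:(lra).
have /andP[r1 r2] := bnd u ((Z - Y) - (X - Z)) (2 * L) u0 ltac:(lra) ltac:(lra).
have eL : s * (2 * L) + t * (2 * L) + u * (2 * L) = 2 * L.
  by rewrite -!mulrDl stu mul1r.
by apply/andP; split; lra.
Qed.

(** The square has a corner at the centroid, where all barycentric coordinates are 1/3. With
    [L = 12 * C * h], the two constants are fixed by two equations: [L ^+ 2 = 2 * C * D], so that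
    [L] bounds the components of all edges, and [2 * L * h = D / 3], so that moving by at most [h]
    along both axes changes a barycentric coordinate by at most 1/3. *)
Lemma inscribed_square (C : R) K x y z : 0 < C -> shape_regular C K ->
  frame K x y z -> exists x0 y0 h : R,
  [/\ 0 < h, h ^+ 2 = `|det2 (y - x) (z - x)| / (72 * C),
    `[x0, x0 + h] `*` `[y0, y0 + h] `<=` tri K &
    forall w, tri K w -> `|w.1 - x0| <= 12 * C * h /\ `|w.2 - y0| <= 12 * C * h].
Proof.
move=> C0 sK f; set D := `|_|.
have D0 : 0 < D by rewrite normr_gt0; exact: f.2.
have [g gE] : exists g : plane R, g = 3^-1 *: (x + y + z) by exists (3^-1 *: (x + y + z)).
pose h := Num.sqrt (D / (72 * C)).
have hh : h ^+ 2 = D / (72 * C) by rewrite sqr_sqrtr// divr_ge0// ?ltW// mulr_gt0.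
have h0 : 0 < h by rewrite sqrtr_gt0 divr_gt0// mulr_gt0.
pose L := 12 * C * h.
have L0 : 0 <= L by rewrite /L !mulr_ge0// ltW.
have LL : L ^+ 2 = 2 * C * D.
  by rewrite /L exprMn hh; field; rewrite gt_eqF.
have Lh : 2 * L * h = D / 3.
  have -> : 2 * L * h = 24 * C * h ^+ 2 by rewrite /L; ring.
  by rewrite hh; field; rewrite gt_eqF.
have f2 := frame_rot f; have f3 := frame_rot f2.
have edg a b c : frame K a b c -> `|(b - a).1| <= L /\ `|(b - a).2| <= L.
  move=> fr; apply: coord_le => //; rewrite LL /D (frame_det f fr).
  exact: shape_regular_edge sK fr.
have [e11 e12] := edg _ _ _ f; have [e21 e22] := edg _ _ _ f2.
have [e31 e32] := edg _ _ _ f3.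
exists g.1, g.2, h; split=> //; last first.
  move=> w /(tri_comb _ f)[s [t [u [s0 t0 u0 stu ->]]]].
  by split; rewrite gE !planeE; apply: convex_dist.
move=> w /=; rewrite !in_itv/= => -[/andP[w1 w2] /andP[w3 w4]].
have pos a b c : frame K a b c -> g = 3^-1 *: (a + b + c) -> 0 <= bary a b c w.
  move=> fr gE'; have [_ D'] := fr; have [e1 e2] := edg _ _ _ (frame_rot fr).
  have DE : `|det2 (b - a) (c - a)| = D by rewrite /D (frame_det f fr).
  have -> : bary a b c w = 3^-1 + det2 (c - b) (w - g) / det2 (b - a) (c - a).
    by move: D'; rewrite /bary gE' /det2 !planeE => D'; field.
  have : `|det2 (c - b) (w - g) / det2 (b - a) (c - a)| <= 3^-1.
    rewrite normrM normfV DE ler_pdivrMr// (mulrC 3^-1) -Lh /det2.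
    apply: le_trans (ler_normB _ _) _; rewrite !normrM.
    have -> : 2 * L * h = L * h + L * h by ring.
    apply: lerD; apply: ler_pM => //; rewrite !planeE ger0_norm; lra.
  by rewrite ler_norml => /andP[? ?]; lra.
apply/(triP _ f); split; [exact: (pos _ _ _ f)|apply: (pos _ _ _ f2)|apply: (pos _ _ _ f3)];
  by rewrite gE; congr (_ *: _); apply: plane_eqP; rewrite !planeE; ring.
Qed.

Local Open Scope ereal_scope.

(** All of [K] is within a fixed multiple of [h] of the inscribed square, so the bound on the square
    reaches [w], and replacing the square by [K] only increases the integral. As [area K] is
    [B * h ^+ 2], the factor [B + B ^+ 2] serves both the area and its square. *)
Lemma inverse_estimate k (C : R) : (0 < C)%R -> exists2 C' : R, (0 < C')%R &
  forall K, shape_regular C K -> forall q, deg_le k q -> forall w, tri K w ->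
  let I := C'%:E * int2 (tri K) (fun x => peval q x ^+ 2)%R in
  [/\ (area K * peval q w ^+ 2)%:E <= I,
      (area K ^+ 2 * peval (mderiv i0 q) w ^+ 2)%:E <= I &
      (area K ^+ 2 * peval (mderiv i1 q) w ^+ 2)%:E <= I].
Proof.
move=> C0; have [A A0 hA] := frame_area.
have M0 : (0 <= 12 * C)%R by rewrite mulr_ge0// ltW.
have [C1 C10 hC1] := @peval_bound_square R k _ M0.
pose B := (72 * C * A)%R; have B0 : (0 < B)%R by rewrite !mulr_gt0.
exists ((B + B ^+ 2) * C1)%R; first by rewrite mulr_gt0// addr_gt0// exprn_gt0.
move=> K sK q qk w Kw; have nK := shape_regular_nondegenerate sK.
have [x [y [z f]]] := nondegenerate_frame nK.
have [x0 [y0 [h [h0 hh sub dist]]]] := inscribed_square C0 sK f.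
have [d1 d2] := dist _ Kw.
have [aE _] := hA _ _ _ _ nK f.
have aB : area K = (B * h ^+ 2)%R.
  by rewrite aE hh /B; field; rewrite gt_eqF.
have := hC1 q qk x0 y0 h w h0 d1 d2.
set J := \int[leb2]_(x in _) _ => /= -[j1 j2 j3].
have mq : measurable_fun setT (fun x => (peval q x ^+ 2)%:E).
  by apply/measurable_EFinP; apply: measurable_funX; exact: measurable_peval.
have J0 : 0 <= J by apply: integral_ge0 => ? _; rewrite lee_fin sqr_ge0.
have JI : J <= int2 (tri K) (fun x => peval q x ^+ 2)%R.
  pose m : {measure set (measurableTypeR R * measurableTypeR R) -> \bar R} := leb2.
  apply: (@ge0_subset_integral _ _ _ m) => //.
  - exact: measurableX.
  - exact: measurable_tri.
  - exact: measurable_funTS.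
  - by move=> ? _; rewrite lee_fin sqr_ge0.
have main (b v : R) : (0 <= b)%R -> (b <= B + B ^+ 2)%R -> v%:E <= C1%:E * J ->
    (b * v)%:E <= ((B + B ^+ 2) * C1)%:E * int2 (tri K) (fun x => peval q x ^+ 2)%R.
  move=> b0 bB vJ; rewrite EFinM EFinM -muleA.
  apply: (@le_trans _ _ (b%:E * (C1%:E * J))); first by rewrite lee_wpmul2l// lee_fin.
  apply: lee_pmul; rewrite ?lee_fin//; first by rewrite mule_ge0// lee_fin ltW.
  by rewrite lee_wpmul2l// lee_fin ltW.
have B2 : (0 <= B ^+ 2)%R by rewrite exprn_ge0// ltW.
rewrite aB; split.
- by rewrite -mulrA; apply: main => //; [exact: ltW|rewrite lerDl].
- have -> : ((B * h ^+ 2) ^+ 2 * peval (mderiv i0 q) w ^+ 2 =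
    B ^+ 2 * (h ^+ 4 * peval (mderiv i0 q) w ^+ 2))%R by ring.
  by apply: main => //; rewrite lerDr ltW.
- have -> : ((B * h ^+ 2) ^+ 2 * peval (mderiv i1 q) w ^+ 2 =
    B ^+ 2 * (h ^+ 4 * peval (mderiv i1 q) w ^+ 2))%R by ring.
  by apply: main => //; rewrite lerDr ltW.
Qed.

End TriangleInverse.

(** * Sums of nonnegative terms and edge integrals *)

Section NonnegativeSums.
Context {R : realType}.
Local Open Scope ereal_scope.

Lemma le_sume_term (I : eqType) (s : seq I) (P : pred I) (F : I -> \bar R) i :
  i \in s -> P i -> (forall j, 0 <= F j) -> F i <= \sum_(j <- s | P j) F j.
Proof.
elim: s => // a s IH; rewrite inE => /orP[/eqP <-|is_] Pi F0; rewrite big_cons.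
  by rewrite Pi leeDl// sume_ge0.
case: ifP => // _; last exact: IH.
by apply: le_trans (IH is_ Pi F0) _; rewrite leeDr.
Qed.

(** The charging argument behind the reduction: fine triangles are charged to their parents, fine
    edges to the coarse edges containing them. Terms that are at most 0, such as jumps inside a
    coarse triangle, are charged to nothing. *)
Lemma sume_transfer (I J : eqType) (s : seq I) (t : seq J) (r : I -> J -> bool)
    (F : I -> \bar R) (B : J -> I -> \bar R) (G : J -> \bar R) :
  (forall j i, 0 <= B j i) ->
  (forall i, i \in s -> F i <= 0 \/ exists j, [/\ j \in t, r i j & F i <= B j i]) ->
  (forall j, j \in t -> \sum_(i <- s | r i j) B j i <= G j) ->
  \sum_(i <- s) F i <= \sum_(j <- t) G j.
Proof.
move=> B0 FB BG.
apply: (@le_trans _ _ (\sum_(i <- s) \sum_(j <- t | r i j) B j i)).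
  rewrite big_seq [leRHS]big_seq; apply: lee_sum => i /FB[F0|[j [jt rij FBi]]].
    by apply: le_trans F0 _; exact: sume_ge0.
  by apply: le_trans FBi _; exact: (@le_sume_term _ _ _ (B ^~ i)).
rewrite (exchange_big_dep xpredT)//= big_seq [leRHS]big_seq.
by apply: lee_sum => j jt; exact: BG.
Qed.

Lemma sume_le1 (I : eqType) (s : seq I) (P : pred I) (c : \bar R) : 0 <= c ->
  uniq s -> (forall i j, i \in s -> j \in s -> P i -> P j -> i = j) ->
  \sum_(i <- s | P i) c <= c.
Proof.
move=> c0; elim: s => [|a s IH] /=; first by rewrite big_nil.
move=> /andP[as_ us] h; rewrite big_cons; case: ifP => Pa; last first.
  by apply: IH => // i j is_ js; apply: h; rewrite inE ?is_ ?js orbT.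
rewrite big_seq_cond big1 ?adde0// => i /andP[is_ Pi].
by move: as_; rewrite (h a i) ?is_// inE ?eqxx// is_ orbT.
Qed.

Lemma sume_const_le (I : Type) (s : seq I) (n : nat) (c : \bar R) : 0 <= c ->
  (size s <= n)%N -> \sum_(i <- s) c <= n%:R%:E * c.
Proof.
move=> c0 sn; apply: (@le_trans _ _ ((size s)%:R%:E * c)); last first.
  by rewrite lee_wpmul2r// lee_fin ler_nat.
elim: s {sn} => [|a s IH]; first by rewrite big_nil mul0e.
rewrite big_cons /= -natr1 EFinD ge0_muleDl ?lee_fin// mul1e addeC.
exact: leeD.
Qed.

(** It follows from the definition of the integral as a supremum over simple functions and therefore
    applies directly to the integrand of [grad_dist2]. *)
Lemma le_nonneg_integral d (X : measurableType d)
    (mu : {measure set X -> \bar R}) (F G : X -> \bar R) :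
  (forall x, 0 <= F x) -> (forall x, F x <= G x) ->
  \int[mu]_x F x <= \int[mu]_x G x.
Proof.
move=> F0 FG; have G0 x : 0 <= G x by exact: le_trans (F0 x) (FG x).
rewrite !ge0_integralTE//; apply: le_ereal_sup => _ [h hF <-].
by exists h => // x; exact: le_trans (hF x) (FG x).
Qed.

(** At each point at most one of the functions [F i], extended by zero outside [A i], is nonzero,
    and [G] dominates it there. *)
Lemma sum_integral_disjoint d (X : measurableType d)
    (mu : {measure set X -> \bar R}) (I : choiceType) (s : seq I)
    (A : I -> set X) (F : I -> X -> \bar R) (D : set X) (G : X -> \bar R) :
  uniq s -> (forall i, i \in s -> measurable (A i)) ->
  (forall i, i \in s -> measurable_fun setT (F i)) ->
  (forall i x, 0 <= F i x) ->
  (forall i j x, i \in s -> j \in s -> A i x -> A j x -> i = j) ->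
  (forall i x, i \in s -> A i x -> D x /\ F i x <= G x) -> (forall x, 0 <= G x) ->
  \sum_(i <- s) \int[mu]_(x in A i) F i x <= \int[mu]_(x in D) G x.
Proof.
move=> us mA mF F0 dis FG G0.
pose H i := if i \in s then F i \_ (A i) else cst 0.
have mH i : measurable_fun setT (H i).
  rewrite /H; case: ifP => is_; last exact: measurable_cst.
  by apply/(measurable_restrictT _ (mA _ is_)); apply: measurable_funTS; exact: mF.
have H0 i x : 0 <= H i x.
  by rewrite /H; case: ifP => // _; rewrite patchE; case: ifP.
rewrite (_ : \sum_(i <- s) _ = \sum_(i <- s) \int[mu]_x H i x); last first.
  by apply: eq_big_seq => i is_; rewrite integral_mkcond /H is_.
rewrite -ge0_integral_sum// [leRHS]integral_mkcond.
apply: le_nonneg_integral => x; first exact: sume_ge0.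
have GD0 : 0 <= (G \_ D) x by rewrite patchE; case: ifP.
have [[i [is_ Aix]]|nA] := pselect (exists i, i \in s /\ A i x).
  rewrite (bigD1_seq i)//= big_seq_cond big1 ?adde0.
    have [Dx FGx] := FG _ _ is_ Aix.
    by rewrite /H is_ !patchE (mem_set Aix) (mem_set Dx).
  move=> j /andP[js ji]; rewrite /H js patchE ifF//; apply/negP; rewrite inE => Ajx.
  by rewrite (dis _ _ _ js is_ Ajx Aix) eqxx in ji.
rewrite big_seq big1// => i is_; rewrite /H is_ patchE ifF//.
by apply/negP; rewrite inE => Aix; apply: nA; exists i.
Qed.

Lemma integral_young d (X : measurableType d) (mu : {measure set X -> \bar R})
    (D : set X) (g g1 g2 : X -> R) (a b : R) :
  measurable D -> (0 <= a)%R -> (0 <= b)%R ->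
  measurable_fun setT g -> measurable_fun setT g1 -> measurable_fun setT g2 ->
  (forall x, (0 <= g x)%R) -> (forall x, (0 <= g1 x)%R) -> (forall x, (0 <= g2 x)%R) ->
  (forall x, D x -> (g x <= a * g1 x + b * g2 x)%R) ->
  \int[mu]_(x in D) (g x)%:E <=
  a%:E * \int[mu]_(x in D) (g1 x)%:E + b%:E * \int[mu]_(x in D) (g2 x)%:E.
Proof.
move=> mD a0 b0 mg mg1 mg2 g0 g10 g20 h.
have mE (u : X -> R) : measurable_fun setT u -> measurable_fun D (EFin \o u).
  by move=> mu_; apply: measurable_funTS; exact/measurable_EFinP.
have mgE := mE _ mg; have mg1E := mE _ mg1; have mg2E := mE _ mg2.
rewrite -ge0_integralZl_EFin//; last by move=> x _; rewrite lee_fin.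
rewrite -ge0_integralZl_EFin//; last by move=> x _; rewrite lee_fin.
have m1 : measurable_fun D (fun x => a%:E * (g1 x)%:E) by exact: measurable_funeM.
have m2 : measurable_fun D (fun x => b%:E * (g2 x)%:E) by exact: measurable_funeM.
rewrite -ge0_integralD//; last 2 first.
- by move=> x _; rewrite -EFinM lee_fin mulr_ge0.
- by move=> x _; rewrite -EFinM lee_fin mulr_ge0.
apply: ge0_le_integral => //.
- by move=> x _; rewrite lee_fin.
- exact: emeasurable_funD.
Qed.

End NonnegativeSums.

(** * Integrals over edges and subedges *)

Section EdgeIntegrals.
Context {R : realType}.
Local Notation leb := (@lebesgue_measure R).
Implicit Types (K : triangle R) (E : edge R) (x y z w : plane R).
Implicit Types (o : ordering R) (g : plane R -> R).
Variable Om : set (plane R).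

Lemma measurable_edge_point o E : measurable_fun setT (edge_point o E).
Proof.
apply/measurable_fun_pairP; split; apply: measurable_funD;
  try exact: measurable_cst; apply: measurable_funM; try exact: measurable_cst;
  exact: measurable_id.
Qed.

Lemma measurable_on_edge o E g : measurable_fun setT g ->
  measurable_fun setT (fun t => g (edge_point o E t)).
Proof. by move=> mg; exact: measurableT_comp mg (measurable_edge_point o E). Qed.

Lemma dot_ge0 (a : plane R) : 0 <= dot a a.
Proof. by rewrite /dot addr_ge0// -expr2 sqr_ge0. Qed.

Lemma enorm_sqr (a : plane R) : enorm a ^+ 2 = dot a a.
Proof. by rewrite /enorm sqr_sqrtr// dot_ge0. Qed.

Lemma enormZ (c : R) (a : plane R) : enorm (c *: a) = `|c| * enorm a.
Proof.
rewrite /enorm -sqrtr_sqr -sqrtrM ?sqr_ge0//; congr Num.sqrt.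
by rewrite /dot !planeE; ring.
Qed.

Lemma edge_length_ge0 o E : 0 <= edge_length o E.
Proof. exact: sqrtr_ge0. Qed.

Local Open Scope ereal_scope.

Lemma int_edge_ge0 o E g : (forall x, (0 <= g x)%R) -> 0 <= int_edge o E g.
Proof.
move=> g0; rewrite mule_ge0//; first by rewrite lee_fin edge_length_ge0.
by apply: integral_ge0 => t _; rewrite lee_fin.
Qed.

Lemma int_edge_young o E g g1 g2 (a b : R) : (0 <= a)%R -> (0 <= b)%R ->
  measurable_fun setT g -> measurable_fun setT g1 -> measurable_fun setT g2 ->
  (forall x, (0 <= g x)%R) -> (forall x, (0 <= g1 x)%R) -> (forall x, (0 <= g2 x)%R) ->
  (forall x, (g x <= a * g1 x + b * g2 x)%R) ->
  int_edge o E g <= a%:E * int_edge o E g1 + b%:E * int_edge o E g2.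
Proof.
move=> a0 b0 mg mg1 mg2 g0 g10 g20 h; rewrite /int_edge.
rewrite (muleCA a%:E) (muleCA b%:E) -ge0_muleDr; last 2 first.
- by rewrite mule_ge0 ?lee_fin// integral_ge0// => t _; rewrite lee_fin.
- by rewrite mule_ge0 ?lee_fin// integral_ge0// => t _; rewrite lee_fin.
rewrite lee_wpmul2l ?lee_fin ?edge_length_ge0//.
apply: (@integral_young _ _ _ leb) => //; exact: measurable_on_edge.
Qed.

Lemma eq_int_edge o E g1 g2 : (forall x, g1 x = g2 x) ->
  int_edge o E g1 = int_edge o E g2.
Proof. by move=> h; congr (_ * _); apply: eq_integral => t _; rewrite h. Qed.

Lemma int_edge_sum o E (I : Type) (s : seq I) (F : I -> plane R -> R) :
  (forall i, measurable_fun setT (F i)) -> (forall i x, (0 <= F i x)%R) ->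
  int_edge o E (fun x => \sum_(i <- s) F i x)%R = \sum_(i <- s) int_edge o E (F i).
Proof.
move=> mF F0; rewrite /int_edge -ge0_sume_distrr; last first.
  by move=> i _; apply: integral_ge0 => t _; rewrite lee_fin.
congr (_ * _); rewrite -ge0_integral_sum//; last first.
- by move=> i t _; rewrite lee_fin.
- move=> i; apply: measurable_funTS; apply/measurable_EFinP.
  exact: measurable_on_edge.
by apply: eq_integral => t _; rewrite sumEFin.
Qed.

(** Arc length on [E'] is expressed in the parameter of [E]; the factor [c] is negative if the
    orderings disagree, and [|c|] is the ratio of the lengths. The set [A] uses the relative
    interior of [E'], so that different subedges give disjoint sets; the endpoints are a null
    set. *)
Lemma int_edge_sub o E E' g : edge_ordering Om o ->
  #|` E| = 2%N -> #|` E'| = 2%N -> hull E' `<=` hull E ->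
  measurable_fun setT g -> (forall x, (0 <= g x)%R) ->
  let A := [set s | openseg E' (edge_point o E s)] in
  [/\ measurable A, A `<=` `[0%R, 1%R] & int_edge o E' g =
    (edge_length o E)%:E * \int[leb]_(s in A) (g (edge_point o E s))%:E].
Proof.
move=> ho E2 E2' sub mg g0 A.
have [s0 [s1 [/andP[s00 s01] /andP[s10 s11] s01n e0 e1]]] := subedge_ordering ho E2 E2' sub.
have [EE ab] := ordering_edge ho E2; have [EE' ab'] := ordering_edge ho E2'.
pose c := (s1 - s0)%R; have c0 : (c != 0)%R by rewrite subr_eq0 eq_sym.
have epE t : edge_point o E' t = edge_point o E (c * t + s0)%R.
  by rewrite /edge_point e0 e1 /c; apply: plane_eqP; rewrite !planeE; ring.
have epI s t : edge_point o E s = edge_point o E t -> s = t.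
  move=> /addrI h; apply/eqP; rewrite -subr_eq0; apply: contraT => st.
  have /eqP := h; rewrite -subr_eq0 -scalerBl => /eqP h'.
  exfalso; move/negP: ab; apply; rewrite eq_sym -subr_eq0; apply/eqP.
  by rewrite -[LHS]scale1r -(mulVf st) -scalerA h' scaler0.
have lenE : edge_length o E' = (`|c| * edge_length o E)%R.
  rewrite /edge_length -enormZ; congr enorm.
  by rewrite e0 e1 /c; apply: plane_eqP; rewrite !planeE; ring.
have AE t : A (c * t + s0)%R <-> (0 < t < 1)%R.
  rewrite /A /= -epE; split=> [|t01]; last first.
    by exists (o E').1, (o E').2, t.
  rewrite {1}EE' => /openseg_fset2[_ [t' t'01]]; rewrite -/(edge_point o E' t').
  by rewrite !epE => /epI /addIr /(mulfI c0) ->.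
have tE s : (c * (c^-1 * s + - (s0 / c)) + s0 = s)%R by field.
have AE' : A = aff c^-1 (- (s0 / c))%R @^-1` `]0%R, 1%R[.
  apply/seteqP; split=> s; rewrite /= /aff in_itv/=.
    by move=> As; apply/AE; rewrite tE.
  by move=> /AE; rewrite tE.
have mA : measurable A.
  by rewrite AE' -[X in measurable X]setTI; apply: measurable_aff.
split=> //.
  move=> s As; have [t [/andP[t0 t1] ->]] : exists t : R, (0 < t < 1)%R /\ s = (c * t + s0)%R.
    by exists (c^-1 * s + - (s0 / c))%R; rewrite tE; split=> //; apply/AE; rewrite tE.
  rewrite /= in_itv/= /c; have [sl|sl|sl] := ltgtP s0 s1.
  - by apply/andP; split; nra.
  - by apply/andP; split; nra.
  - by rewrite sl eqxx in s01n.
rewrite [in RHS]integral_mkcond (@ge0_integral_aff _ c s0)//; last 2 first.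
- apply/(measurable_restrictT _ mA); apply: measurable_funTS.
  by apply/measurable_EFinP; exact: measurable_on_edge.
- by move=> s; rewrite patchE; case: ifP => // _; rewrite lee_fin.
rewrite muleA -EFinM (mulrC (edge_length o E)) -lenE /int_edge; congr (_ * _).
transitivity (\int[leb]_(t in `]0%R, 1%R[) (g (edge_point o E' t))%:E).
  apply: integral_itv_bndoo; apply: measurable_funTS; apply/measurable_EFinP.
  exact: measurable_on_edge.
rewrite integral_mkcond; apply: eq_integral => t _; rewrite !patchE epE.
congr (if _ then _ else _); apply/idP/idP; rewrite !inE /= in_itv/=.
  by move/AE.
by move/AE.
Qed.

Lemma sum_subedges o T' K E (L : seq (triangle R * edge R)) g :
  edge_ordering Om o -> triangulation Om T' ->
  Defs.nondegenerate K -> E \in edges K -> uniq L ->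
  (forall e, e \in L -> [/\ e.1 \in T', descendant K e.1, e.2 \in edges e.1 &
    hull e.2 `<=` hull E]) ->
  measurable_fun setT g -> (forall x, (0 <= g x)%R) ->
  \sum_(e <- L) int_edge o e.2 g <= int_edge o E g.
Proof.
move=> ho tT' nK EK uL hL mg g0; have E2 := edge_card2 EK.
have l0 := edge_length_ge0 o E.
pose A (e : triangle R * edge R) := [set s | openseg e.2 (edge_point o E s)].
have sub e : e \in L -> [/\ measurable (A e), A e `<=` `[0%R, 1%R] &
    int_edge o e.2 g =
    (edge_length o E)%:E * \int[leb]_(s in A e) (g (edge_point o E s))%:E].
  by move=> /hL[_ _ /edge_card2 e2 sube]; exact: (int_edge_sub ho E2 e2 sube).
rewrite (_ : \sum_(e <- L) _ = (edge_length o E)%:E *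
    \sum_(e <- L) \int[leb]_(s in A e) (g (edge_point o E s))%:E); last first.
  rewrite ge0_sume_distrr; last by move=> e _; apply: integral_ge0 => s _; rewrite lee_fin.
  by apply: eq_big_seq => e /sub[].
rewrite /int_edge lee_wpmul2l ?lee_fin//.
apply: (@sum_integral_disjoint _ _ _ leb _ L A) => //.
- by move=> e /sub[].
- by move=> e _; apply/measurable_EFinP; exact: measurable_on_edge.
- by move=> e s; rewrite lee_fin.
- move=> [K1 E1] [K2 E3] s /hL[/= K1T d1 E1K sub1] /hL[/= K2T d2 E2K sub2] o1 o2.
  by have [-> ->] := subedge_disjoint tT' nK EK K1T K2T d1 d2 E1K E2K sub1 o1 o2.
- by move=> e s /sub[_ Asub _] Aes; split=> //; exact: Asub.
- by move=> s; rewrite lee_fin.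
Qed.

Lemma sum_subtriangles T' K (L : seq (triangle R)) (g : plane R -> R) :
  triangulation Om T' -> Defs.nondegenerate K -> uniq L ->
  (forall K', K' \in L -> K' \in T' /\ descendant K K') ->
  measurable_fun setT g -> (forall x, (0 <= g x)%R) ->
  \sum_(K' <- L) int2 (tri K') g <= int2 (tri K) g.
Proof.
move=> tT' nK uL hL mg g0.
have mgE : measurable_fun setT (fun x => (g x)%:E) by exact/measurable_EFinP.
have nK' K' : K' \in L -> Defs.nondegenerate K'.
  by move=> /hL[K'T _]; exact: (triangulation_nondegenerate tT' K'T).
rewrite (eq_big_seq (fun K' => \int[leb2]_(x in interior (tri K')) (g x)%:E)); last first.
  by move=> K' K'L; apply: (ge0_integral_interior (nK' _ K'L) mgE) => x; rewrite lee_fin.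
pose m : {measure set (measurableTypeR R * measurableTypeR R) -> \bar R} := leb2.
apply: (@sum_integral_disjoint _ _ _ m _ L (fun K' => interior (tri K'))) => //.
- by move=> K' K'L; apply: measurable_interior_tri; exact: nK'.
- move=> K1 K2 x /hL[K1T _] /hL[K2T _] x1 /interior_subset x2.
  exact: triangulation_interior tT' K1T K2T x1 x2.
- move=> K' x /hL[_ dK'] /interior_subset Kx; split=> //.
  exact: (descendant_tri nK dK' Kx).
Qed.

End EdgeIntegrals.

(** * Laplacian and trace estimates *)

Section Traces.
Context {R : realType}.
Local Notation leb := (@lebesgue_measure R).
Local Notation i0 := (ord0 : 'I_2).
Local Notation i1 := (ord_max : 'I_2).
Implicit Types (K : triangle R) (E : edge R) (x y z w : plane R).
Implicit Types (o : ordering R) (q : poly2 R) (T : {fset triangle R}).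
Variable Om : set (plane R).

Lemma mderiv_sub i (p q : poly2 R) : mderiv i (p - q) = mderiv i p - mderiv i q.
Proof. exact: mderivB. Qed.

Lemma grad_sub p q x : grad (p - q) x = grad p x - grad q x.
Proof. by rewrite /grad !mderiv_sub !pevalB. Qed.

Lemma laplacian_sub p q x : laplacian (p - q) x = laplacian p x - laplacian q x.
Proof. by rewrite /laplacian !mderiv_sub !pevalB; ring. Qed.

Definition grad_sqr q x : R := dot (grad q x) (grad q x).

Lemma grad_sqrE q x :
  grad_sqr q x = peval (mderiv i0 q) x ^+ 2 + peval (mderiv i1 q) x ^+ 2.
Proof. by rewrite /grad_sqr /dot /grad /= !expr2. Qed.

Lemma grad_sqr_ge0 q x : 0 <= grad_sqr q x. Proof. exact: dot_ge0. Qed.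

Lemma measurable_grad_sqr q : measurable_fun setT (grad_sqr q).
Proof.
rewrite (_ : grad_sqr q =
  fun x => peval (mderiv i0 q) x ^+ 2 + peval (mderiv i1 q) x ^+ 2).
  by apply: measurable_funD; apply: measurable_funX; exact: measurable_peval.
by apply/funext => x; exact: grad_sqrE.
Qed.

Lemma measurable_laplacian q : measurable_fun setT (laplacian q).
Proof. by apply: measurable_funD; exact: measurable_peval. Qed.

Lemma dot_sqr_le (a n : plane R) : dot n n <= 1 -> dot a n ^+ 2 <= dot a a.
Proof.
move=> n1; have a0 := dot_ge0 a.
(* Lagrange's identity. *)
have -> : dot a n ^+ 2 = dot a a * dot n n - det2 a n ^+ 2.
  by rewrite /dot /det2; ring.
have := sqr_ge0 (det2 a n).
have : dot a a * dot n n <= dot a a by rewrite ler_piMr.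
by lra.
Qed.

Lemma jump_pw_grad1 o T (u : pwpoly R) E x : (jump o T (pw_grad u) E x).1 =
  \sum_(K <- T | (E \in edges K) && on_left o E K) peval (mderiv i0 (u K)) x -
  \sum_(K <- T | (E \in edges K) && on_right o E K) peval (mderiv i0 (u K)) x.
Proof.
rewrite /jump add_plane1 opp_plane1; congr (_ - _);
  by apply: (big_morph (fun a : plane R => a.1)).
Qed.

Lemma jump_pw_grad2 o T (u : pwpoly R) E x : (jump o T (pw_grad u) E x).2 =
  \sum_(K <- T | (E \in edges K) && on_left o E K) peval (mderiv i1 (u K)) x -
  \sum_(K <- T | (E \in edges K) && on_right o E K) peval (mderiv i1 (u K)) x.
Proof.
rewrite /jump add_plane2 opp_plane2; congr (_ - _);
  by apply: (big_morph (fun a : plane R => a.2)).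
Qed.

Lemma measurable_sum_peval T (P : pred (triangle R)) (u : triangle R -> poly2 R) :
  measurable_fun setT (fun x => \sum_(K <- T | P K) peval (u K) x).
Proof.
under eq_fun do rewrite -big_filter.
by apply: measurable_sum => K; exact: measurable_peval.
Qed.

Lemma measurable_jump_dot o T (u : pwpoly R) E (n : plane R) :
  measurable_fun setT (fun x => dot (jump o T (pw_grad u) E x) n ^+ 2).
Proof.
apply: measurable_funX; rewrite /dot.
apply: measurable_funD; apply: measurable_funM; try exact: measurable_cst.
- under eq_fun do rewrite jump_pw_grad1.
  by apply: measurable_funB; exact: measurable_sum_peval.
- under eq_fun do rewrite jump_pw_grad2.
  by apply: measurable_funB; exact: measurable_sum_peval.
Qed.

Lemma jump_sub (V : zmodType) o T (g h : triangle R -> plane R -> V) E x :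
  jump o T (fun K x => g K x - h K x) E x = jump o T g E x - jump o T h E x.
Proof.
have e (P : pred (triangle R)) : \sum_(K <- T | P K) (g K x - h K x) =
    \sum_(K <- T | P K) g K x - \sum_(K <- T | P K) h K x by rewrite -sumrB.
rewrite /jump !e !opprB [LHS]addrACA [RHS]addrACA; congr (_ + _).
exact: addrC.
Qed.

Lemma le_sum_term (I : eqType) (s : seq I) (P : pred I) (F : I -> R) i :
  i \in s -> P i -> (forall j, 0 <= F j) -> F i <= \sum_(j <- s | P j) F j.
Proof.
move=> is_ Pi F0; have := @le_sume_term R I s P (EFin \o F) i is_ Pi.
by rewrite sumEFin lee_fin; apply => j; rewrite lee_fin.
Qed.

(** The squared norm of either one-sided trace is at most the whole sum [S], on boundary edges too,
    where one trace is zero; 4 = 2 + 2 from |a - b|^2 <= 2 |a|^2 + 2 |b|^2. *)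
Lemma jump_sqr_le o T (u : pwpoly R) K0 E x : edge_ordering Om o ->
  triangulation Om T -> K0 \in T -> E \in edges K0 ->
  let J := jump o T (pw_grad u) E x in
  dot J J <= \sum_(K <- T | E \in edges K) 4 * grad_sqr (u K) x.
Proof.
move=> ho tT K0T EK0; have E2 := edge_card2 EK0.
have [EE ab] := ordering_edge ho E2.
set v := (o E).2 - (o E).1; set m := (o E).1 + 2^-1 *: v.
have om : openseg E m by rewrite EE; exact: openseg_mid.
have v0 : v != 0 by rewrite subr_eq0 eq_sym.
rewrite /= (jump_sided _ _ ho tT K0T EK0 om (det2_rot v0)) -mulr_sumr.
set S := \sum_(K <- T | _) _.
have S0 : 0 <= S by apply: sumr_ge0 => K _; exact: grad_sqr_ge0.
have side d : let a := sided_sum T m d (fun K => pw_grad u K x) in dot a a <= S.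
  rewrite /=; have [[K [KT s]]|ns] := pselect (exists K, K \in T /\ sided K m d).
    rewrite (sided_sum1 _ tT KT s).
    apply: (@le_sum_term _ _ _ (fun K => grad_sqr (u K) x)) => //.
      exact: sided_edge tT K0T KT EK0 om s.
    by move=> K'; exact: grad_sqr_ge0.
  rewrite sided_sum0; last by move=> K KT s; apply: ns; exists K.
  by rewrite (_ : dot 0 0 = 0)// /dot !planeE; ring.
set a := sided_sum _ _ _ _; set b := sided_sum _ _ _ _.
have ha : dot a a <= S by exact: side.
have hb : dot b b <= S by exact: side.
have -> : dot (a - b) (a - b) = 2 * dot a a + 2 * dot b b - dot (a + b) (a + b).
  by rewrite /dot !planeE; ring.
by have := dot_ge0 (a + b); lra.
Qed.

(** What the tangent and the normal have in common, so that the edge terms of [mu2] and of [nu2] are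
    reduced by one argument. The sign is left open because a subedge may be ordered the other way
    round. *)
Definition edge_field o (n : edge R -> plane R) : Prop :=
  (forall E, #|` E| = 2%N -> dot (n E) (n E) <= 1) /\
  forall E E', #|` E| = 2%N -> #|` E'| = 2%N -> hull E' `<=` hull E ->
    n E' = n E \/ n E' = - n E.

Lemma tangent_edge_field o : edge_ordering Om o -> edge_field o (tangent o).
Proof.
move=> ho; split=> [E E2|E E' E2 E2' sub].
  have l0 := edge_length_gt0 ho E2; rewrite /tangent; set u := _ - _.
  have -> : dot ((edge_length o E)^-1 *: u) ((edge_length o E)^-1 *: u) =
    (edge_length o E) ^- 2 * dot u u by rewrite /dot !planeE; field; rewrite gt_eqF.
  by rewrite -enorm_sqr mulVf// expf_neq0// gt_eqF.
have l0 := edge_length_gt0 ho E2.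
have [s0 [s1 [_ _ s01 e0 e1]]] := subedge_ordering ho E2 E2' sub.
set u := (o E).2 - (o E).1 in e0 e1.
have uE : (o E').2 - (o E').1 = (s1 - s0) *: u.
  by rewrite e0 e1; apply: plane_eqP; rewrite !planeE; ring.
rewrite /tangent /edge_length uE -/u enormZ.
have l0' : enorm u != 0 by rewrite gt_eqF.
have [s|s|s] := ltgtP s0 s1; last by rewrite s eqxx in s01.
- left; rewrite gtr0_norm ?subr_gt0//; apply: plane_eqP; rewrite !planeE;
  by field; rewrite l0' subr_eq0 gt_eqF.
- right; rewrite ltr0_norm ?subr_lt0//; apply: plane_eqP; rewrite !planeE;
  by field; rewrite l0' subr_eq0 lt_eqF.
Qed.

Lemma normal_edge_field o : edge_ordering Om o -> edge_field o (normal o).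
Proof.
move=> /tangent_edge_field[h1 h2]; split=> [E /h1|E E' E2 E2' sub].
  by rewrite /normal /rot /dot /=; lra.
rewrite /normal; case: (h2 _ _ E2 E2' sub) => ->; [by left|right].
by apply: plane_eqP; rewrite /rot /= ?planeE.
Qed.

Local Open Scope ereal_scope.

Lemma int2_grad_sqr K q : Defs.nondegenerate K -> int2 (tri K) (grad_sqr q) =
  int2 (tri K) (fun x => peval (mderiv i0 q) x ^+ 2)%R +
  int2 (tri K) (fun x => peval (mderiv i1 q) x ^+ 2)%R.
Proof.
move=> nK; have mt := measurable_tri nK.
pose m : {measure set (measurableTypeR R * measurableTypeR R) -> \bar R} := leb2.
have mp i : measurable_fun setT (fun x => (peval (mderiv i q) x ^+ 2)%:E).
  by apply/measurable_EFinP; apply: measurable_funX; exact: measurable_peval.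
transitivity (\int[m]_(x in tri K) ((peval (mderiv i0 q) x ^+ 2)%:E +
    (peval (mderiv i1 q) x ^+ 2)%:E)).
  by apply: eq_integral => x _; rewrite grad_sqrE EFinD.
have p0 i x : tri K x -> 0 <= (peval (mderiv i q) x ^+ 2)%:E.
  by move=> _; rewrite lee_fin sqr_ge0.
exact: (@ge0_integralD _ _ _ m (tri K) mt _ _ (p0 i0) (measurable_funTS (mp i0))
  (p0 i1) (measurable_funTS (mp i1))).
Qed.

Lemma area_gt0 K : Defs.nondegenerate K -> (0 < area K)%R.
Proof.
move=> nK; have [A A0 hA] := @frame_area R.
have [x [y [z f]]] := nondegenerate_frame nK; have [-> _] := hA _ _ _ _ nK f.
by rewrite mulr_gt0// normr_gt0; exact: f.2.
Qed.

Lemma leb2_triE K : Defs.nondegenerate K -> leb2 (tri K) = (area K)%:E.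
Proof.
move=> nK; have [A A0 hA] := @frame_area R.
by have [x [y [z f]]] := nondegenerate_frame nK; have [] := hA _ _ _ _ nK f.
Qed.

Lemma int2_ge0 (D : set (plane R)) (g : plane R -> R) :
  (forall x, (0 <= g x)%R) -> 0 <= int2 D g.
Proof. by move=> g0; apply: integral_ge0 => x _; rewrite lee_fin. Qed.

(** The inverse estimate is applied to the two components of the gradient, so that the right-hand
    side contains no values of [q]. It bounds the Laplacian pointwise, and integrating this constant
    bound over [K] brings in the area. *)
Lemma laplacian_estimate k (C : R) : (0 < C)%R -> exists2 C1 : R, (0 < C1)%R &
  forall K, shape_regular C K -> forall q, deg_le k q ->
  (area K)%:E * int2 (tri K) (fun x => laplacian q x ^+ 2)%R <=
  C1%:E * int2 (tri K) (grad_sqr q).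
Proof.
move=> C0; have [CI CI0 hI] := inverse_estimate k C0.
exists (2 * CI)%R; first by rewrite mulr_gt0.
move=> K sK q qk; have nK := shape_regular_nondegenerate sK.
have a0 := area_gt0 nK; have mt := measurable_tri nK.
pose m : {measure set (measurableTypeR R * measurableTypeR R) -> \bar R} := leb2.
set B := _ * int2 _ (grad_sqr q).
have B0 : 0 <= B.
  rewrite mule_ge0//; first by rewrite lee_fin mulr_ge0// ltW.
  by apply: int2_ge0 => x; exact: grad_sqr_ge0.
have ml : measurable_fun setT (fun x => (laplacian q x ^+ 2)%:E).
  by apply/measurable_EFinP; apply: measurable_funX; exact: measurable_laplacian.
have pt x : tri K x -> (area K ^+ 2)%:E * (laplacian q x ^+ 2)%:E <= B.
  move=> Kx; have [_ h0 _] := hI K sK _ (deg_le_mderiv i0 qk) x Kx.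
  have [_ _ h1] := hI K sK _ (deg_le_mderiv i1 qk) x Kx.
  have h2 : (area K ^+ 2 * peval (mderiv i0 (mderiv i0 q)) x ^+ 2 +
      area K ^+ 2 * peval (mderiv i1 (mderiv i1 q)) x ^+ 2)%:E <=
      CI%:E * int2 (tri K) (grad_sqr q).
    rewrite EFinD (int2_grad_sqr _ nK) ge0_muleDr; last 2 first.
    - by apply: int2_ge0 => ?; exact: sqr_ge0.
    - by apply: int2_ge0 => ?; exact: sqr_ge0.
    exact: (leeD h0 h1).
  rewrite /B (EFinM 2 CI) -muleA; apply: (@le_trans _ _ (2%:E *
    (area K ^+ 2 * peval (mderiv i0 (mderiv i0 q)) x ^+ 2 +
      area K ^+ 2 * peval (mderiv i1 (mderiv i1 q)) x ^+ 2)%:E)); last first.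
    by rewrite lee_wpmul2l// lee_fin.
  rewrite -!EFinM lee_fin /laplacian.
  set u := peval _ x; set v := peval _ x; have := sqr_ge0 (area K * (u - v))%R.
  rewrite -subr_ge0 => h; rewrite -subr_ge0; apply: le_trans h _.
  by rewrite le_eqVlt; apply/orP; left; apply/eqP; ring.
(* Both sides are multiplied by the area because the pointwise bound carries its square. *)
rewrite -(@lee_pmul2l _ (area K)%:E) ?lte_fin//.
rewrite muleA -EFinM -expr2.
have -> : (area K ^+ 2)%:E * int2 (tri K) (fun x => laplacian q x ^+ 2)%R =
    \int[m]_(x in tri K) ((area K ^+ 2)%:E * (laplacian q x ^+ 2)%:E).
  rewrite ge0_integralZl_EFin//; [|exact: (measurable_funTS ml)|exact: sqr_ge0].
    by move=> x _; rewrite lee_fin sqr_ge0.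
rewrite (muleC (area K)%:E) -(leb2_triE nK).
have -> : B * leb2 (tri K) = \int[m]_(x in tri K) cst B x by rewrite integral_cst.
apply: ge0_le_integral => //.
- by move=> x _; rewrite -EFinM lee_fin mulr_ge0// sqr_ge0.
- by apply: measurable_funeM; exact: (measurable_funTS ml).
Qed.

(** The weight belongs to [K1] and the integral to [K2]; the two areas are compared through the
    length of the common edge. On the edge the gradient is bounded pointwise by the inverse estimate
    on [K2]. *)
Lemma trace_estimate k (C : R) : (0 < C)%R -> exists2 C2 : R, (0 < C2)%R &
  forall o, edge_ordering Om o ->
  forall K1 K2 E, shape_regular C K1 -> shape_regular C K2 ->
  E \in edges K1 -> E \in edges K2 -> forall q, deg_le k q ->
  (Num.sqrt (area K1))%:E * int_edge o E (grad_sqr q) <=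
  C2%:E * int2 (tri K2) (grad_sqr q).
Proof.
move=> C0; have [CI CI0 hI] := inverse_estimate k C0.
have [A A0 hA] := @frame_area R.
(* The first factor bounds the square root of the area of [K1] by the edge length, the second bounds
   the squared edge length by the area of [K2]. *)
pose c := (Num.sqrt (2 * C * A) * (2 * C / A))%R.
have c0 : (0 < c)%R by rewrite mulr_gt0 ?sqrtr_gt0 ?divr_gt0 ?mulr_gt0.
exists (c * CI)%R; first by rewrite mulr_gt0.
move=> o ho K1 K2 E sK1 sK2 EK1 EK2 q qk.
have nK1 := shape_regular_nondegenerate sK1.
have nK2 := shape_regular_nondegenerate sK2.
have [EE ab] := ordering_edge ho (edge_card2 EK1).
have l0 := edge_length_ge0 o E.
have lE : (edge_length o E ^+ 2 = dot ((o E).2 - (o E).1) ((o E).2 - (o E).1))%R.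
  exact: enorm_sqr.
have [z1 f1] : exists z, frame K1 (o E).1 (o E).2 z.
  by apply: edge_frame nK1 _; rewrite -EE.
have [z2 f2] : exists z, frame K2 (o E).1 (o E).2 z.
  by apply: edge_frame nK2 _; rewrite -EE.
have [a1E _] := hA _ _ _ _ nK1 f1; have [a2E _] := hA _ _ _ _ nK2 f2.
have a20 := area_gt0 nK2.
have h2 : (edge_length o E ^+ 2 <= 2 * C / A * area K2)%R.
  rewrite lE a2E mulrA divfK ?gt_eqF//; exact: shape_regular_edge sK2 f2.
have h1 : (area K1 <= 2 * C * A * edge_length o E ^+ 2)%R.
  rewrite a1E lE (mulrC (2 * C)%R) -mulrA; apply: (ler_wpM2l (ltW A0)).
  set D := `|_|%R; have D0 : (0 < D)%R by rewrite normr_gt0; exact: f1.2.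
  have := shape_regular_edge sK1 (frame_rot (frame_rot f1)).
  rewrite (frame_det (frame_rot (frame_rot f1)) f1) -/D => h3.
  (* The determinant is at most the product of two edge lengths, by Lagrange's identity. Shape
     regularity bounds the second squared length by a multiple of [D], and one factor [D]
     cancels. *)
  have : (D ^+ 2 <= dot ((o E).2 - (o E).1) ((o E).2 - (o E).1) *
      dot ((o E).1 - z1) ((o E).1 - z1))%R.
    rewrite /D real_normK ?num_real// -subr_ge0.
    have := sqr_ge0 (dot ((o E).2 - (o E).1) ((o E).1 - z1))%R.
    move=> h; apply: le_trans h _; rewrite le_eqVlt; apply/orP; left; apply/eqP.
    by rewrite /dot /det2 !planeE; ring.
  have d0 := dot_ge0 ((o E).2 - (o E).1)%R.
  move=> h4; have h5 := le_trans h4 (ler_wpM2l d0 h3).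
  by rewrite -(ler_pM2r D0) -expr2 (le_trans h5)// mulrA (mulrC (dot _ _)).
have s1 : (Num.sqrt (area K1) * edge_length o E <= c * area K2)%R.
  apply: (@le_trans _ _ (Num.sqrt (2 * C * A) * edge_length o E ^+ 2)%R).
    rewrite expr2 mulrA ler_wpM2r// -[X in (_ * X)%R](ger0_norm l0) -sqrtr_sqr -sqrtrM.
      by rewrite ler_sqrt// mulr_ge0 ?sqr_ge0// !mulr_ge0// ltW.
    by rewrite !mulr_ge0// ltW.
  by rewrite /c -(mulrA (Num.sqrt _)) ler_wpM2l// sqrtr_ge0.
rewrite /int_edge; set X := \int[_]_(_ in _) _; set I := int2 _ _.
have mgs : measurable_fun (`[0%R, 1%R]%classic : set R)
    (fun t => (grad_sqr q (edge_point o E t))%:E).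
  apply: measurable_funTS; apply/measurable_EFinP.
  by apply: measurable_on_edge; exact: measurable_grad_sqr.
have I0 : 0 <= I by apply: int2_ge0 => x; exact: grad_sqr_ge0.
have X0 : 0 <= X by apply: integral_ge0 => t _; rewrite lee_fin grad_sqr_ge0.
have aX : (area K2)%:E * X <= CI%:E * I.
  rewrite /X -ge0_integralZl_EFin//; last 2 first.
  - by move=> t _; rewrite lee_fin grad_sqr_ge0.
  - exact: ltW.
  have -> : CI%:E * I = \int[leb]_(t in `[0%R, 1%R]) cst (CI%:E * I) t.
    have e01 : leb `[0%R, 1%R]%classic = 1.
      by rewrite lebesgue_measure_itv/= lte_fin ltr01 oppr0 adde0.
    transitivity (CI%:E * I * leb `[0%R, 1%R]%classic); first by rewrite e01 mule1.
    by rewrite integral_cst.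
  apply: ge0_le_integral => //.
  - by move=> t _; rewrite -EFinM lee_fin mulr_ge0 ?grad_sqr_ge0// ltW.
  - exact: measurable_funeM.
  move=> t; rewrite /= in_itv/= => t01.
  have Kt : tri K2 (edge_point o E t).
    apply: hull_edge_tri EK2 nK2 _; rewrite EE; apply/(hull2P _ ab).
    by rewrite -EE; exists t.
  have [g0 _ _] := hI K2 sK2 _ (deg_le_mderiv i0 qk) _ Kt.
  have [g1 _ _] := hI K2 sK2 _ (deg_le_mderiv i1 qk) _ Kt.
  rewrite -EFinM grad_sqrE mulrDr EFinD /I (int2_grad_sqr _ nK2) ge0_muleDr.
  - exact: (leeD g0 g1).
  - by apply: int2_ge0 => ?; exact: sqr_ge0.
  - by apply: int2_ge0 => ?; exact: sqr_ge0.
rewrite muleA -EFinM; apply: (@le_trans _ _ ((c * area K2)%:E * X)).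
  by rewrite lee_wpmul2r// lee_fin.
by rewrite !(EFinM c) -!muleA lee_wpmul2l// lee_fin ltW.
Qed.

End Traces.

(** * Reduction of the estimator on refined triangles *)

Section AuxiliarySums.
Context {R : realType}.
Local Open Scope ereal_scope.

Lemma sume_subset_le (I : eqType) (s t : seq I) (F : I -> \bar R) : uniq s ->
  {subset s <= t} -> (forall i, 0 <= F i) ->
  \sum_(i <- s) F i <= \sum_(i <- t) F i.
Proof.
move=> us st F0.
apply: (@sume_transfer _ _ _ _ _ (fun i j => i == j) _ (fun=> F)).
- by move=> _ i; exact: F0.
- by move=> i is_; right; exists i; split; [exact: st|exact: eqxx|exact: lexx].
- move=> j _; rewrite (eq_bigr (fun=> F j)); last by move=> i /eqP ->.
  by apply: sume_le1 => // i1 i2 _ _ /eqP -> /eqP ->.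
Qed.

Lemma area_ge0 (K : triangle R) : (0 <= area K)%R.
Proof. by rewrite /area fine_ge0. Qed.

Lemma young_volume (a a' : R) : (0 <= a')%R -> (a' <= a / 2)%R ->
  (5 / 4 * a' <= 9 / 10 * a)%R.
Proof. by move=> ? ?; lra. Qed.

End AuxiliarySums.

Section Reduction.
Context {R : realType}.
Implicit Types (K : triangle R) (E : edge R) (x y z w : plane R).
Context (Om : set (plane R)) (o : ordering R) (ho : edge_ordering Om o).
Context (T T' : {fset triangle R}) (tT : triangulation Om T)
  (tT' : triangulation Om T') (bis : bisections T T').
Context (par : triangle R -> triangle R)
  (hpar : forall K', K' \in T' -> par K' \in T /\ descendant (par K') K').
Context (k : nat) (C : R) (C0 : 0 < C) (shT : forall K, K \in T -> shape_regular C K).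
Context (v v' : pwpoly R) (kv : pw_deg_le k T v) (kv' : pw_deg_le k T' v').

Local Notation S := (T `\` T')%fset.
Local Notation S' := (T' `\` T)%fset.

Lemma interior_tri_nonempty K : Defs.nondegenerate K ->
  exists x, interior (tri K) x.
Proof.
move=> /nondegenerate_frame[x [y [z f]]]; exists (3^-1 *: (x + y + z)).
have b3 a b c : frame K a b c -> 3^-1 *: (x + y + z) = 3^-1 *: (a + b + c) ->
    bary a b c (3^-1 *: (x + y + z)) = 3^-1.
  by move=> [_ D] ->; move: D; rewrite /bary /det2 !planeE => D; field.
have f2 := frame_rot f; have f3 := frame_rot f2.
apply/(interior_triP _ f); rewrite (b3 _ _ _ f erefl) (b3 _ _ _ f2) ?(b3 _ _ _ f3).
- by split; rewrite invr_gt0.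
- by congr (_ *: _); apply: plane_eqP; rewrite !planeE; ring.
- by congr (_ *: _); apply: plane_eqP; rewrite !planeE; ring.
Qed.

Let nT := triangulation_nondegenerate tT.
Let nT' := triangulation_nondegenerate tT'.

Lemma shape_regular_refined K' : K' \in T' -> shape_regular C K'.
Proof. by move=> /hpar[/shT sp dp]; exact: shape_regular_descendant sp dp. Qed.

(** A parent that survived in [T'] would overlap the interior of [K'], hence equal [K'], which is
    not in [T]. *)
Lemma refined_parent K' : K' \in S' ->
  [/\ K' \in T', par K' \in S & area K' <= area (par K') / 2].
Proof.
rewrite in_fsetD => /andP[K'T K'T']; have [pT dp] := hpar K'T'.
have nK' := nT' K'T'; have npK := nT pT.
split=> //.
  rewrite in_fsetD pT andbT; apply/negP => pT'.
  have [x xK'] := interior_tri_nonempty nK'.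
  have px := descendant_tri npK dp (interior_subset xK').
  by move: K'T; rewrite (triangulation_interior tT' K'T' pT' xK' px) pT.
have [A A0 hA] := @frame_area R.
have [x [y [z f]]] := nondegenerate_frame npK.
have [x' [y' [z' f']]] := nondegenerate_frame nK'.
have [-> _] := hA _ _ _ _ npK f; have [-> _] := hA _ _ _ _ nK' f'.
have [K'p|le] := descendant_det npK dp f f'; first by move: K'T; rewrite K'p pT.
by rewrite -mulrA ler_wpM2l// ltW.
Qed.

(** The difference of the two functions on [K']. As a single polynomial of degree at most [k] it is
    open to the inverse and trace estimates. *)
Definition defect K' : poly2 R := v (par K') - v' K'.

Lemma deg_le_defect K' : K' \in T' -> deg_le k (defect K').
Proof. by move=> K'T'; apply: deg_leB; [apply: kv; exact: (hpar K'T').1|exact: kv']. Qed.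

Lemma broken_gradE U (u : pwpoly R) K x : triangulation Om U -> K \in U ->
  interior (tri K) x -> broken_grad U u x = grad (u K) x.
Proof.
move=> tU KU xi; rewrite /broken_grad big_mkcond (bigD1_seq K)//=; last exact: fset_uniq.
rewrite asboolT// big_seq_cond big1 ?addr0// => K1 /andP[K1U K1K].
case: asboolP => // /interior_subset x1.
by rewrite (triangulation_interior tU KU K1U xi x1) eqxx in K1K.
Qed.

Local Open Scope ereal_scope.

Definition defect_norm2 K' : \bar R := int2 (tri K') (grad_sqr (defect K')).

Lemma defect_norm2_ge0 K' : 0 <= defect_norm2 K'.
Proof. by apply: int2_ge0 => x; exact: grad_sqr_ge0. Qed.

(** In the interior of a fine triangle both broken gradients come from single polynomials, and their
    difference is the gradient of the defect; these interiors are disjoint subsets of [Om]. *)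
Lemma sum_defect_le : open Om -> lipschitz_boundary Om ->
  \sum_(K' <- T') defect_norm2 K' <= grad_dist2 Om T v T' v'.
Proof.
move=> oOm lip.
have mg K' : measurable_fun setT (fun x => (grad_sqr (defect K') x)%:E).
  by apply/measurable_EFinP; exact: measurable_grad_sqr.
rewrite (eq_big_seq (fun K' =>
    \int[leb2]_(x in interior (tri K')) (grad_sqr (defect K') x)%:E)); last first.
  move=> K' K'T'; apply: (ge0_integral_interior (nT' K'T') (mg K')) => x.
  by rewrite lee_fin grad_sqr_ge0.
pose m : {measure set (measurableTypeR R * measurableTypeR R) -> \bar R} := leb2.
apply: (@sum_integral_disjoint _ _ _ m _ T' (fun K' => interior (tri K'))) => //.
- by move=> K' K'T'; apply: measurable_interior_tri; exact: nT'.
- by move=> K' _; exact: mg.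
- by move=> K' x; rewrite lee_fin grad_sqr_ge0.
- move=> K1 K2 x K1T K2T x1 /interior_subset x2.
  exact: triangulation_interior tT' K1T K2T x1 x2.
- move=> K' x K'T' xi; have [pT dp] := hpar K'T'.
  split; first exact: (triangulation_interior_sub oOm lip tT' K'T' xi).
  have xp : interior (tri (par K')) x.
    exact: (interiorS (descendant_tri (nT pT) dp) xi).
  rewrite (broken_gradE v tT pT xp) (broken_gradE v' tT' K'T' xi).
  by rewrite enorm_sqr -grad_sub.
- by move=> x; rewrite lee_fin sqr_ge0.
Qed.

Lemma volume_reduction (f : plane R -> R) (C1 : R) : measurable_fun setT f ->
  (0 < C1)%R ->
  (forall K, shape_regular C K -> forall q, deg_le k q ->
    (area K)%:E * int2 (tri K) (fun x => laplacian q x ^+ 2)%R <=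
    C1%:E * int2 (tri K) (grad_sqr q)) ->
  \sum_(K' <- S') (area K')%:E * int2 (tri K') (fun x => (f x + laplacian (v' K') x) ^+ 2)%R <=
  (9 / 10)%:E * (\sum_(K <- S) (area K)%:E *
      int2 (tri K) (fun x => (f x + laplacian (v K) x) ^+ 2)%R) +
  (5 * C1)%:E * \sum_(K' <- T') defect_norm2 K'.
Proof.
move=> mf C10 hC1.
pose r (q : poly2 R) x := ((f x + laplacian q x) ^+ 2)%R.
have mr q : measurable_fun setT (r q).
  by apply: measurable_funX; apply: measurable_funD => //; exact: measurable_laplacian.
have r0 q x : (0 <= r q x)%R by exact: sqr_ge0.
have i0 K q : 0 <= int2 (tri K) (r q) by exact: int2_ge0.
pose X K' := (5 / 4 * area K')%:E * int2 (tri K') (r (v (par K'))).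
have step K' : K' \in S' -> (area K')%:E * int2 (tri K') (r (v' K')) <=
    X K' + (5 * C1)%:E * defect_norm2 K'.
  move=> /refined_parent[K'T' _ _]; have nK' := nT' K'T'.
  have a0 := ltW (area_gt0 nK').
  have yg : int2 (tri K') (r (v' K')) <= (5 / 4)%:E * int2 (tri K') (r (v (par K'))) +
      5%:E * int2 (tri K') (fun x => laplacian (defect K') x ^+ 2)%R.
    pose m : {measure set (measurableTypeR R * measurableTypeR R) -> \bar R} := leb2.
    have ml : measurable_fun setT (fun x => laplacian (defect K') x ^+ 2)%R.
      by apply: measurable_funX; exact: measurable_laplacian.
    have l0 x : (0 <= laplacian (defect K') x ^+ 2)%R by exact: sqr_ge0.
    have mt := measurable_tri nK'.
    apply: (@integral_young _ _ _ m _ _ _ _ _ _ mt _ _ (mr _) (mr _) ml (r0 _) (r0 _) l0) => //.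
    move=> x _; rewrite /r /defect laplacian_sub.
    set a := (f x + laplacian (v (par K')) x)%R; set b := laplacian (v (par K')) x.
    set c := laplacian (v' K') x.
    have -> : (f x + c = a - (b - c))%R by rewrite /a -/b; ring.
    (* With d = b - c this square is exactly 5/4 a^2 + 5 d^2 - (a - d)^2. *)
    have := sqr_ge0 (a / 2 + 2 * (b - c))%R.
    rewrite -subr_ge0 => h; rewrite -subr_ge0; apply: le_trans h _.
    by rewrite le_eqVlt; apply/orP; left; apply/eqP; field.
  apply: le_trans (lee_wpmul2l _ yg) _; first by rewrite lee_fin.
  rewrite ge0_muleDr; last 2 first.
  - by rewrite mule_ge0 ?lee_fin ?divr_ge0.
  - by rewrite mule_ge0 ?lee_fin//; apply: int2_ge0 => x; exact: sqr_ge0.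
  apply: leeD.
    by rewrite muleA -EFinM /X (mulrC (area K')).
  rewrite muleCA (EFinM 5) -muleA lee_wpmul2l ?lee_fin//.
  by apply: hC1; [exact: shape_regular_refined|exact: deg_le_defect].
apply: (@le_trans _ _ (\sum_(K' <- S') (X K' + (5 * C1)%:E * defect_norm2 K'))).
  by rewrite big_seq [leRHS]big_seq; apply: lee_sum.
rewrite big_split /=; apply: leeD; last first.
  rewrite -ge0_sume_distrr; last by move=> K' _; exact: defect_norm2_ge0.
  apply: lee_wpmul2l; first by rewrite lee_fin mulr_ge0// ltW.
  apply: sume_subset_le; first exact: fset_uniq.
    by move=> K' /refined_parent[].
  exact: defect_norm2_ge0.
have c0 K : (0 <= 9 / 10 * area K)%R by rewrite mulr_ge0 ?area_ge0// divr_ge0.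
rewrite ge0_sume_distrr; last first.
  by move=> K _; rewrite mule_ge0 ?i0// lee_fin area_ge0.
(* The share of [K'] in the term of its parent [K]. The shares add up to at most that term because
   the fine triangles do not overlap. *)
pose B K K' := (9 / 10 * area K)%:E * int2 (tri K') (r (v K)).
apply: (@sume_transfer _ _ _ _ _ (fun K' K => par K' == K) _ B).
- by move=> K K'; rewrite /B mule_ge0 ?i0// lee_fin.
- move=> K' /refined_parent[K'T' pS ap]; right; exists (par K').
  split; [exact: pS|exact: eqxx|].
  apply: lee_wpmul2r; first exact: i0.
  by rewrite lee_fin; apply: young_volume => //; exact: area_ge0.
- move=> K KS; rewrite /B -ge0_sume_distrr; last by move=> K' _; exact: i0.
  rewrite -big_filter muleA -EFinM; apply: lee_wpmul2l; first by rewrite lee_fin.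
  have KT : K \in T by move: KS; rewrite in_fsetD => /andP[].
  apply: (sum_subtriangles tT' (nT KT)) => //.
    by rewrite filter_uniq// fset_uniq.
  move=> K'; rewrite mem_filter => /andP[/eqP <- /refined_parent[K'T' _ _]].
  by split=> //; exact: (hpar K'T').2.
Qed.

Lemma on_left_or_right K E : K \in T' -> E \in edges K ->
  on_left o E K || on_right o E K.
Proof.
move=> KT' EK; have E2 := edge_card2 EK; have [EE ab] := ordering_edge ho E2.
have [z f] : exists z, frame K (o E).1 (o E).2 z.
  by apply: (edge_frame (nT' KT')); rewrite -EE.
rewrite (on_leftE ho E2 f) (on_rightE ho E2 f).
by have [_ D] := f; rewrite -neq_lt.
Qed.

Lemma on_side_uniq K1 K2 E : K1 \in T' -> K2 \in T' ->
  E \in edges K1 -> E \in edges K2 ->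
  (on_left o E K1 && on_left o E K2) || (on_right o E K1 && on_right o E K2) ->
  K1 = K2.
Proof.
move=> K1T K2T EK1 EK2; have E2 := edge_card2 EK1.
have [EE ab] := ordering_edge ho E2.
have [z1 f1] : exists z, frame K1 (o E).1 (o E).2 z.
  by apply: (edge_frame (nT' K1T)); rewrite -EE.
have [z2 f2] : exists z, frame K2 (o E).1 (o E).2 z.
  by apply: (edge_frame (nT' K2T)); rewrite -EE.
have om := openseg_mid ab.
rewrite !(on_leftE ho E2 f1, on_leftE ho E2 f2, on_rightE ho E2 f1, on_rightE ho E2 f2).
set m := (_ + _)%R in om; set u := ((o E).2 - (o E).1)%R in f1 f2 m om *.
have u0 : u != 0%R by rewrite subr_eq0 eq_sym.
have uu := det2_rot u0.
have uN : det2 u (- rot u)%R = (- det2 u (rot u))%R by rewrite /det2 !planeE; ring.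
case/orP=> /andP[h1 h2].
- apply: (@sided_uniq _ _ _ _ _ m (- rot u)%R tT' K1T K2T).
    by apply/(sidedP _ f1 om); rewrite uN mulNr -mulrN -invrN divr_gt0// oppr_gt0.
  by apply/(sidedP _ f2 om); rewrite uN mulNr -mulrN -invrN divr_gt0// oppr_gt0.
- apply: (@sided_uniq _ _ _ _ _ m (rot u) tT' K1T K2T).
    by apply/(sidedP _ f1 om); rewrite divr_gt0.
  by apply/(sidedP _ f2 om); rewrite divr_gt0.
Qed.

(** A crude count of all 2^3 sets of vertices; it enters only the constant in front of the gradient
    distance. *)
Lemma card_edges_le K : Defs.nondegenerate K -> (size (edges K) <= 8)%N.
Proof.
move=> nK; have [x [y [z f]]] := nondegenerate_frame nK.
have sub : (edges K `<=` fpowerset (vertices K))%fset.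
  by apply/fsubsetP => E; rewrite fpowersetE edgesE => /andP[].
apply: leq_trans (fsubset_leq_card sub) _; rewrite card_fpowerset.
rewrite (@leq_pexp2l 2 _ 3)// f.1.
by rewrite -fsetUA cardfsU1 cardfs2; case: (x \notin [fset y; z]%fset); case: (y != z).
Qed.

(** * Edge terms, for normal and tangential jumps at once *)

Section EdgeFamily.
Variables (n : edge R -> plane R) (FE : triangle R -> {fset edge R}) (C2 : R).
Hypothesis nE : edge_field o n.
Hypothesis FE_sub : forall K E, E \in FE K -> E \in edges K.
(** It lets a fine edge be charged to the coarse edge containing it. For interior edges it holds
    because a subedge of a boundary edge is a boundary edge. *)
Hypothesis FE_super : forall K K' E E',
  E' \in FE K' -> E \in edges K -> hull E' `<=` hull E -> E \in FE K.
Hypothesis C20 : (0 < C2)%R.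
Hypothesis trace : forall K1 K2 E, shape_regular C K1 -> shape_regular C K2 ->
  E \in edges K1 -> E \in edges K2 -> forall q, deg_le k q ->
  (Num.sqrt (area K1))%:E * int_edge o E (grad_sqr q) <=
  C2%:E * int2 (tri K2) (grad_sqr q).

Definition edge_pairs (U : {fset triangle R}) : seq (triangle R * edge R) :=
  [seq (K, E) | K <- U, E <- FE K].

Lemma edge_pairsP (U : {fset triangle R}) e :
  reflect (e.1 \in U /\ e.2 \in FE e.1) (e \in edge_pairs U).
Proof.
apply: (iffP idP) => [/allpairsPdep[K [E [KU EK ->]]]//|[KU EK]].
by apply/allpairsPdep; exists e.1, e.2; split=> //; case: (e).
Qed.

Lemma edge_pairs_uniq U : uniq (edge_pairs U).
Proof.
apply: allpairs_uniq_dep; first exact: fset_uniq.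
  by move=> K _; exact: fset_uniq.
by move=> [a b] [c d] _ _ /= [-> ->].
Qed.

Lemma sum_edge_pairs (U : {fset triangle R}) (F : triangle R -> edge R -> \bar R)
    (a : triangle R -> R) : (forall K E, 0 <= F K E) ->
  \sum_(K <- U) (a K)%:E * \sum_(E <- FE K) F K E =
  \sum_(e <- edge_pairs U) (a e.1)%:E * F e.1 e.2.
Proof.
move=> F0; rewrite big_allpairs_dep /=; apply: eq_bigr => K _.
by rewrite ge0_sume_distrr.
Qed.

Let jsq (U : {fset triangle R}) (u : pwpoly R) E x :=
  (dot (jump o U (pw_grad u) E x) (n E) ^+ 2)%R.

(** Jumps are linear, so the jump of [v' K] is that of the parent's polynomial minus that of the
    defect. The constant 20 is the 5 of Young's inequality times the 4 of [jump_sqr_le]. *)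
Lemma jump_young K' E x : K' \in T' -> E \in edges K' ->
  (jsq T' v' E x <= 5 / 4 * jsq T' (v \o par) E x +
   20 * \sum_(K <- T' | E \in edges K) grad_sqr (defect K) x)%R.
Proof.
move=> K'T' EK'; have n1 := nE.1 E (edge_card2 EK').
have := jump_sqr_le defect x ho tT' K'T' EK'; rewrite /= -mulr_sumr.
have -> : jump o T' (pw_grad defect) E x =
    (jump o T' (pw_grad (v \o par)) E x - jump o T' (pw_grad v') E x)%R.
  rewrite -jump_sub; congr (jump _ _ _ _ _); apply/funext => K; apply/funext => y.
  exact: grad_sub.
rewrite /jsq; set a := jump _ _ _ _ _; set b := jump _ _ _ _ _; set s := (\sum_(_ <- _ | _) _)%R.
move=> h; have := le_trans (dot_sqr_le (a - b)%R n1) h.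
have -> : (dot (a - b) (n E) = dot a (n E) - dot b (n E))%R by rewrite /dot !planeE; ring.
set p := dot a _; set q := dot b _ => h2.
have h3 := sqr_ge0 (p / 2 + 2 * (p - q))%R.
have : (q ^+ 2 <= 5 / 4 * p ^+ 2 + 5 * (p - q) ^+ 2)%R.
  rewrite -subr_ge0; apply: le_trans h3 _.
  by rewrite le_eqVlt; apply/orP; left; apply/eqP; field.
by move=> h4; lra.
Qed.

Lemma edge_term K' E : K' \in S' -> E \in FE K' ->
  (Num.sqrt (area K'))%:E * int_edge o E (jsq T' v' E) <=
  (5 / 4 * Num.sqrt (area K'))%:E * int_edge o E (jsq T' (v \o par) E) +
  \sum_(K <- T' | E \in edges K) (20 * C2)%:E * defect_norm2 K.
Proof.
move=> K'S' EF; have [K'T' _ _] := refined_parent K'S'; have EK' := FE_sub EF.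
have s0 : (0 <= Num.sqrt (area K'))%R by exact: sqrtr_ge0.
have mJ U u : measurable_fun setT (jsq U u E) by exact: measurable_jump_dot.
have J0 U u x : (0 <= jsq U u E x)%R by exact: sqr_ge0.
pose r := [seq K <- T' | E \in edges K].
have mS : measurable_fun setT (fun x => \sum_(K <- r) grad_sqr (defect K) x)%R.
  by apply: measurable_sum => K; exact: measurable_grad_sqr.
have S0 x : (0 <= \sum_(K <- r) grad_sqr (defect K) x)%R.
  by apply: sumr_ge0 => K _; exact: grad_sqr_ge0.
have yg : int_edge o E (jsq T' v' E) <=
    (5 / 4)%:E * int_edge o E (jsq T' (v \o par) E) +
    20%:E * int_edge o E (fun x => \sum_(K <- r) grad_sqr (defect K) x)%R.
  apply: int_edge_young => // x; rewrite big_filter; exact: jump_young K'T' EK'.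
apply: le_trans (lee_wpmul2l _ yg) _; first by rewrite lee_fin.
rewrite ge0_muleDr; last 2 first.
- by rewrite mule_ge0 ?int_edge_ge0// lee_fin divr_ge0.
- by rewrite mule_ge0 ?int_edge_ge0// lee_fin.
apply: leeD; first by rewrite muleA -EFinM (mulrC (Num.sqrt _)).
rewrite int_edge_sum; [|by move=> K; exact: measurable_grad_sqr|by move=> K x; exact: grad_sqr_ge0].
have i0 K : 0 <= int_edge o E (grad_sqr (defect K)).
  by apply: int_edge_ge0 => x; exact: grad_sqr_ge0.
rewrite muleCA ge0_sume_distrr// ge0_sume_distrr; last first.
  by move=> K _; rewrite mule_ge0// lee_fin.
rewrite -[leRHS]big_filter -/r big_seq [leRHS]big_seq; apply: lee_sum => K.
rewrite mem_filter => /andP[EK KT'].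
rewrite (EFinM 20) -muleA; apply: lee_wpmul2l; first by rewrite lee_fin.
apply: trace => //; [exact: shape_regular_refined|exact: shape_regular_refined|].
exact: deg_le_defect.
Qed.

(** A triangle is reached through at most 8 edges, and each of them has at most one fine triangle on
    its left and one on its right: 16 = 8 * 2. *)
Lemma edge_count (c : triangle R -> \bar R) : (forall K, 0 <= c K) ->
  \sum_(e <- edge_pairs S') \sum_(K <- T' | e.2 \in edges K) c K <=
  16%:E * \sum_(K <- T') c K.
Proof.
move=> c0; rewrite (exchange_big_dep xpredT)//= ge0_sume_distrr//.
rewrite big_seq [leRHS]big_seq; apply: lee_sum => K KT'.
have eS e : e \in edge_pairs S' -> e.1 \in T' /\ e.2 \in edges e.1.
  by move=> /edge_pairsP[/refined_parent[? _ _] /FE_sub].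
rewrite -big_filter; set r := [seq e <- _ | _].
have ur : uniq r by rewrite filter_uniq// edge_pairs_uniq.
apply: (@le_trans _ _ (\sum_(E <- edges K) 2%:E * c K)); last first.
  apply: le_trans (sume_const_le _ (card_edges_le (nT' KT'))) _.
    by rewrite mule_ge0// lee_fin.
  by rewrite muleA -EFinM -natrM.
apply: (@sume_transfer _ _ _ _ _ (fun e E => e.2 == E) _ (fun _ _ => c K)).
- by move=> _ _; exact: c0.
- move=> e; rewrite mem_filter => /andP[eK _]; right; exists e.2.
  by split; [exact: eK|exact: eqxx|exact: lexx].
- move=> E EK; rewrite (bigID (fun e => on_left o E e.1))/=.
  rewrite (EFinD 1 1) ge0_muleDl ?lee_fin// mul1e; apply: leeD.
    apply: sume_le1 => // -[K1 E1] [K2 E3].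
    rewrite !mem_filter => /andP[_ /eS[/= K1T E1K]] /andP[_ /eS[/= K2T E3K]].
    move=> /andP[/eqP eq1 l1] /andP[/eqP eq2 l2]; subst E1 E3.
    by rewrite (on_side_uniq K1T K2T E1K E3K)// l1 l2.
  apply: sume_le1 => // -[K1 E1] [K2 E3].
  rewrite !mem_filter => /andP[_ /eS[/= K1T E1K]] /andP[_ /eS[/= K2T E3K]].
  move=> /andP[/eqP eq1 l1] /andP[/eqP eq2 l2]; subst E1 E3.
  have := on_left_or_right K1T E1K; rewrite (negbTE l1) /= => r1.
  have := on_left_or_right K2T E3K; rewrite (negbTE l2) /= => r2.
  by rewrite (on_side_uniq K1T K2T E1K E3K)// r1 r2 orbT.
Qed.

Lemma young_edge (a a' : R) : (0 <= a')%R -> (a' <= a / 2)%R ->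
  (5 / 4 * Num.sqrt a' <= 9 / 10 * Num.sqrt a)%R.
Proof.
move=> a0 aa; have a1 : (0 <= a)%R by lra.
have p0 : (0 <= 5 / 4 * Num.sqrt a')%R by rewrite mulr_ge0 ?sqrtr_ge0 ?divr_ge0.
have p1 : (0 <= 9 / 10 * Num.sqrt a)%R by rewrite mulr_ge0 ?sqrtr_ge0 ?divr_ge0.
(* After squaring, what remains is 25/32 <= 81/100. *)
by rewrite -ler_sqr ?nnegrE// !exprMn !sqr_sqrtr//; lra.
Qed.

(** A fine pair of triangle and edge is charged to the parent together with its edge containing the
    fine one. Keeping the triangle in the pair preserves the two occurrences of an interior edge,
    one from each side; from one side the subedges do not overlap. The constant is 320 = 20 * 16. *)
Lemma edge_reduction :
  \sum_(K' <- S') (Num.sqrt (area K'))%:E *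
    \sum_(E <- FE K') int_edge o E (jsq T' v' E) <=
  (9 / 10)%:E * (\sum_(K <- S) (Num.sqrt (area K))%:E *
    \sum_(E <- FE K) int_edge o E (jsq T v E)) +
  (320 * C2)%:E * \sum_(K' <- T') defect_norm2 K'.
Proof.
have i0 U u E : 0 <= int_edge o E (jsq U u E).
  by apply: int_edge_ge0 => x; exact: sqr_ge0.
rewrite (@sum_edge_pairs _ (fun _ E => int_edge o E (jsq T' v' E)) (fun K => Num.sqrt (area K)))//.
rewrite (@sum_edge_pairs _ (fun _ E => int_edge o E (jsq T v E)) (fun K => Num.sqrt (area K)))//.
pose X (e : triangle R * edge R) := (5 / 4 * Num.sqrt (area e.1))%:E *
  int_edge o e.2 (jsq T' (v \o par) e.2).
pose Y (e : triangle R * edge R) :=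
  \sum_(K <- T' | e.2 \in edges K) (20 * C2)%:E * defect_norm2 K.
apply: (@le_trans _ _ (\sum_(e <- edge_pairs S') (X e + Y e))).
  rewrite big_seq [leRHS]big_seq; apply: lee_sum => e /edge_pairsP[eS eF].
  exact: edge_term.
have d0 K : 0 <= (20 * C2)%:E * defect_norm2 K.
  by rewrite mule_ge0 ?defect_norm2_ge0// lee_fin mulr_ge0// ltW.
rewrite big_split /=; apply: leeD; last first.
  apply: le_trans (edge_count d0) _.
  rewrite -ge0_sume_distrr; last by move=> K _; exact: defect_norm2_ge0.
  rewrite muleA -EFinM; apply: lee_wpmul2r.
    by apply: sume_ge0 => K _; exact: defect_norm2_ge0.
  by rewrite lee_fin mulrA -natrM.
rewrite ge0_sume_distrr; last first.
  by move=> e _; rewrite mule_ge0// lee_fin sqrtr_ge0.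
pose B (e0 e : triangle R * edge R) := (9 / 10 * Num.sqrt (area e0.1))%:E *
  int_edge o e.2 (jsq T v e0.2).
have c0 K : (0 <= 9 / 10 * Num.sqrt (area K))%R.
  by rewrite mulr_ge0 ?sqrtr_ge0// divr_ge0.
have B0 e0 e : 0 <= B e0 e.
  rewrite /B mule_ge0 ?lee_fin//; apply: int_edge_ge0 => x; exact: sqr_ge0.
apply: (@sume_transfer _ _ _ _ _ (fun e e0 => (par e.1 == e0.1) && `[< hull e.2 `<=` hull e0.2 >]) _ B) => //.
- move=> e /edge_pairsP[eS eF]; have [eT pS ap] := refined_parent eS.
  have [z|[E [EK sub EJ]]] := jump_refine (pw_grad v) ho tT tT' bis hpar eT (FE_sub eF).
    left; rewrite /X /int_edge integral0_eq ?mule0// => t _.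
    rewrite /jsq (z (edge_point o e.2 t)).
    by rewrite (_ : dot 0%R _ = 0%R) ?expr0n// /dot !planeE; ring.
  right; exists (par e.1, E); split.
  + by apply/edge_pairsP; split=> //=; exact: FE_super eF EK sub.
  + by rewrite /= eqxx /=; apply/asboolP.
  have -> : X e = (5 / 4 * Num.sqrt (area e.1))%:E * int_edge o e.2 (jsq T v E).
    rewrite /X; congr (_ * _); apply: eq_int_edge => x; rewrite /jsq.
    have -> : pw_grad (v \o par) = pw_grad v \o par by [].
    (* The sign of the direction disappears in the square, and so does that of the jump below. *)
    have eqJ : forall J : plane R, (dot J (n e.2) ^+ 2 = dot J (n E) ^+ 2)%R.
      move=> J; have [->//|->] := nE.2 _ _ (edge_card2 EK) (edge_card2 (FE_sub eF)) sub.
      by rewrite /dot !planeE; ring.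
    rewrite eqJ; case: (EJ x) => -> //.
    by rewrite /dot !planeE; ring.
  rewrite /B; apply: lee_wpmul2r.
    by apply: int_edge_ge0 => x; exact: sqr_ge0.
  by rewrite lee_fin; apply: young_edge => //; exact: area_ge0.
- move=> [K E] /edge_pairsP[/= KS EK].
  have KT : K \in T by move: KS; rewrite in_fsetD => /andP[].
  rewrite /B /= -ge0_sume_distrr; last first.
    by move=> e _; apply: int_edge_ge0 => x; exact: sqr_ge0.
  rewrite -big_filter muleA -EFinM; apply: lee_wpmul2l; first by rewrite lee_fin.
  apply: (sum_subedges ho tT' (nT KT) (FE_sub EK)).
  + by rewrite filter_uniq// edge_pairs_uniq.
  + move=> e; rewrite mem_filter => /andP[/andP[/eqP <- /asboolP sub]].
    move=> /edge_pairsP[/refined_parent[eT _ _] /FE_sub eE].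
    by split=> //; exact: (hpar eT).2.
  + exact: measurable_jump_dot.
  + by move=> x; exact: sqr_ge0.
Qed.

End EdgeFamily.

End Reduction.

Lemma bisections_shape_regular (R : realType) (C : R) (T T' : {fset triangle R}) :
  (forall K, K \in T -> shape_regular C K) -> bisections T T' ->
  forall K', K' \in T' -> shape_regular C K'.
Proof.
move=> shT bis K' /(bisections_ancestor bis)[K /shT sK].
exact: shape_regular_descendant sK.
Qed.

(** The three terms are the volume residual, the normal jumps and the tangential jumps. The sign
    conditions serve distributivity in the extended reals. *)
Lemma sum3_reduction (R : realType) (r c1 c2 c3 : R)
    (X1 X2 X3 Y1 Y2 Y3 D G : \bar R) :
  0 <= c1 -> 0 <= c2 -> 0 <= c3 -> (0 <= D)%E ->
  (0 <= Y1)%E -> (0 <= Y2)%E -> (0 <= Y3)%E ->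
  (X1 <= r%:E * Y1 + c1%:E * D)%E -> (X2 <= r%:E * Y2 + c2%:E * D)%E ->
  (X3 <= r%:E * Y3 + c3%:E * D)%E -> (D <= G)%E ->
  (X1 + X2 + X3 <= r%:E * (Y1 + Y2 + Y3) + (c1 + c2 + c3)%:E * G)%E.
Proof.
move=> c10 c20 c30 D0 Y10 Y20 Y30 h1 h2 h3 DG.
apply: le_trans (leeD (leeD h1 h2) h3) _.
rewrite !(ge0_muleDr r%:E) ?adde_ge0//.
apply: (@le_trans _ _ (r%:E * Y1 + r%:E * Y2 + r%:E * Y3 + (c1 + c2 + c3)%:E * D)%E).
  rewrite !EFinD !ge0_muleDl ?lee_fin ?addr_ge0// ?adde_ge0 ?lee_fin//.
  by rewrite (addeACA (r%:E * Y1)%E) (addeACA (r%:E * Y1 + r%:E * Y2)%E).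
by rewrite leeD2l// lee_wpmul2l// lee_fin !addr_ge0.
Qed.

Theorem lemma8p2 (R : realType) (Om : set (plane R))
    (hOm : polygonal_lipschitz_domain Om)
    (o : ordering R) (ho : edge_ordering Om o)
    (k : nat) (hk1 : (1 <= k)%N) (hk : odd k)
    (T0 : {fset triangle R}) (hT0 : triangulation Om T0)
    (f : plane R -> R) (hf : L2 Om f) :
  exists rho2 Lambda2 : R,
    [/\ 0 < rho2, rho2 < 1, 0 < Lambda2 &
     forall T T' : {fset triangle R},
       nvb_refinement Om T0 T -> nvb_refinement Om T T' ->
     forall v v' : pwpoly R, CR0 k o T v -> CR0 k o T' v' ->
       (eta2 Om o T' v' f (T' `\` T)%fset
        <= rho2%:E * eta2 Om o T v f (T `\` T')%fset
           + Lambda2%:E * grad_dist2 Om T v T' v')%E].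
Proof.
have nT0 := triangulation_nondegenerate hT0.
have [C C0 shT0] := fset_shape_regular nT0.
have [C1 C10 lap] := laplacian_estimate k C0.
have [C2 C20 tr] := trace_estimate Om k C0.
(* One summand each for the volume terms, the normal jumps and the tangential jumps. All constants
   depend on [T0] only through its shape regularity, which every refinement inherits. *)
pose L := 5 * C1 + 320 * C2 + 320 * C2.
have L0 : 0 < L by rewrite /L; lra.
exists (9 / 10), L; split; [lra|lra|exact: L0|].
move=> T T' [bis0 tT] [bis tT'] v v' [kv _] [kv' _].
have shT := bisections_shape_regular shT0 bis0.
(* A parent for every fine triangle; outside [T'] the value is arbitrary. *)
have /choice[par hpar] : forall K', exists K, K' \in T' -> K \in T /\ descendant K K'.
  move=> K'; have [K'T'|nK'] := boolP (K' \in T'); last by exists K'.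
  by have [K KT dK] := bisections_ancestor bis K'T'; exists K.
have mf : measurable_fun setT f by case: hf.
have tr' := tr o ho.
have vol := volume_reduction tT tT' hpar shT kv kv' mf C10 lap.
have edN := @edge_reduction _ _ _ ho _ _ tT tT' bis _ hpar _ _ shT _ _ kv kv'
  (normal o) (interior_edges Om) C2 (normal_edge_field ho) _ _ C20 tr'.
have edT := @edge_reduction _ _ _ ho _ _ tT tT' bis _ hpar _ _ shT _ _ kv kv'
  (tangent o) (@edges R) C2 (tangent_edge_field ho) _ _ C20 tr'.
have ie1 K E : E \in interior_edges Om K -> E \in edges K.
  by rewrite !inE => /andP[].
have ie2 K K' E E' : E' \in interior_edges Om K' -> E \in edges K ->
    hull E' `<=` hull E -> E \in interior_edges Om K.
  move=> /[!inE]/andP[_ nb] -> sub /=; apply: contra nb => /asboolP b.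
  by apply/asboolP; exact: subset_trans b.
have N := edN ie1 ie2; have Tg := edT (fun _ _ => id) (fun _ _ _ _ _ EK _ => EK).
have sum := sum_defect_le tT tT' hpar v v' (pld_open hOm) (pld_lipschitz hOm).
have d0 : (0 <= \sum_(K' <- T') defect_norm2 par v v' K')%E.
  by apply: sume_ge0 => K' _; exact: defect_norm2_ge0.
have ie U (u : pwpoly R) (n : edge R -> plane R) E :
    (0 <= int_edge o E (fun x => dot (jump o U (pw_grad u) E x) (n E) ^+ 2)%R)%E.
  by apply: int_edge_ge0 => x; exact: sqr_ge0.
have eN K (B : {fset edge R}) (n : edge R -> plane R) : (0 <= (Num.sqrt (area K))%:E *
    \sum_(E <- B) int_edge o E (fun x => dot (jump o T (pw_grad v) E x) (n E) ^+ 2)%R)%E.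
  by rewrite mule_ge0 ?sume_ge0// lee_fin sqrtr_ge0.
have c1 : (0 <= 5 * C1)%R := mulr_ge0 (ler0n R 5) (ltW C10).
have c2 : (0 <= 320 * C2)%R := mulr_ge0 (ler0n R 320) (ltW C20).
have main := sum3_reduction c1 c2 c2 d0 _ _ _ vol N Tg sum.
rewrite /eta2 /mu2 /nu2 !big_split/= /L.
apply: main; apply: sume_ge0 => K _ //.
by rewrite mule_ge0 ?lee_fin ?area_ge0// int2_ge0// => x; exact: sqr_ge0.
Qed.
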